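(* Let $k,l$ be natural numbers with $1<k\le l$ and let $m=k+l-1$. Every $112m^2$-edge-connected simple graph whose number of edges is divisible by $m$ has an $S(k,l)$-decomposition.
   Context: $S(k,l)$ denotes the bistar: the tree consisting of two adjacent vertices of degrees $k$ and $l$ respectively, all other vertices being leaves. An $H$-decomposition of a graph $G$ is a partition of $E(G)$ into subgraphs isomorphic to $H$. *)

(* Defs.v *)
From mathcomp Require Import all_boot.
Set Implicit Arguments. Unset Strict Implicit. Unset Printing Implicit Defensive.

(* A simple graph on a finite vertex type T is a symmetric irreflexive
   relation g; edges are 2-element vertex sets. *)
Definition edges (T : finType) (g : rel T) : {set {set T}} :=
  [set [set p.1; p.2] | p in [set p : T * T | g p.1 p.2]].

Definition spans_connected (T : finType) (D : {set {set T}}) : Prop :=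
  forall x y : T, connect (fun a b => [set a; b] \in D) x y.

Definition edge_connected (T : finType) (g : rel T) (n : nat) : Prop :=
  1 < #|T| /\
  forall F : {set {set T}}, F \subset edges g -> #|F| < n ->
    spans_connected (edges g :\: F).

(* The bistar S(k,l) on vertex set {0,...,k+l-1}: centres 0 and 1 are
   adjacent; 0 has the k-1 further leaves 2..k, 1 has the l-1 further
   leaves k+1..k+l-1.  So deg 0 = k, deg 1 = l. *)
Definition bistar_arc (k l i j : nat) : bool :=
  [|| (i == 0) && (j == 1),
      (i == 0) && (2 <= j <= k)
    | (i == 1) && (k < j < k + l)].

Arguments bistar_arc : clear implicits.
Definition bistar_rel (k l : nat) : rel 'I_(k + l) :=
  fun x y => bistar_arc k l x y || bistar_arc k l y x.

Arguments bistar_rel : clear implicits.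

Definition bistar_copy (k l : nat) (T : finType) (H : {set {set T}}) : Prop :=
  exists f : 'I_(k + l) -> T, injective f /\
    H = [set [set f p.1; f p.2] |
           p in [set p : 'I_(k + l) * 'I_(k + l) | bistar_rel k l p.1 p.2]].

Definition bistar_decomposition (k l : nat) (T : finType) (g : rel T)
    (P : {set {set {set T}}}) : Prop :=
  partition P (edges g) /\ forall H, H \in P -> bistar_copy k l H.

(* Main.v *)
(* Write m = k + l - 1.  A maximum cut (A, B) leaves a bipartite graph that is still
   56m^2-edge-connected.  Bistars are removed greedily from the graphs inside A and inside B until
   every remaining inner edge can be charged to an endpoint carrying fewer than m such edges.  By
   packing connected spanning layers, the cut graph is split into three parts, two of
   edge-connectivity 6m^2 (directed A -> B and B -> A) and one of edge-connectivity 9m, whose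
   orientation modulo m makes the number of edges charged to each vertex divisible by m.

   It remains to decompose a bipartite graph together with the inner edges charged to one side B.
   A near-constant edge weighting, corrected by an orientation modulo 2mk of the highly connected
   part, is rounded to a subgraph H in which the degrees are multiples of k; a second rounding
   chooses one k-th of H as the central edges of the bistars, the rest of H gives the leaves of
   the centres in A, and the edges outside H together with the inner edges give the leaves of the
   centres in B.  A balanced bipartition of the central edges separates those that receive inner
   edges from those that are used to avoid coincidences between leaves.

   Orientations modulo 2K exist in 9K-edge-connected graphs by induction: one contracts a small
   cut, or lifts pairs of edges at a vertex, or deletes an edge.  Lovász splitting extends this to
   orientations balanced at the vertices of one side. *)
Require Import Defs.
From mathcomp Require Import all_boot all_order all_algebra.
From mathcomp Require Import zify lra ring.
Set Implicit Arguments. Unset Strict Implicit. Unset Printing Implicit Defensive.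

(** * Weighted graphs, degrees and cuts *)

(** A bistar with central edge ab, a in A and b outside A, takes its k-1 further edges at a from H,
    and its l-1 further edges at b from outside H. So a vertex of A only needs an H-degree divisible
    by k, which the choice of H can arrange, whereas at b the number of edges charged to b must be a
    multiple of m: if it is [m * q b] and the H-degree is [k * q b], there are [q b] centres and
    exactly [(l - 1) * q b] edges for their leaves. This is why a residue is prescribed only at the
    vertices that are charged, and why the graph is cut into two halves charged to opposite sides.
    The leaves of a lie outside A, those of b lie in A unless they come from inner edges, so only
    inner edges can make the two leaf sets meet. Fewer than m of them are charged to b, hence two
    centres can absorb them, and the other centres at a leave enough freedom to avoid a coincidence.
    In the induction for modular orientations, contracting a small cut returns its edges already
    oriented. The instances therefore carry from the start a vertex z with prescribed arcs, whose
    degree has to stay bounded. *)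

Definition arc1 (T : eqType) (u v x y : T) : nat := (x == u) && (y == v).
Definition edge1 (T : eqType) (u v x y : T) : nat := arc1 u v x y + arc1 v u x y.
Definition deg (T : finType) (w : T -> T -> nat) (x : T) := \sum_y w x y.
Definition cut (T : finType) (w : T -> T -> nat) (X : {set T}) :=
  \sum_x \sum_y w x y * ((x \in X) && (y \notin X)).

Lemma arc1C (T : eqType) (u v x y : T) : arc1 u v x y = arc1 v u y x.
Proof. by rewrite /arc1 andbC. Qed.

Lemma edge1C (T : eqType) (u v x y : T) : edge1 u v x y = edge1 u v y x.
Proof. by rewrite /edge1 arc1C addnC [arc1 v u x y]arc1C. Qed.

Lemma edge1CC (T : eqType) (u v x y : T) : edge1 u v x y = edge1 v u x y.
Proof. by rewrite /edge1 addnC. Qed.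

Lemma big_optionE (R : Type) (idx : R) (op : Monoid.com_law idx) (I : finType) (F : option I -> R) :
  \big[op/idx]_i F i = op (F None) (\big[op/idx]_i F (Some i)).
Proof.
rewrite (bigD1 None) //=; congr (op _ _).
rewrite (reindex_omap Some id) => [|[i|]] //=.
by apply: eq_bigl => i; rewrite eqxx.
Qed.

Section Weights.
Variable T : finType.
Implicit Types (w : T -> T -> nat) (X Y Z : {set T}).

Lemma sum_eqb (x : T) : \sum_y ((y == x) : nat) = 1.
Proof. by rewrite (bigD1 x) //= eqxx big1 // => y /negPf ->. Qed.

Lemma sum_arc1_out (u v x : T) : \sum_y arc1 u v x y = (x == u).
Proof.
rewrite /arc1; case: (x == u) => /=; last by rewrite big1.
exact: sum_eqb.
Qed.

Lemma sum_arc1_in (u v x : T) : \sum_y arc1 u v y x = (x == v).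
Proof.
rewrite /arc1; case: (x == v) => /=; last by rewrite big1 // => i _; rewrite andbF.
by under eq_bigr do rewrite andbT; exact: sum_eqb.
Qed.

Lemma deg_edge1 (u v x : T) : deg (edge1 u v) x = (x == u) + (x == v).
Proof. by rewrite /deg /edge1 big_split /= !sum_arc1_out. Qed.

Lemma eq_deg w w' x : (forall y, w x y = w' x y) -> deg w x = deg w' x.
Proof. by move=> e; apply: eq_bigr => y _; rewrite e. Qed.

Lemma degD w w' x : deg (fun a b => w a b + w' a b) x = deg w x + deg w' x.
Proof. by rewrite /deg big_split. Qed.

Lemma eq_cut w w' X : (forall x y, w x y = w' x y) -> cut w X = cut w' X.
Proof. by move=> e; apply: eq_bigr => x _; apply: eq_bigr => y _; rewrite e. Qed.

Lemma cutD w w' X : cut (fun a b => w a b + w' a b) X = cut w X + cut w' X.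
Proof.
rewrite /cut -big_split; apply: eq_bigr => x _; rewrite -big_split.
by apply: eq_bigr => y _; rewrite mulnDl.
Qed.

Lemma cut_le w w' X : (forall x y, w x y <= w' x y) -> cut w X <= cut w' X.
Proof. by move=> e; do 2!apply: leq_sum => ? _; rewrite leq_mul2r e orbT. Qed.

Lemma sum_arc1_mul (u v : T) (F : T -> T -> nat) :
  \sum_x \sum_y arc1 u v x y * F x y = F u v.
Proof.
rewrite (bigD1 u) //= [X in _ + X]big1 ?addn0; last first.
  by move=> i /negPf n; apply: big1 => j _; rewrite /arc1 n.
rewrite (bigD1 v) //= [X in _ + X]big1 ?addn0; last first.
  by move=> i /negPf n; rewrite /arc1 n andbF.
by rewrite /arc1 !eqxx mul1n.
Qed.

Lemma cut_arc1 (u v : T) X : cut (arc1 u v) X = ((u \in X) && (v \notin X)).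
Proof. exact: (sum_arc1_mul u v (fun x y => (x \in X) && (y \notin X))). Qed.

Lemma cut_edge1 (u v : T) X : cut (edge1 u v) X = ((u \in X) (+) (v \in X)).
Proof. by rewrite cutD !cut_arc1; do 2!case: (_ \in X). Qed.

Lemma cut_xor w X : (forall x y, w x y = w y x) ->
  (cut w X).*2 = \sum_x \sum_y w x y * ((x \in X) (+) (y \in X)).
Proof.
move=> sw; rewrite -addnn {2}/cut exchange_big /= -big_split /=.
apply: eq_bigr => x _; rewrite -big_split /=; apply: eq_bigr => y _.
by rewrite (sw y x) -mulnDr; do 2!case: (_ \in X).
Qed.

Lemma cutC w X : (forall x y, w x y = w y x) -> cut w (~: X) = cut w X.
Proof.
move=> sw; apply: double_inj; rewrite !cut_xor //.
by do 2!(apply: eq_bigr => ? _); rewrite !inE; do 2!case: (_ \in X).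
Qed.

Lemma cut1 w x : (forall z, w z z = 0) -> cut w [set x] = deg w x.
Proof.
move=> iw; rewrite /cut (bigD1 x) //= [X in _ + X]big1 ?addn0; last first.
  by move=> i /negPf n; apply: big1 => j _; rewrite !inE n muln0.
apply: eq_bigr => y _; rewrite !inE eqxx /=; case: eqP => [->|]; rewrite ?muln1 //.
by rewrite iw.
Qed.

Lemma cut_posimod w X Y : (forall x y, w x y = w y x) ->
  cut w (X :\: Y) + cut w (Y :\: X) <= cut w X + cut w Y.
Proof.
move=> sw; rewrite -leq_double !doubleD !cut_xor // -!big_split /=.
apply: leq_sum => x _; rewrite -!big_split /=; apply: leq_sum => y _.
rewrite -!mulnDr leq_mul2l; apply/orP; right.
by rewrite !inE; do 4!case: (_ \in _).
Qed.

Lemma cut_submod w X Y :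
  cut w (X :&: Y) + cut w (X :|: Y) <= cut w X + cut w Y.
Proof.
rewrite /cut -!big_split /=.
apply: leq_sum => x _; rewrite -!big_split /=; apply: leq_sum => y _.
rewrite -!mulnDr leq_mul2l; apply/orP; right.
by rewrite !inE; do 4!case: (_ \in _).
Qed.

Lemma cut_set0 w : cut w set0 = 0.
Proof. by rewrite /cut big1 // => i _; rewrite big1 // => j _; rewrite inE muln0. Qed.

End Weights.

(** * Orientations and liftings *)

Section Ori.
Variable T : finType.
Implicit Types (w o : T -> T -> nat) (zo zi : T -> nat) (f : T -> int).

Definition net o (v : T) : int := ((\sum_y o v y)%:Z - (\sum_y o y v)%:Z)%R.

(* Besides the edges of w there is a distinguished vertex z outside T, whose edges are already
   oriented: [zo v] of them go from z to v and [zi v] go from v to z. *)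
Definition Ori w zo zi f := exists o : T -> T -> nat,
  (forall x y, o x y + o y x = w x y) /\
  (forall v, f v = (net o v + (zi v)%:Z - (zo v)%:Z)%R).

Lemma net_add o u v (x : T) :
  net (fun a b => o a b + arc1 u v a b) x =
  (net o x + (x == u)%:Z - (x == v)%:Z)%R.
Proof.
by rewrite /net !big_split /= sum_arc1_out sum_arc1_in; lia.
Qed.

Lemma Ori_ext w w' zo zo' zi zi' f f' :
  (forall x y, w x y = w' x y) -> (forall x, zo x = zo' x) -> (forall x, zi x = zi' x) ->
  (forall x, f x = f' x) -> Ori w zo zi f -> Ori w' zo' zi' f'.
Proof.
move=> ew eo ei ef [o [ow of_]]; exists o; split=> [x y|v]; first by rewrite -ew.
by rewrite -ef -eo -ei.
Qed.

Lemma Ori_del w w' zo zi f u v :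
  (forall x y, w x y = w' x y + edge1 u v x y) ->
  Ori w' zo zi f -> Ori w zo zi (fun x => f x + (x == u)%:Z - (x == v)%:Z)%R.
Proof.
move=> ew [o [ow of_]]; exists (fun a b => o a b + arc1 u v a b); split=> [x y|x].
  by rewrite ew -ow /edge1 [arc1 u v y x]arc1C; lia.
by rewrite net_add of_; lia.
Qed.

Lemma Ori_zi w zo zi f zi' f' :
  (forall x, f' x = f x + (zi' x)%:Z - (zi x)%:Z)%R ->
  Ori w zo zi f -> Ori w zo zi' f'.
Proof.
by move=> ef [o [ow of_]]; exists o; split=> // v; rewrite ef of_; lia.
Qed.

Lemma Ori_zo w zo zi f zo' f' :
  (forall x, f' x = f x - (zo' x)%:Z + (zo x)%:Z)%R ->
  Ori w zo zi f -> Ori w zo' zi f'.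
Proof.
by move=> ef [o [ow of_]]; exists o; split=> // v; rewrite ef of_; lia.
Qed.

(** An arc between p and r is rerouted through x in its own direction; x gains one arc in and one
    arc out, so no net degree changes. *)
Lemma Ori_lift w w' zo zi f x p r :
  p != r ->
  (forall a b, w a b + edge1 p r a b = w' a b + edge1 x p a b + edge1 x r a b) ->
  0 < w' p r -> Ori w' zo zi f -> Ori w zo zi f.
Proof.
move=> npr ew; suff H : forall p r, p != r ->
  (forall a b, w a b + edge1 p r a b = w' a b + edge1 x p a b + edge1 x r a b) ->
  forall o, (forall a b, o a b + o b a = w' a b) -> (forall v, f v = (net o v + (zi v)%:Z - (zo v)%:Z)%R) ->
  0 < o p r -> Ori w zo zi f.
  move=> wp [o [ow of_]].
  have : (0 < o p r) || (0 < o r p) by move: wp; rewrite -ow; lia.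
  case/orP => h; first exact: (H p r npr ew o).
  apply: (H r p _ _ o) => //; first by rewrite eq_sym.
  by move=> a b; move: (ew a b); rewrite [edge1 p r a b]edge1CC; lia.
move=> {npr ew} {}p {}r npr ew o ow of_ opr.
exists (fun a b => o a b - arc1 p r a b + arc1 p x a b + arc1 x r a b).
have os : forall a b, o a b - arc1 p r a b + arc1 p r a b = o a b.
  move=> a b; rewrite subnK // /arc1; case: eqP => [->|] //=; case: eqP => [->|] //=.
split=> [a b|v].
  move: (ew a b) (os a b) (os b a); rewrite -ow /edge1.
  by rewrite [arc1 p r b a]arc1C [arc1 p x b a]arc1C [arc1 x r b a]arc1C; lia.
rewrite of_ !net_add.
have -> : net o v = net (fun a b => o a b - arc1 p r a b + arc1 p r a b) v.
  by rewrite /net; under eq_bigr do rewrite -os; under [in X in (_ - X)%R]eq_bigr do rewrite -os.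
by rewrite net_add; lia.
Qed.

(** The two parallel edges get opposite directions and cancel. *)
Lemma Ori_loop w w' zo zi f x p :
  (forall a b, w a b = w' a b + edge1 x p a b + edge1 x p a b) ->
  Ori w' zo zi f -> Ori w zo zi f.
Proof.
move=> ew h; have h1 := @Ori_del (fun a b => w' a b + edge1 x p a b) w' zo zi f x p (fun _ _ => erefl) h.
have := @Ori_del w (fun a b => w' a b + edge1 x p a b) zo zi _ p x _ h1.
have e : forall a b, w a b = w' a b + edge1 x p a b + edge1 p x a b.
  by move=> a b; rewrite ew /edge1; lia.
move/(_ e); apply: Ori_ext => // y; lia.
Qed.

Lemma Ori_liftzo w w' zo zo' zi f x r : x != r ->
  (forall a b, w a b = w' a b + edge1 x r a b) ->
  (forall a, zo a + (a == r) = zo' a + (a == x)) ->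
  Ori w' zo' zi f -> Ori w zo zi f.
Proof.
move=> nxr ew eo h; move: (Ori_del ew h); apply: Ori_zo => a.
by move: (eo a); lia.
Qed.

Lemma Ori_liftzi w w' zo zi zi' f x r : x != r ->
  (forall a b, w a b = w' a b + edge1 x r a b) ->
  (forall a, zi a + (a == r) = zi' a + (a == x)) ->
  Ori w' zo zi' f -> Ori w zo zi f.
Proof.
move=> nxr ew eo h.
have ew' : forall a b, w a b = w' a b + edge1 r x a b by move=> a b; rewrite ew edge1CC.
move: (Ori_del ew' h); apply: Ori_zi => a.
by move: (eo a); lia.
Qed.

End Ori.

Definition wsym (T : finType) (w : T -> T -> nat) :=
  (forall x y, w x y = w y x) /\ forall x, w x x = 0.

Definition tdeg (T : finType) (w : T -> T -> nat) (zo zi : T -> nat) v :=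
  deg w v + zo v + zi v.

(** The boundary of A in the graph with z added, z counting as outside A. *)
Definition bcut (T : finType) (w : T -> T -> nat) (zo zi : T -> nat) (A : {set T}) :=
  cut w A + \sum_(u in A) (zo u + zi u).

Section Lift.
Variable T : finType.
Implicit Types (w o : T -> T -> nat) (zo zi : T -> nat) (f : T -> int).

(** The effect of any number of liftings at x. The monotonicity clauses ensure that a set avoiding x
    loses at most its edges towards x from its boundary; the last clause pulls orientations back. *)
Record lifted (x : T) w zo zi w' zo' zi' : Prop := Lifted {
  lf_sym : wsym w';
  lf_deg : forall u, u != x -> tdeg w' zo' zi' u = tdeg w zo zi u;
  lf_zo : \sum_u zo' u = \sum_u zo u;
  lf_zi : \sum_u zi' u = \sum_u zi u;
  lf_w : forall u y, u != x -> y != x -> w u y <= w' u y;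
  lf_zole : forall u, u != x -> zo u <= zo' u;
  lf_zile : forall u, u != x -> zi u <= zi' u;
  lf_ori : forall f, Ori w' zo' zi' f -> Ori w zo zi f }.

Lemma lifted_refl x w zo zi : wsym w -> lifted x w zo zi w zo zi.
Proof. by split. Qed.

Lemma lifted_trans x w zo zi w1 zo1 zi1 w2 zo2 zi2 :
  lifted x w zo zi w1 zo1 zi1 -> lifted x w1 zo1 zi1 w2 zo2 zi2 ->
  lifted x w zo zi w2 zo2 zi2.
Proof.
move=> [s1 d1 o1 i1 w1le zo1le zi1le or1] [s2 d2 o2 i2 w2le zo2le zi2le or2].
split=> //; rewrite ?o2 ?i2 // => *.
- by rewrite d2 // d1.
- by apply: leq_trans (w1le _ _ _ _) (w2le _ _ _ _).
- by apply: leq_trans (zo1le _ _) (zo2le _ _).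
- by apply: leq_trans (zi1le _ _) (zi2le _ _).
- exact/or1/or2.
Qed.

(** [None] stands for z, so that z is treated like any other neighbour. *)
Definition nb w zo zi (x : T) (i : option T) : nat :=
  if i is Some u then w x u else zo x + zi x.

Lemma sum_addeq (g g' : T -> nat) (r x : T) :
  (forall a, g a + (a == r) = g' a + (a == x)) -> \sum_u g' u = \sum_u g u.
Proof.
move=> e; have : \sum_a (g a + (a == r)) = \sum_a (g' a + (a == x)).
  by apply: eq_bigr.
by rewrite !big_split /= !sum_eqb; lia.
Qed.

Lemma deg_addeq w w' (h h' : T -> T -> nat) u :
  (forall a b, w a b + h a b = w' a b + h' a b) -> deg w u + deg h u = deg w' u + deg h' u.
Proof. by move=> e; rewrite -!degD; apply: eq_bigr => b _; apply: e. Qed.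

Lemma lift_step_vv w zo zi x p r : wsym w -> p != r -> 0 < w x p -> 0 < w x r ->
  exists w', lifted x w zo zi w' zo zi /\
    forall a b, w a b + edge1 p r a b = w' a b + edge1 x p a b + edge1 x r a b.
Proof.
move=> [sw iw] npr wp wr.
have nxp : x != p by apply: contraL wp => /eqP <-; rewrite iw.
have nxr : x != r by apply: contraL wr => /eqP <-; rewrite iw.
pose w' a b := w a b + edge1 p r a b - (edge1 x p a b + edge1 x r a b).
have ew a b : w a b + edge1 p r a b = w' a b + edge1 x p a b + edge1 x r a b.
  rewrite -addnA /w' subnK // /edge1 /arc1.
  have [->|nax] := altP (a =P x).
    rewrite (negPf nxp) (negPf nxr) /=.
    have [->|nbp] := altP (b =P p); first by rewrite (negPf npr) /=; lia.
    by have [->|_] := altP (b =P r); lia.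
  rewrite /= ?addn0.
  have [->|nap] := altP (a =P p).
    have [->|nbx] := altP (b =P x); rewrite ?andbF /=; rewrite ?(negPf npr) /=; try lia.
    by rewrite sw; lia.
  have [->|nar] := altP (a =P r); rewrite /=; last lia.
  by have [->|nbx] := altP (b =P x); rewrite ?andbF /=; rewrite 1?sw; lia.
exists w'; split=> //; split=> //.
- split=> [a b|a].
    by move: (ew a b) (ew b a); rewrite sw (edge1C p) (edge1C x p) (edge1C x r); lia.
  move: (ew a a); rewrite iw /edge1 /arc1.
  have [->|_] := altP (a =P p); first by rewrite (negPf npr) /=; lia.
  by rewrite /= add0n andbF; lia.
- move=> u nu; rewrite /tdeg; move: (deg_addeq u (fun a b => (etrans (ew a b) (esym (addnA _ _ _))))).
  by rewrite (degD (edge1 x p) (edge1 x r)) !deg_edge1 (negPf nu); lia.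
- move=> u y nu ny; move: (ew u y); rewrite /edge1 /arc1 (negPf nu) (negPf ny) /= !andbF; clear; lia.
move=> f; apply: (Ori_lift npr ew).
move: (ew p r); rewrite /edge1 /arc1 !eqxx /= [p == x]eq_sym [r == x]eq_sym (negPf nxp) (negPf nxr) /= andbF; lia.
Qed.

Lemma lift_step_vz w zo zi x r : wsym w -> 0 < zo x + zi x -> 0 < w x r ->
  exists w' zo' zi', lifted x w zo zi w' zo' zi' /\
    [/\ (forall a b, w a b = w' a b + edge1 x r a b),
     zo' x + zi' x = (zo x + zi x).-1 & forall a, zo' a + zi' a + (a == x) = zo a + zi a + (a == r)].
Proof.
move=> [sw iw] wz wr.
have nxr : x != r by apply: contraL wr => /eqP <-; rewrite iw.
pose w' a b := w a b - edge1 x r a b.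
have ew a b : w a b = w' a b + edge1 x r a b.
  rewrite /w' subnK // /edge1 /arc1.
  have [->|nax] := altP (a =P x).
    rewrite (negPf nxr) /=.
    by have [->|_] := altP (b =P r); lia.
  have [->|nar] := altP (a =P r); rewrite /=; last lia.
  by have [->|nbx] := altP (b =P x); rewrite 1?sw; lia.
have sw' : wsym w'.
  split=> [a b|a]; first by move: (ew a b) (ew b a); rewrite sw edge1C; lia.
  by move: (ew a a); rewrite iw; lia.
have lew u y : u != x -> y != x -> w u y <= w' u y.
  by move=> nu ny; move: (ew u y); rewrite /edge1 /arc1 (negPf nu) (negPf ny) /= !andbF; lia.
have dg u : u != x -> deg w u = deg w' u + (u == r).
  move=> nu.
  have -> : deg w u = deg (fun a b => w' a b + edge1 x r a b) u by apply: eq_deg.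
  by rewrite degD deg_edge1 (negPf nu).
case: (posnP (zo x)) => [zo0|zop]; last first.
  pose zo' a := zo a + (a == r) - (a == x).
  have eo a : zo a + (a == r) = zo' a + (a == x).
    by rewrite /zo' subnK //; case: eqP => [->|]; lia.
  exists w', zo', zi; split; last split=> //.
  - split=> //; rewrite ?(sum_addeq eo) //.
    + by move=> u nu; rewrite /tdeg dg //; move: (eo u); rewrite (negPf nu); lia.
    + by move=> u nu; move: (eo u); rewrite (negPf nu); lia.
    by move=> f; apply: (Ori_liftzo nxr ew eo).
  - by move: (eo x); rewrite eqxx (negPf nxr); lia.
  by move=> a; move: (eo a); lia.
pose zi' a := zi a + (a == r) - (a == x).
have ei a : zi a + (a == r) = zi' a + (a == x).
  by rewrite /zi' subnK //; case: eqP => [->|]; lia.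
exists w', zo, zi'; split; last split=> //.
- split=> //; rewrite ?(sum_addeq ei) //.
  + by move=> u nu; rewrite /tdeg dg //; move: (ei u); rewrite (negPf nu); lia.
  + by move=> u nu; move: (ei u); rewrite (negPf nu); lia.
  by move=> f; apply: (Ori_liftzi nxr ew ei).
- by move: (ei x); rewrite eqxx (negPf nxr); lia.
by move=> a; move: (ei a); lia.
Qed.

Lemma sum_nb w zo zi x : \sum_i nb w zo zi x i = tdeg w zo zi x.
Proof. by rewrite big_optionE /= /tdeg /deg; lia. Qed.

Lemma lift_step w zo zi x i j : wsym w -> i != j ->
  0 < nb w zo zi x i -> 0 < nb w zo zi x j ->
  exists w' zo' zi', [/\ lifted x w zo zi w' zo' zi',
   forall h, nb w zo zi x h = nb w' zo' zi' x h + (h == i) + (h == j) &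
   forall A, bcut w zo zi A <= bcut w' zo' zi' A + 2].
Proof.
(* i and j differ, so at most one of them is z; by symmetry it is i. *)
move=> sw; wlog: i j / (j != None).
  move=> H nij wi wj; case: (altP (j =P None)) => [jN|jN]; last exact: H.
  have iN : i != None by rewrite -jN.
  have nji : j != i by rewrite eq_sym.
  have [w' [zo' [zi' [l h b]]]] := H j i iN nji wj wi.
  by exists w', zo', zi'; split=> // y; rewrite h addnAC.
case: j => // r _; case: i => [p|] nij wi wr.
  have npr : p != r by [].
  have [w' [l ew]] := lift_step_vv zo zi sw npr wi wr.
  exists w', zo, zi; split=> //; last first.
    move=> A; have := eq_cut A (fun a b => etrans (ew a b) (esym (addnA _ _ _))).
    by rewrite !cutD !cut_arc1 /bcut; do 3!case: (_ \in A); lia.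
  move=> -[u|] /=; last by lia.
  have [_ iw] := sw.
  have nxp : x != p by apply: contraL wi => /eqP <-; rewrite /= iw.
  have nxr : x != r by apply: contraL wr => /eqP <-; rewrite /= iw.
  move: (ew x u); rewrite /edge1 /arc1 eqxx (negPf nxp) (negPf nxr) /= !addn0.
  exact.
have [w' [zo' [zi' [l [ew e0 ez]]]]] := lift_step_vz sw wi wr.
exists w', zo', zi'; split=> //; last first.
  move=> A; rewrite /bcut (eq_cut A ew) !cutD !cut_arc1.
  have : \sum_(a in A) (zo' a + zi' a + (a == x)) = \sum_(a in A) (zo a + zi a + (a == r)).
    by apply: eq_bigr.
  rewrite !(big_split _ _ _ _ (fun a => (a == _) : nat)) /=.
  have sA (z : T) : \sum_(a in A) (a == z) = (z \in A).
    rewrite -[RHS]mul1n -(sum_eqb z) big_distrl /= [LHS]big_mkcond /=.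
    by apply: eq_bigr => a _; case: eqP => [->|_]; case: ifP; rewrite ?mul0n ?mul1n.
  by rewrite !sA; do 2!case: (_ \in A); lia.
move=> -[u|] /=; last by move: wi; rewrite e0 /=; lia.
have [_ iw] := sw.
have nxr : x != r by apply: contraL wr => /eqP <-; rewrite /= iw.
move: (ew x u); rewrite /edge1 /arc1 eqxx (negPf nxr) /= !addn0; exact.
Qed.

(** Greedy: the most frequent neighbour is always paired with another one, which keeps every
    multiplicity at most half of the degree. *)
Lemma full_lift w zo zi x : wsym w -> ~~ odd (tdeg w zo zi x) ->
  (forall i, (nb w zo zi x i).*2 <= tdeg w zo zi x) ->
  exists w' zo' zi', [/\ lifted x w zo zi w' zo' zi', (forall u, w' x u = 0),
    zo' x = 0 & zi' x = 0].
Proof.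
move: {2}(tdeg w zo zi x) (leqnn (tdeg w zo zi x)) => n.
elim: n w zo zi => [|n IH] w zo zi.
  rewrite leqn0 -sum_nb => /eqP s0 sw _ _.
  exists w, zo, zi; split; first exact: lifted_refl.
  - move=> u; move: s0 => /eqP; rewrite sum_nat_eq0 => /forallP/(_ (Some u)) /=.
    by move/eqP.
  - move: s0 => /eqP; rewrite sum_nat_eq0 => /forallP/(_ None) /= /eqP; lia.
  move: s0 => /eqP; rewrite sum_nat_eq0 => /forallP/(_ None) /= /eqP; lia.
move=> len sw ev hb.
have [s0|spos] := posnP (tdeg w zo zi x); first by apply: IH => //; rewrite s0.
pose i := [arg max_(i > None) nb w zo zi x i].
have imax h : nb w zo zi x h <= nb w zo zi x i.
  by rewrite /i; case: arg_maxnP => // j _; apply.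
have ipos : 0 < nb w zo zi x i.
  rewrite lt0n; apply: contraL spos => /eqP i0.
  by rewrite -sum_nb big1 // => h _; apply/eqP; rewrite -leqn0 -i0.
have [j nij jpos] : exists2 j, i != j & 0 < nb w zo zi x j.
  apply/exists_inP; apply: contraT; rewrite negb_exists => /forallP hj.
  have : tdeg w zo zi x = nb w zo zi x i.
    rewrite -sum_nb (bigD1 i) //= big1 ?addn0 // => j ji.
    by move: (hj j); rewrite eq_sym ji /= -leqNgt leqn0 => /eqP.
  by move: (hb i) ipos; lia.
have [w1 [zo1 [zi1 [l1 h1 _]]]] := lift_step sw nij ipos jpos.
have t1 : tdeg w zo zi x = tdeg w1 zo1 zi1 x + 2.
  rewrite -!sum_nb (eq_bigr _ (fun h _ => h1 h)) !big_split /= !sum_eqb; lia.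
have [||||w' [zo' [zi' [l' a b c]]]] := IH w1 zo1 zi1.
- by lia.
- by case: l1.
- by move: ev; rewrite t1 oddD addbF.
- move=> h; have := h1 h; have := hb h; rewrite t1.
  have [->|nhi] := altP (h =P i); first by rewrite (negPf nij); lia.
  have [->|nhj] := altP (h =P j); first by lia.
  (* A neighbour h outside the pair has at most the multiplicity of i, and j takes at least one
     edge, so twice its multiplicity is at most the old degree minus 1; parity improves this to
     minus 2, the new degree. *)
  move=> hb1 h2.
  have : nb w zo zi x i + (nb w zo zi x j + nb w zo zi x h) <= tdeg w zo zi x.
    rewrite -sum_nb (bigD1 i) //= (bigD1 j) 1?eq_sym //= (bigD1 h) /=; first lia.
    by rewrite nhi nhj.
  by move: (imax h) jpos ev; rewrite t1 oddD; lia.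
exists w', zo', zi'; split=> //; exact: lifted_trans l1 l'.
Qed.

End Lift.

(** * Orientations with prescribed net degrees modulo 2K *)

Section Inst.
Variable T : finType.
Implicit Types (w o : T -> T -> nat) (zo zi : T -> nat) (f tau : T -> int) (A V : {set T}).

Lemma cutU1 w x A : wsym w -> x \notin A ->
  cut w (x |: A) + (\sum_(u in A) w x u).*2 = cut w A + deg w x.
Proof.
move=> [sw iw] xA.
have e1 : \sum_a \sum_b w a b * ((a \in A) && (b == x)) = \sum_(u in A) w x u.
  rewrite [RHS]big_mkcond /=; apply: eq_bigr => a _.
  case: (a \in A) => /=; last by rewrite big1 // => b _; rewrite muln0.
  rewrite (bigD1 x) //= eqxx muln1 big1 ?addn0 // => b /negPf ->; exact: muln0.
have e2 : \sum_a \sum_b w a b * ((a == x) && (b \notin x |: A)) =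
   \sum_(u | u \notin x |: A) w x u.
  rewrite (bigD1 x) //= [X in _ + X]big1 ?addn0; last first.
    by move=> a /negPf ->; rewrite big1 // => b _; rewrite muln0.
  rewrite [RHS]big_mkcond /=; apply: eq_bigr => b _; rewrite eqxx /=.
  by case: (b \notin _); rewrite ?muln1 ?muln0.
have e3 : deg w x = \sum_(u in A) w x u + \sum_(u | u \notin x |: A) w x u.
  rewrite /deg (bigID (mem A)) /=; congr (_ + _).
  rewrite (bigD1 x) //= iw add0n; apply: eq_bigl => b.
  by rewrite !inE negb_or andbC.
have : cut w (x |: A) + \sum_a \sum_b w a b * ((a \in A) && (b == x)) =
       cut w A + \sum_a \sum_b w a b * ((a == x) && (b \notin x |: A)).
  rewrite /cut -!big_split /=; apply: eq_bigr => a _; rewrite -!big_split /=.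
  apply: eq_bigr => b _; rewrite -!mulnDr; congr (_ * _); rewrite !inE.
  have [->|] := altP (a =P x); have [->|] := altP (b =P x);
    rewrite ?(negPf xA) ?eqxx /= ?andbF //; by case: (a \in A); case: (b \in A).
by rewrite e1 e2 e3; lia.
Qed.

Lemma bcutU1 w zo zi x A : wsym w -> x \notin A ->
  bcut w zo zi (x |: A) + (\sum_(u in A) w x u).*2 = bcut w zo zi A + tdeg w zo zi x.
Proof.
move=> sw xA; have := cutU1 sw xA; rewrite /bcut /tdeg big_setU1 //=; lia.
Qed.

Lemma bcut1 w zo zi x : wsym w -> bcut w zo zi [set x] = tdeg w zo zi x.
Proof. by move=> [_ iw]; rewrite /bcut cut1 // big_set1 /tdeg; lia. Qed.

Variable K : nat.

Definition eqm (a b : int) := exists q : int, (a = b + q * Posz (2 * K)%N)%R.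

(* The invariant of the induction.  Since 9K = K mod 2K, a value |f v| = 9K is incompatible with
   |tau v| < K, so the bound |f v| <= 9K in [sol] survives putting back one deleted edge. *)
Record inst (V : {set T}) w zo zi tau : Prop := Inst {
  in_sym : wsym w;
  in_supp : forall u, u \notin V -> tdeg w zo zi u = 0;
  in_card : 2 <= #|V|;
  in_tau : forall v, v \in V -> `|tau v|%N <= K;
  in_par : forall v, v \in V -> odd (tdeg w zo zi v) = odd `|tau v|%N;
  in_zo : \sum_u zo u <= 12 * K;
  in_zi : \sum_u zi u <= 12 * K;
  in_z : \sum_u zo u + \sum_u zi u <= 14 * K;
  in_deg : forall v, v \in V -> 8 * K + `|tau v|%N <= tdeg w zo zi v;
  in_bcut : forall A, A \proper V -> 2 <= #|A| -> 9 * K <= bcut w zo zi A;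
  in_sum : eqm (\sum_(v in V) tau v)%R ((\sum_u zi u)%:Z - (\sum_u zo u)%:Z)%R }.

Definition sol (V : {set T}) w zo zi tau := exists f, Ori w zo zi f /\
  forall v, v \in V -> `|f v|%N <= 9 * K /\ eqm (f v) (tau v).

Lemma eqm_refl a : eqm a a. Proof. by exists 0%R; rewrite GRing.mul0r GRing.addr0. Qed.
Lemma eqm_sym a b : eqm a b -> eqm b a.
Proof. by move=> [q ->]; exists (- q)%R; lia. Qed.
Lemma eqm_trans a b c : eqm a b -> eqm b c -> eqm a c.
Proof. by move=> [q ->] [r ->]; exists (q + r)%R; lia. Qed.
Lemma eqmD a b c d : eqm a b -> eqm c d -> eqm (a + c)%R (b + d)%R.
Proof. by move=> [q ->] [r ->]; exists (q + r)%R; lia. Qed.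
Lemma eqmN a b : eqm a b -> eqm (- a)%R (- b)%R.
Proof. by move=> [q ->]; exists (- q)%R; lia. Qed.
Lemma eqm_sum (P : pred T) f g : (forall v, P v -> eqm (f v) (g v)) ->
  eqm (\sum_(v | P v) f v)%R (\sum_(v | P v) g v)%R.
Proof.
move=> h; elim/big_ind2: _ => //; [exact: eqm_refl | by move=> *; apply: eqmD].
Qed.

Lemma eqm_rep (a L : int) : 0 < K -> exists b, [/\ eqm b a, (L <= b)%R & (b < L + Posz (2 * K)%N)%R].
Proof.
move=> K0; have K2 : (Posz (2 * K)%N != 0)%R by lia.
exists (L + ((a - L) %% Posz (2 * K)%N)%Z)%R; split.
- exists (- ((a - L) %/ Posz (2 * K)%N)%Z)%R.
  by have := divz_eq (a - L)%R (Posz (2 * K)%N); lia.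
- by have := modz_ge0 (a - L)%R K2; lia.
by have := @ltz_pmod (a - L)%R (Posz (2 * K)%N); lia.
Qed.

Lemma eqm_par a b : eqm a b -> odd `|a|%N = odd `|b|%N.
Proof. by move=> [q ->]; lia. Qed.

Lemma sumz_D1 V f x : x \in V ->
  (\sum_(v in V) f v = f x + \sum_(v in V :\ x) f v)%R.
Proof. by move=> xV; rewrite (big_setD1 x). Qed.

Section Facts.
Variables (V : {set T}) (w : T -> T -> nat) (zo zi : T -> nat) (tau : T -> int).
Hypothesis I : inst V w zo zi tau.

Lemma supp_w u y : u \notin V -> w u y = 0.
Proof.
move/(in_supp I); rewrite /tdeg => h.
have : deg w u = 0 by lia.
by rewrite /deg (bigD1 y) //=; lia.
Qed.

Lemma supp_w' u y : u \notin V -> w y u = 0.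
Proof. by have [sw _] := in_sym I; rewrite sw; apply: supp_w. Qed.

Lemma supp_zo u : u \notin V -> zo u = 0.
Proof. by move/(in_supp I); rewrite /tdeg; lia. Qed.

Lemma supp_zi u : u \notin V -> zi u = 0.
Proof. by move/(in_supp I); rewrite /tdeg; lia. Qed.

Lemma bcutV : bcut w zo zi V = \sum_u zo u + \sum_u zi u.
Proof.
rewrite /bcut [cut w V]big1 ?add0n.
  rewrite -big_split /= [LHS]big_mkcond /=; apply: eq_bigr => u _.
  by case: ifPn => // h; rewrite supp_zo ?supp_zi.
move=> a _; apply: big1 => b _; case bV: (b \in V); first by rewrite andbF muln0.
by rewrite supp_w' ?bV.
Qed.

Lemma sum_inV x : \sum_(u in V :\ x) w x u = deg w x.
Proof.
rewrite [LHS]big_mkcond; apply: eq_bigr => u _; case: ifPn => //.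
have [sw iw] := in_sym I.
rewrite !inE negb_and negbK => /orP[/eqP->|nV]; first by rewrite iw.
by rewrite supp_w'.
Qed.

Lemma bcutVx x : x \in V ->
  \sum_u zo u + \sum_u zi u + tdeg w zo zi x = bcut w zo zi (V :\ x) + (zo x + zi x).*2.
Proof.
move=> xV; have := @bcutU1 w zo zi x (V :\ x) (in_sym I).
by rewrite !inE eqxx => /(_ isT); rewrite setD1K // bcutV sum_inV /tdeg; lia.
Qed.

Lemma bcut2 x u : x != u ->
  bcut w zo zi [set x; u] + (w x u).*2 = tdeg w zo zi x + tdeg w zo zi u.
Proof.
move=> xu; have := @bcutU1 w zo zi x [set u] (in_sym I).
by rewrite inE => /(_ xu); rewrite big_set1 bcut1; [lia | exact: in_sym I].
Qed.

End Facts.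

Lemma Ori_opp w zo zi f : Ori w zo zi f -> Ori w zi zo (fun v => - f v)%R.
Proof.
move=> [o [ow of_]]; exists (fun x y => o y x); split=> [x y|v]; first by rewrite addnC.
by rewrite of_ /net; lia.
Qed.

Lemma inst_opp V w zo zi tau : inst V w zo zi tau -> inst V w zi zo (fun v => - tau v)%R.
Proof.
case=> sw su c ta pa o i z d s e.
have td v : tdeg w zi zo v = tdeg w zo zi v by rewrite /tdeg addnAC.
split=> //.
- by move=> u; rewrite td; apply: su.
- by move=> v /ta; rewrite abszN.
- by move=> v /pa; rewrite td abszN.
- by rewrite addnC.
- by move=> v /d; rewrite td abszN.
- move=> A /s h /h; rewrite /bcut; congr (_ <= _ + _); by apply: eq_bigr => u _; rewrite addnC.
rewrite GRing.sumrN -GRing.opprB; exact: eqmN.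
Qed.

Lemma sol_opp V w zo zi tau : sol V w zi zo (fun v => - tau v)%R -> sol V w zo zi tau.
Proof.
move=> [f [/Ori_opp h hf]]; exists (fun v => - f v)%R; split=> // v /hf [b e].
by rewrite abszN; split=> //; rewrite -[tau v]GRing.opprK; apply: eqmN.
Qed.

End Inst.

(** * Reductions of an instance without small cuts *)

Section Steps.
Variables (T : finType) (K : nat).
Hypothesis K0 : 0 < K.
Implicit Types (w o : T -> T -> nat) (zo zi : T -> nat) (f tau : T -> int) (A V : {set T}).

Lemma eqm_neq9 (a t : int) : eqm K a t -> (0 <= t)%R -> (t < K%:Z)%R -> a <> Posz (9 * K).
Proof.
move=> [q ->] t0 tK e.
have e2 : (K%:Z * (9 - 2 * q) = t)%R by lia.
have [h|[h|h]] : (9 - 2 * q <= -1 \/ 9 - 2 * q = 0 \/ 9 - 2 * q >= 1)%R by lia.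
- by nia.
- by lia.
by nia.
Qed.

Lemma eqm_neqN9 (a t : int) : eqm K a t -> (t <= 0)%R -> (- K%:Z < t)%R -> a <> (- Posz (9 * K))%R.
Proof.
by move=> /eqmN /eqm_neq9 h t0 tK e; apply: h; lia.
Qed.

Variables (V : {set T}) (w : T -> T -> nat) (zo zi : T -> nat) (tau : T -> int).
Hypothesis I : inst K V w zo zi tau.
Hypothesis big : forall A, A \proper V -> 2 <= #|A| -> 14 * K < bcut w zo zi A.
Hypothesis IHN : forall w' zo' zi' tau', inst K V w' zo' zi' tau' ->
  \sum_v tdeg w' zo' zi' v < \sum_v tdeg w zo zi v -> sol K V w' zo' zi' tau'.

Lemma sum_indic (u : T) : u \in V -> (\sum_(a in V) (a == u)%:Z = 1)%R.
Proof.
move=> uV; rewrite (bigD1 u) //= eqxx big1 ?GRing.addr0 //.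
by move=> i /andP[_ /negPf ->].
Qed.

(** Directing the deleted edge u -> v adds 1 at u and subtracts 1 at v, so both residues move
    towards 0 and the required degrees drop together with the actual ones. *)
Lemma step_del u v : u \in V -> v \in V -> 0 < w u v ->
  (0 < tau u)%R -> (tau v < 0)%R -> sol K V w zo zi tau.
Proof.
move=> uV vV wuv tu tv; have [sw iw] := in_sym I.
have nuv : u != v by apply: contraL wuv => /eqP <-; rewrite iw.
pose w' a b := w a b - edge1 u v a b.
have ew a b : w a b = w' a b + edge1 u v a b.
  rewrite /w' subnK // /edge1 /arc1.
  have [->|nau] := altP (a =P u).
    rewrite (negPf nuv) /=.
    by have [->|_] := altP (b =P v); lia.
  have [->|nav] := altP (a =P v); rewrite /=; last lia.
  by have [->|nbu] := altP (b =P u); rewrite 1?sw; lia.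
have td a : tdeg w zo zi a = tdeg w' zo zi a + (a == u) + (a == v).
  rewrite /tdeg; have -> : deg w a = deg (fun a b => w' a b + edge1 u v a b) a by apply: eq_deg.
  by rewrite degD deg_edge1; lia.
pose tau' a := (tau a - (a == u)%:Z + (a == v)%:Z)%R.
have tu' : (`|tau' u| + 1)%N = `|tau u|%N by rewrite /tau' eqxx (negPf nuv); lia.
have tv' : (`|tau' v| + 1)%N = `|tau v|%N by rewrite /tau' eqxx eq_sym (negPf nuv); lia.
have ta' a : a != u -> a != v -> tau' a = tau a.
  by rewrite /tau' => /negPf -> /negPf ->; lia.
have [f [of_ hf]] : sol K V w' zo zi tau'.
  apply: IHN; last first.
    under [X in _ < X]eq_bigr do rewrite td.
    by rewrite !big_split /= !sum_eqb; lia.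
  case: (I) => _ su c ta pa o i z d s e; split=> //.
  - split=> [a b|a]; last by move: (ew a a); rewrite iw; lia.
    by move: (ew a b) (ew b a); rewrite sw edge1C; lia.
  - by move=> a /su; rewrite td; lia.
  - move=> a /ta; have [->|nu] := altP (a =P u); first by lia.
    have [->|nv] := altP (a =P v); first by lia.
    by rewrite ta'.
  - move=> a /pa; rewrite td; have [->|nu] := altP (a =P u); first by rewrite (negPf nuv); lia.
    have [->|nv] := altP (a =P v); first by lia.
    by rewrite ta' //; lia.
  - move=> a /d; rewrite td; have [->|nu] := altP (a =P u); first by rewrite (negPf nuv); lia.
    have [->|nv] := altP (a =P v); first by lia.
    by rewrite ta' //; lia.
  - move=> A pA cA; have := big pA cA; rewrite /bcut (eq_cut A ew) !cutD !cut_arc1.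
    by case: (u \in A); case: (v \in A); lia.
  rewrite /tau' !big_split /= GRing.sumrN !sum_indic //.
  by rewrite GRing.subrK.
exists (fun x => f x + (x == u)%:Z - (x == v)%:Z)%R; split; first exact: (Ori_del ew of_).
move=> a aV; have [b e] := hf a aV.
have e' : eqm K (f a + (a == u)%:Z - (a == v)%:Z)%R (tau a).
  by case: e => q ->; exists q; rewrite /tau'; lia.
split=> //; have [eu|nu] := altP (a =P u).
  subst a; rewrite (negPf nuv); have tK := in_tau I uV.
  have := @eqm_neq9 _ _ e; rewrite /tau' eqxx (negPf nuv); lia.
have [ev|nv] := altP (a =P v); last by lia.
subst a; have tK := in_tau I vV.
by have := @eqm_neqN9 _ _ e; rewrite /tau' eqxx (negPf nu); lia.
Qed.

(** An arc v -> z acts like an edge directed out of v; here only one residue moves, compensated by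
    the number of arcs into z. *)
Lemma step_zi v : v \in V -> (0 < tau v)%R -> 0 < zi v -> sol K V w zo zi tau.
Proof.
move=> vV tv zv; have [sw iw] := in_sym I.
pose zi' a := zi a - (a == v).
have ei a : zi a = zi' a + (a == v) by rewrite /zi' subnK //; case: eqP => [->|].
have td a : tdeg w zo zi a = tdeg w zo zi' a + (a == v) by rewrite /tdeg ei; lia.
have si : \sum_a zi a = \sum_a zi' a + 1.
  by rewrite (eq_bigr _ (fun a _ => ei a)) big_split /= sum_eqb.
pose tau' a := (tau a - (a == v)%:Z)%R.
have tv' : (`|tau' v| + 1)%N = `|tau v|%N by rewrite /tau' eqxx; lia.
have ta' a : a != v -> tau' a = tau a by rewrite /tau' => /negPf ->; lia.
have [f [of_ hf]] : sol K V w zo zi' tau'.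
  apply: IHN; last first.
    under [X in _ < X]eq_bigr do rewrite td.
    by rewrite [X in _ < X]big_split /= sum_eqb; lia.
  case: (I) => _ su c ta pa o i z d s e; split=> //.
  - by move=> a /su; rewrite td; lia.
  - move=> a /ta; have [->|nv] := altP (a =P v); first by lia.
    by rewrite ta'.
  - move=> a /pa; rewrite td; have [->|nv] := altP (a =P v); first by lia.
    by rewrite ta' //; lia.
  - by lia.
  - by lia.
  - move=> a /d; rewrite td; have [->|nv] := altP (a =P v); first by lia.
    by rewrite ta' //; lia.
  - move=> A pA cA; have := big pA cA; rewrite /bcut.
    suff : \sum_(a in A) (zo a + zi a) <= \sum_(a in A) (zo a + zi' a) + 1 by lia.
    rewrite -(sum_eqb v) [X in _ <= _ + X](bigID (mem A)) /= addnA.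
    apply: leq_trans (leq_addr _ _); rewrite -big_split /=.
    by apply: leq_sum => a _; rewrite ei addnA.
  rewrite /tau' !big_split /= GRing.sumrN sum_indic //.
  by case: e => q ->; exists q; rewrite si; lia.
exists (fun x => f x + (x == v)%:Z)%R; split.
  by apply: Ori_zi of_ => a; rewrite ei; lia.
move=> a aV; have [b e] := hf a aV.
have e' : eqm K (f a + (a == v)%:Z)%R (tau a).
  by case: e => q ->; exists q; rewrite /tau'; lia.
split=> //; have [eu|nu] := altP (a =P v); last by lia.
subst a; have tK := in_tau I vV.
by have := @eqm_neq9 _ _ e; rewrite /tau' eqxx; lia.
Qed.

Hypothesis V3 : 2 < #|V|.

(** A lifting costs 2 in one degree, paid by the slack, and at most 2 in a boundary, paid by the
    absence of small cuts. It needs two distinct neighbours; if x lacks them, its unique neighbour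
    can be used instead. *)
Lemma step_lift x : x \in V -> 8 * K + `|tau x|%N + 1 < tdeg w zo zi x -> sol K V w zo zi tau.
Proof.
move=> xV slack.
have sw := in_sym I.
suff [y [yV sy [i [j [nij ip jp]]]]] : exists y, [/\ y \in V, 8 * K + `|tau y|%N + 1 < tdeg w zo zi y &
    exists i j, [/\ i != j, 0 < nb w zo zi y i & 0 < nb w zo zi y j]].
  have [w' [zo' [zi' [l h b]]]] := lift_step sw nij ip jp.
  have t1 : tdeg w zo zi y = tdeg w' zo' zi' y + 2.
    rewrite -!sum_nb (eq_bigr _ (fun h' _ => h h')) !big_split /= !sum_eqb; lia.
  have td a : tdeg w zo zi a = tdeg w' zo' zi' a + (a == y) * 2.
    have [->|na] := altP (a =P y); first by lia.
    by rewrite (lf_deg l na); lia.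
  have [f [of_ hf]] : sol K V w' zo' zi' tau.
    apply: IHN; last first.
      under [X in _ < X]eq_bigr do rewrite td.
      by rewrite !big_split /= -big_distrl /= sum_eqb; lia.
    case: (I) => _ su c ta pa o z_ z d s e; split=> //.
    - exact: lf_sym l.
    - by move=> a /su; rewrite td; lia.
    - by move=> a /pa; rewrite td; lia.
    - by rewrite (lf_zo l).
    - by rewrite (lf_zi l).
    - by rewrite (lf_zo l) (lf_zi l).
    - move=> a /d; rewrite td; have [->|na] := altP (a =P y); last by lia.
      by lia.
    - by move=> A pA cA; move: (b A) (big pA cA); lia.
    by rewrite (lf_zo l) (lf_zi l).
  by exists f; split=> //; apply: lf_ori l _ of_.
have two y : y \in V -> (exists i j, [/\ i != j, 0 < nb w zo zi y i & 0 < nb w zo zi y j]) \/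
    exists i, nb w zo zi y i = tdeg w zo zi y.
  move=> yV; have [i ip] : exists i, 0 < nb w zo zi y i.
    apply/existsP; apply: contraT; rewrite negb_exists => /forallP h.
    have := in_deg I yV; rewrite -(sum_nb w zo zi y) big1; first by lia.
    by move=> i _; move: (h i); rewrite lt0n negbK => /eqP.
  case: (boolP [exists j, (i != j) && (0 < nb w zo zi y j)]).
    by case/existsP=> j /andP[nij jp]; left; exists i, j.
  rewrite negb_exists => /forallP h; right; exists i.
  rewrite -sum_nb (bigD1 i) //= big1 ?addn0 // => j ji.
  by move: (h j); rewrite eq_sym ji /= lt0n negbK => /eqP.
case: (two x xV) => [ex|]; first by exists x.
case=> -[p|] /= e.
  (* All edges at x go to p, so the boundary of {x, p} is [tdeg p - tdeg x], above 14K. Thus p has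
     slack, and it has a neighbour other than x. *)
  have wp : 0 < w x p by rewrite e; lia.
  have pV : p \in V by apply: contraLR wp => /(supp_w' I) ->.
  have xp : x != p by apply: contraL wp => /eqP <-; rewrite (in_sym I).2.
  have p2 : [set x; p] \proper V.
    by rewrite properEcard subUset !sub1set xV pV cards2 xp.
  have := big p2; rewrite cards2 xp => /(_ isT) bg.
  have := bcut2 I xp => bc.
  have dx := in_deg I xV; have tp := in_tau I pV.
  exists p; split=> //; first by lia.
  case: (two p pV) => // -[i].
  have big_deg : tdeg w zo zi x < tdeg w zo zi p by lia.
  case: i => [r|] /= er.
    have wpx : w p x <= tdeg w zo zi x by rewrite sw.1 e.
    have nrx : r != x by apply: contraTneq big_deg => rx; rewrite -er rx; lia.
    have := sum_nb w zo zi p; rewrite (bigD1 (Some r)) //= (bigD1 (Some x)) //=.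
      by rewrite er (sw.1 p x); lia.
    by rewrite eq_sym.
  have := sum_nb w zo zi p; rewrite (bigD1 None) //= (bigD1 (Some x)) //=.
  by rewrite er (sw.1 p x); lia.
(* Were z the only neighbour of x, the degree of z would be the boundary of [V :\ x] plus the degree
   of x, more than 14K. *)
have := bcutVx I xV.
have pV : V :\ x \proper V by rewrite properD1.
have cV : 2 <= #|V :\ x| by move: V3; rewrite (cardsD1 x) xV; lia.
by have := big pV cV; have := in_z I; lia.
Qed.

Hypothesis IHV : forall V' w' zo' zi' tau', #|V'| < #|V| -> inst K V' w' zo' zi' tau' ->
  sol K V' w' zo' zi' tau'.

(* Attach [ta] virtual edges x -> z and [tb] virtual edges z -> x, which makes x balanced, then lift x completely. *)
Lemma step_elim x ta tb : x \in V -> (forall u, u \in V -> tdeg w zo zi u <= 9 * K) ->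
  eqm K (tb%:Z - ta%:Z)%R (tau x) -> ta + tb <= 9 * K ->
  \sum_u zo u + \sum_u zi u + ta + tb <= 14 * K ->
  \sum_u zo u + tb <= 12 * K -> \sum_u zi u + ta <= 12 * K -> sol K V w zo zi tau.
Proof.
move=> xV dV et tK tz to ti; have sw := in_sym I; have dx := dV x xV.
pose zo1 a := zo a + (a == x) * tb; pose zi1 a := zi a + (a == x) * ta.
have so1 : \sum_u zo1 u = \sum_u zo u + tb by rewrite big_split /= -big_distrl /= sum_eqb mul1n.
have si1 : \sum_u zi1 u = \sum_u zi u + ta by rewrite big_split /= -big_distrl /= sum_eqb mul1n.
have td1 : tdeg w zo1 zi1 x = tdeg w zo zi x + ta + tb by rewrite /tdeg /zo1 /zi1 eqxx; lia.
have tdn u : u != x -> tdeg w zo1 zi1 u = tdeg w zo zi u.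
  by rewrite /tdeg /zo1 /zi1 => /negPf ->; lia.
have pV : V :\ x \proper V by rewrite properD1.
have cV : #|V| = #|V :\ x|.+1 by rewrite (cardsD1 x) xV.
have [||w' [zo' [zi' [l wx zox zix]]]] := @full_lift T w zo1 zi1 x sw.
- rewrite td1; have := in_par I xV; have := eqm_par et; lia.
(* No neighbour holds more than half of the edges at x. For z: the boundary of [V :\ x] exceeds 14K,
   while z with the virtual edges has degree at most 14K. For u: the boundary of {x, u} exceeds 14K,
   while u has degree at most 9K. *)
- move=> [u|] /=; last first.
    have bg : 14 * K < bcut w zo zi (V :\ x) by apply: big => //; lia.
    by have := bcutVx I xV; rewrite td1 /zo1 /zi1 eqxx; lia.
  have [uV|nV] := boolP (u \in V); last by rewrite (supp_w' I).
  have [<-|xu] := altP (x =P u); first by rewrite sw.2.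
  have p2 : [set x; u] \proper V by rewrite properEcard subUset !sub1set xV uV cards2 xu.
  have bg := big p2; rewrite cards2 xu in bg; have {bg} bg := bg isT.
  have bc := bcut2 I xu.
  by have := dV u uV; rewrite td1; lia.
have tdx : tdeg w' zo' zi' x = 0.
  by rewrite /tdeg zox zix /deg big1.
have [f [of_ hf]] : sol K (V :\ x) w' zo' zi' tau.
  apply: IHV; first by lia.
  case: (I) => _ su c ta_ pa o z_ z d s e; split=> //.
  - exact: lf_sym l.
  - move=> u; rewrite !inE negb_and negbK => /orP[/eqP-> //|nV].
    have ux : u != x by apply: contraNneq nV => ->.
    by rewrite (lf_deg l) // tdn // su.
  - by lia.
  - by move=> v /setD1P[_ /ta_].
  - by move=> v /setD1P[nv /pa]; rewrite (lf_deg l) // tdn.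
  - by rewrite (lf_zo l) so1.
  - by rewrite (lf_zi l) si1.
  - by rewrite (lf_zo l) (lf_zi l) so1 si1; lia.
  - by move=> v /setD1P[nv /d]; rewrite (lf_deg l) // tdn.
  - move=> A pA cA.
    have AV : A \proper V := proper_trans pA pV.
    have xA : x \notin A by apply/negP => /(subsetP (proper_sub pA)); rewrite !inE eqxx.
    have xAV : x |: A \proper V.
      rewrite properEcard subUset sub1set xV (proper_sub AV) cardsU1 xA.
      by have := proper_card pA; lia.
    have b1 := big AV cA; have b2 : 14 * K < bcut w zo zi (x |: A).
      by apply: big => //; rewrite cardsU1 xA; lia.
    have e3 := bcutU1 zo zi sw xA.
    (* Only edges from A to x can be lost, and twice what remains is at least the sum of the
       boundaries of A and [x |: A] minus the degree of x, hence more than 28K - 9K. *)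
    suff : bcut w zo zi A <= bcut w' zo' zi' A + \sum_(u in A) w x u by lia.
    rewrite /bcut addnAC; apply: leq_add; last first.
      apply: leq_sum => u uA.
      have ux : u != x by apply: contraTneq uA => ->.
      have := lf_zole l ux; have := lf_zile l ux.
      by rewrite /zo1 /zi1 (negPf ux); clear; lia.
    rewrite /cut [X in _ <= _ + X]big_mkcond /= -big_split /=.
    apply: leq_sum => a _; case: ifPn => aA; last by rewrite big1 // => b _; rewrite muln0.
    rewrite (bigD1 x) //= xA muln1 addnC sw.1 leq_add2r.
    rewrite [X in _ <= X](bigD1 x) //= -[X in X <= _]add0n leq_add //.
    apply: leq_sum => b bx; rewrite leq_mul2r; apply/orP; right.
    by apply: (lf_w l) => //; apply: contraTneq aA => ->.
  rewrite (lf_zo l) (lf_zi l) so1 si1.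
  case: e et => q; rewrite (sumz_D1 _ xV) => e [r er]; exists (q + r)%R; lia.
(* x is isolated after the complete lifting, so its final value [tb - ta] comes from removing the
   virtual edges alone. *)
have f0 : f x = 0%R.
  case: of_ => o [ow ->]; rewrite /net zox zix.
  have o0 y : o x y = 0 /\ o y x = 0 by have := ow x y; rewrite wx; lia.
  by rewrite !big1 // => y _; case: (o0 y).
have := lf_ori l of_ => h.
exists (fun a => f a - ((a == x) * ta)%:Z + ((a == x) * tb)%:Z)%R; split.
  apply: (@Ori_zo _ w zo1 zi (fun a => f a - ((a == x) * ta)%:Z)%R).
    by move=> a; rewrite /zo1; lia.
  by apply: (Ori_zi _ h) => a; rewrite /zi1; lia.
move=> v vV; have [->|nv] := altP (v =P x).
  by rewrite f0; split; first lia; case: et => q e; exists q; lia.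
have [|b e] := hf v; first by rewrite !inE nv.
by split; first lia; case: e => q ->; exists q; lia.
Qed.

End Steps.

Lemma nat_subsel (T : finType) (A : {set T}) (g : T -> nat) s : s <= \sum_(u in A) g u ->
  exists h : T -> nat, (forall u, h u <= g u) /\ \sum_(u in A) h u = s.
Proof.
elim: {A}#|A| {-2}A (erefl #|A|) s => [|n IH] A.
  move/eqP; rewrite cards_eq0 => /eqP-> s; rewrite big_set0 leqn0 => /eqP->.
  by exists (fun=> 0); rewrite big_set0.
move=> cA s; have /card_gt0P[x xA] : 0 < #|A| by rewrite cA.
have cA' : #|A :\ x| = n by move: cA; rewrite (cardsD1 x) xA => -[].
rewrite (big_setD1 x) //= => hs.
have [|h [hle hsum]] := IH _ cA' (s - minn s (g x)); first by lia.
exists (fun u => if u == x then minn s (g x) else h u); split=> [u|].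
  by case: eqP => [->|] //; apply: geq_minr.
rewrite (big_setD1 x) //= eqxx (eq_bigr h); first by rewrite hsum; lia.
by move=> u; rewrite !inE => /andP[/negPf->].
Qed.

Lemma odd_abszD (a b : int) : odd `|(a + b)%R|%N = odd `|a|%N (+) odd `|b|%N.
Proof. lia. Qed.

(** * Contracting a small cut *)

Section Contract.
Variables (T : finType) (K : nat).
Hypothesis K0 : 0 < K.
Variables (V : {set T}) (w : T -> T -> nat) (zo zi : T -> nat) (tau : T -> int).
Hypothesis I : inst K V w zo zi tau.

Lemma odd_bcut (A : {set T}) : A \subset V ->
  odd (bcut w zo zi A) = odd `|(\sum_(v in A) tau v)%R|%N.
Proof.
elim: {A}#|A| {-2}A (erefl #|A|) => [|n IH] A.
  move/eqP; rewrite cards_eq0 => /eqP-> _.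
  by rewrite /bcut cut_set0 !big_set0.
move=> cA AV; have /card_gt0P[x xA] : 0 < #|A| by rewrite cA.
have cA' : #|A :\ x| = n by move: cA; rewrite (cardsD1 x) xA => -[].
have A'V : A :\ x \subset V by apply: subset_trans AV; apply: subD1set.
have := @bcutU1 T w zo zi x (A :\ x) (in_sym I).
rewrite setD11 setD1K // => /(_ isT).
move/(congr1 odd); rewrite [LHS]oddD [RHS]oddD odd_double addbF => ->.
by rewrite (sumz_D1 _ xA) odd_abszD addbC (IH _ cA' A'V) (in_par I (subsetP AV _ xA)).
Qed.

Variables (A : {set T}) (a : T).
Hypotheses (pA : A \proper V) (A2 : 2 <= #|A|) (aA : a \in A).
Hypothesis small : bcut w zo zi A <= 14 * K.
Hypothesis IHV : forall (V' : {set T}) w' zo' zi' tau', #|V'| < #|V| -> inst K V' w' zo' zi' tau' ->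
  sol K V' w' zo' zi' tau'.

Let pr u := if u \in A then a else u.
(** Loops are dropped, which discards the edges inside A. *)
Let w1 x y := if x == y then 0 else \sum_u \sum_v w u v * ((pr u == x) && (pr v == y)).
Let push (g : T -> nat) x := \sum_u g u * (pr u == x).
Let V1 := V :\: (A :\ a).

Lemma sum_push g (P : pred T) : \sum_(x | P x) push g x = \sum_u g u * P (pr u).
Proof.
rewrite exchange_big /=; apply: eq_bigr => u _; rewrite -big_distrr /=; congr (_ * _).
rewrite big_mkcond (bigD1 (pr u)) //= eqxx big1 ?addn0; first by case: (P _).
by move=> i /negPf; rewrite eq_sym => ->; case: (P _).
Qed.

Lemma cut_w1 X : cut w1 X = cut w (pr @^-1: X).
Proof.
transitivity (\sum_x \sum_y \sum_u \sum_v
   (w u v * ((pr u == x) && (pr v == y))) * ((x \in X) && (y \notin X))).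
  apply: eq_bigr => x _; apply: eq_bigr => y _; rewrite /w1.
  case: eqP => [->|_].
    by rewrite andbN muln0 big1 // => u _; rewrite big1 // => v _; rewrite muln0.
  by rewrite big_distrl /=; apply: eq_bigr => u _; rewrite big_distrl.
rewrite pair_big /=; under eq_bigr do rewrite pair_big /=.
rewrite exchange_big /= /cut [RHS]pair_big /=; apply: eq_bigr => -[u v] _ /=.
rewrite !inE -(pair_big xpredT xpredT (fun x y => w u v * ((pr u == x) && (pr v == y)) * ((x \in X) && (y \notin X)))) /=.
rewrite (bigD1 (pr u)) //= [X in _ + X]big1 ?addn0; last first.
  by move=> i /negPf h; rewrite big1 // => j _; rewrite eq_sym h muln0.
rewrite (bigD1 (pr v)) //= [X in _ + X]big1 ?addn0; last first.
  by move=> i /negPf h; rewrite [pr v == i]eq_sym h andbF muln0.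
by rewrite !eqxx muln1.
Qed.

Lemma bcut_w1 X : bcut w1 (push zo) (push zi) X = bcut w zo zi (pr @^-1: X).
Proof.
rewrite /bcut cut_w1; congr (_ + _); rewrite big_split /= !sum_push -big_split /=.
rewrite [RHS]big_mkcond /=; apply: eq_bigr => u _; rewrite inE.
by case: (_ \in X); rewrite ?muln1 ?muln0.
Qed.

Lemma w1_sym : wsym w1.
Proof.
have [sw iw] := in_sym I; split=> [x y|x]; last by rewrite /w1 eqxx.
rewrite /w1 eq_sym; case: eqP => // _; rewrite exchange_big /=.
by apply: eq_bigr => u _; apply: eq_bigr => v _; rewrite sw andbC.
Qed.

Lemma pre1 x : x \notin A -> pr @^-1: [set x] = [set x].
Proof.
move=> xA; apply/setP => u; rewrite !inE /pr; case: ifPn => // uA.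
have -> : (a == x) = false by apply: contraNF xA => /eqP <-.
by apply/esym/negbTE; apply: contraNneq xA => <-.
Qed.

Lemma prea : pr @^-1: [set a] = A.
Proof.
apply/setP => u; rewrite !inE /pr; case: ifPn; first by rewrite eqxx.
by move=> uA; apply: contraNF uA => /eqP ->.
Qed.

Lemma pre0 x : x \in A :\ a -> pr @^-1: [set x] = set0.
Proof.
move=> /setD1P[xa xA]; apply/setP => u; rewrite !inE /pr; case: ifPn => [_|uA].
  by rewrite eq_sym (negPf xa).
by apply: contraNF uA => /eqP ->.
Qed.

Lemma tdeg1 x : tdeg w1 (push zo) (push zi) x = bcut w zo zi (pr @^-1: [set x]).
Proof. by rewrite -bcut1 ?bcut_w1 //; exact: w1_sym. Qed.

Lemma w1_out x y : x \notin A -> y \notin A -> w1 x y = w x y.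
Proof.
move=> xA yA; have [sw iw] := in_sym I; rewrite /w1; case: eqP => [->|_] //.
have px u : (pr u == x) = (u == x) by have := pre1 xA => /setP/(_ u); rewrite !inE.
have py u : (pr u == y) = (u == y) by have := pre1 yA => /setP/(_ u); rewrite !inE.
rewrite -[RHS](sum_arc1_mul x y w).
by apply: eq_bigr => u _; apply: eq_bigr => v _; rewrite px py mulnC.
Qed.

Lemma w1_a y : y \notin A -> w1 a y = \sum_(u in A) w u y.
Proof.
move=> yA; rewrite /w1; case: eqP => [e|_]; first by rewrite -e aA in yA.
have pa u : (pr u == a) = (u \in A) by have := prea => /setP/(_ u); rewrite !inE.
have py u : (pr u == y) = (u == y) by have := pre1 yA => /setP/(_ u); rewrite !inE.
rewrite [RHS]big_mkcond; apply: eq_bigr => u _; rewrite (bigD1 y) //= py eqxx big1.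
  by rewrite pa; case: (u \in A); rewrite ?muln0 ?muln1 addn0.
by move=> v /negPf n; rewrite py n andbF muln0.
Qed.

Lemma w1_0 x y : y \in A :\ a -> w1 x y = 0.
Proof.
move=> yA; rewrite /w1; case: eqP => // _.
have py u : (pr u == y) = false by have := pre0 yA => /setP/(_ u); rewrite !inE.
by rewrite big1 // => u _; rewrite big1 // => v _; rewrite py andbF muln0.
Qed.

Lemma push_out g x : x \notin A -> push g x = g x.
Proof.
move=> xA; have px u : (pr u == x) = (u == x) by have := pre1 xA => /setP/(_ u); rewrite !inE.
rewrite /push (bigD1 x) //= px eqxx big1 ?addn0 ?muln1 // => u /negPf n.
by rewrite px n muln0.
Qed.

Lemma push_a g : push g a = \sum_(u in A) g u.
Proof.
have pa u : (pr u == a) = (u \in A) by have := prea => /setP/(_ u); rewrite !inE.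
rewrite [RHS]big_mkcond; apply: eq_bigr => u _; rewrite pa.
by case: (u \in A); rewrite ?muln1 ?muln0.
Qed.

Lemma aV : a \in V. Proof. exact: subsetP (proper_sub pA) a aA. Qed.

Lemma V1P x : x \in V1 -> x \in V /\ (x = a \/ x \notin A).
Proof.
rewrite !inE negb_and negbK => /andP[/orP[/eqP->|h] xV]; split=> //; by [left|right].
Qed.

Lemma aV1 : a \in V1. Proof. by rewrite !inE eqxx aV. Qed.

(** The residue t of the contracted vertex can be chosen with |t| <= K, so the bound 9K on
    boundaries supplies the bound 8K + |t| demanded of its degree. *)
Lemma sol_quot : exists t, eqm K t (\sum_(v in A) tau v)%R /\
  sol K V1 w1 (push zo) (push zi) (fun v => if v == a then t else tau v).
Proof.
have [t [te tl tu]] := eqm_rep (\sum_(v in A) tau v)%R (- K%:Z)%R K0.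
exists t; split=> //; set tau1 := fun v => _.
have tK : `|t|%N <= K by lia.
have AV := proper_sub pA.
have cA : #|A :\ a| < #|V| by have := proper_card pA; rewrite (cardsD1 a A) aA; lia.
apply: IHV.
  rewrite cardsD; have -> : V :&: (A :\ a) = A :\ a.
    by apply/setIidPr; apply: subset_trans AV; apply: subD1set.
  by move: A2; rewrite (cardsD1 a) aA; lia.
case: (I) => sw su c ta pa o z_ z d s e.
split.
- exact: w1_sym.
- move=> u; rewrite tdeg1 in_setD negb_and negbK => /orP[/pre0 -> | uV].
    by rewrite /bcut cut_set0 big_set0.
  rewrite pre1; last by apply: contra uV => /(subsetP AV).
  by rewrite bcut1 // su.
- have /properP[_ [b bV bA]] := pA.
  have : [set a; b] \subset V1.
    rewrite subUset !sub1set aV1 !inE bV (negPf bA) andbF //.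
  move/subset_leq_card; rewrite cards2; suff -> : a != b by [].
  by apply: contraNneq bA => <-.
- move=> v /V1P[vV [->|vA]]; rewrite /tau1 ?eqxx //; case: eqP => // _; exact: ta.
- move=> v /V1P[vV [->|vA]]; rewrite tdeg1 /tau1.
    by rewrite eqxx prea odd_bcut // (eqm_par te).
  rewrite pre1 // bcut1 // ; case: eqP => [e1|_]; last exact: pa.
  by rewrite e1 aA in vA.
- by rewrite sum_push; under eq_bigr do rewrite muln1.
- by rewrite sum_push; under eq_bigr do rewrite muln1.
- by rewrite !sum_push; under eq_bigr do rewrite muln1; under [X in _ + X]eq_bigr do rewrite muln1.
- move=> v /V1P[vV [->|vA]]; rewrite tdeg1 /tau1.
    by rewrite eqxx prea; have := s A pA A2; lia.
  rewrite pre1 // bcut1 // ; case: eqP => [e1|_]; last exact: d.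
  by rewrite e1 aA in vA.
- move=> X pX cX; rewrite bcut_w1; apply: s.
    apply/properP; split.
      apply/subsetP => u; rewrite inE => /(subsetP (proper_sub pX)) /V1P[].
      by rewrite /pr; case: ifPn => // uA _ _; apply: (subsetP AV).
    have /properP[_ [y yV yX]] := pX; have [yV' yA] := V1P yV.
    exists y => //; rewrite inE /pr; case: ifPn => // yA'.
    by case: yA => [<-//|]; rewrite yA'.
  apply: leq_trans cX _; apply: subset_leq_card; apply/subsetP => x xX.
  have [_ xA] := V1P (subsetP (proper_sub pX) _ xX).
  rewrite inE /pr; case: ifPn => // xA'.
  by case: xA => [<-//|]; rewrite xA'.
rewrite !sum_push; under [in X in (_ - X)%R]eq_bigr do rewrite muln1.
under [in X in (X - _)%R]eq_bigr do rewrite muln1.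
apply: eqm_trans e.
rewrite (sumz_D1 _ aV1) {1}/tau1 eqxx.
have -> : (\sum_(v in V) tau v = \sum_(v in A) tau v + \sum_(v in V1 :\ a) tau v)%R.
  rewrite (big_setID A) /=; congr (_ + _)%R.
    by apply: eq_bigl => v; rewrite inE andbC; case vA: (v \in A) => //=; rewrite (subsetP AV).
  apply: eq_bigl => v; rewrite !inE; case: (altP (v =P a)) => [->|] //=; by rewrite aA.
apply: eqmD => //; rewrite (eq_bigr tau); first exact: eqm_refl.
by move=> v /setD1P[/negPf nv _]; rewrite /tau1 nv.
Qed.

(** Once the quotient is oriented, everything outside A is merged with z, and the edges leaving A
    become prescribed arcs of an instance on A. They number at most 14K because the cut is small,
    and |f1 a| <= 9K bounds those of either direction by (14K + 9K) / 2, below 12K. *)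
Lemma step_contract : sol K V w zo zi tau.
Proof.
have [t [te [f1 [[o1 [ow1 fo1]] hf1]]]] := sol_quot.
have [sw iw] := in_sym I; have AV := proper_sub pA.
have [b1 e1] := hf1 a aV1; rewrite eqxx in e1.
(* The quotient directs [o1 a y] of the edges between A and y towards y; [h y u] is the number of
   them that start at u. *)
have exh (y : T) : exists h : {ffun T -> nat}, y \notin A -> (forall u, h u <= w u y) /\ \sum_(u in A) h u = o1 a y.
  have [yA|yA] := boolP (y \in A); first by exists [ffun=> 0].
  have [|h [h1 h2]] := @nat_subsel T A (fun u => w u y) (o1 a y).
    by rewrite -w1_a // -ow1 leq_addr.
  exists [ffun u => h u] => _; split=> [u|]; first by rewrite ffunE.
  by rewrite -h2; apply: eq_bigr => u _; rewrite ffunE.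
have [h hP] := fin_all_exists exh.
have hle y u : y \notin A -> h y u <= w u y by case/hP.
have hsum y : y \notin A -> \sum_(u in A) h y u = o1 a y by case/hP.
have hsum' y : y \notin A -> \sum_(u in A) (w y u - h y u) = o1 y a.
  move=> yA; have := w1_a yA; rewrite -ow1.
  have -> : \sum_(u in A) w u y = \sum_(u in A) (w y u - h y u) + \sum_(u in A) h y u.
    by rewrite -big_split /=; apply: eq_bigr => u _; rewrite subnK // sw hle.
  by rewrite hsum //; lia.
pose w2 u v := if (u \in A) && (v \in A) then w u v else 0.
pose zo2 u := if u \in A then zo u + \sum_(y | y \notin A) (w u y - h y u) else 0.
pose zi2 u := if u \in A then zi u + \sum_(y | y \notin A) h y u else 0.
have sw2 : wsym w2.
  split=> [x y|x]; first by rewrite /w2 andbC sw.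
  by rewrite /w2 iw; case: ifP.
have zz u : u \in A -> zo2 u + zi2 u = zo u + zi u + \sum_(y | y \notin A) w u y.
  move=> uA; rewrite /zo2 /zi2 uA.
  have : \sum_(y | y \notin A) w u y =
    \sum_(y | y \notin A) (w u y - h y u) + \sum_(y | y \notin A) h y u; last by lia.
  by rewrite -big_split /=; apply: eq_bigr => y yA; rewrite subnK // hle.
have bc2 (X : {set T}) : X \subset A -> bcut w2 zo2 zi2 X = bcut w zo zi X.
  move=> XA; rewrite /bcut; have -> : \sum_(u in X) (zo2 u + zi2 u) =
     \sum_(u in X) \sum_(y | y \notin A) w u y + \sum_(u in X) (zo u + zi u).
    rewrite -big_split /=; apply: eq_bigr => u uX.
    by rewrite zz ?(subsetP XA) // addnC.
  rewrite addnA; congr (_ + _).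
  rewrite /cut [X in _ + X]big_mkcond -big_split /=; apply: eq_bigr => x _.
  case: (boolP (x \in X)) => xX; last first.
    by rewrite addn0; rewrite !big1 // => y _; rewrite muln0.
  have xA := subsetP XA _ xX.
  rewrite [X in _ + X]big_mkcond -big_split /=; apply: eq_bigr => y _.
  rewrite /w2 xA /=; have [yA|yA] := boolP (y \in A); first by rewrite addn0.
  have -> : y \notin X by apply: contra yA => /(subsetP XA).
  by rewrite ?xX /= ?muln1 ?mul0n ?add0n.
have td2 u : u \in A -> tdeg w2 zo2 zi2 u = tdeg w zo zi u.
  by move=> uA; rewrite -!bcut1 ?bc2 ?sub1set //; exact: in_sym I.
have szo : \sum_u zo2 u = \sum_(u in A) zo2 u.
  by rewrite [RHS]big_mkcond; apply: eq_bigr => u _; rewrite /zo2; case: (u \in A).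
have szi : \sum_u zi2 u = \sum_(u in A) zi2 u.
  by rewrite [RHS]big_mkcond; apply: eq_bigr => u _; rewrite /zi2; case: (u \in A).
(* The surplus of the new z is the quotient value at a, congruent to the sum of [tau] over A: this
   is the sum condition of the instance on A. *)
have fa : (f1 a = (\sum_u zi2 u)%:Z - (\sum_u zo2 u)%:Z)%R.
  have s0 (g : T -> nat) : (forall y, y \in A -> g y = 0) -> \sum_y g y = \sum_(y | y \notin A) g y.
    by move=> g0; rewrite [RHS]big_mkcond; apply: eq_bigr => y _; case: ifPn => // /negbNE/g0.
  have o10 y : y \in A -> o1 a y = 0 /\ o1 y a = 0.
    move=> yA; have := ow1 a y; have [->|ya] := altP (y =P a).
      by rewrite w1_sym.2; lia.
    by rewrite w1_0 ?inE ?ya //; lia.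
  rewrite fo1 /net (s0 (o1 a)); last by move=> y /o10[].
  rewrite (s0 (o1^~ a)); last by move=> y /o10[].
  rewrite szo szi !push_a.
  have -> : \sum_(u in A) zi2 u = \sum_(u in A) zi u + \sum_(y | y \notin A) o1 a y.
    rewrite -[X in _ + X](eq_bigr _ (fun y h => hsum y h)) exchange_big -big_split /=.
    by apply: eq_bigr => u uA; rewrite /zi2 uA.
  have -> : \sum_(u in A) zo2 u = \sum_(u in A) zo u + \sum_(y | y \notin A) o1 y a.
    rewrite -[X in _ + X](eq_bigr _ (fun y h => hsum' y h)) exchange_big -big_split /=.
    by apply: eq_bigr => u uA; rewrite /zo2 uA; under [in RHS]eq_bigr do rewrite sw.
  by lia.
have stot : \sum_u zo2 u + \sum_u zi2 u <= 14 * K.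
  rewrite szo szi -big_split /=; apply: leq_trans small; rewrite -bc2 //; exact: leq_addl.
have [f2 [[o2 [ow2 fo2]] hf2]] : sol K A w2 zo2 zi2 tau.
  apply: IHV; first exact: proper_card.
  case: (I) => _ su c ta pa o z_ z d s e; split=> //.
  - move=> u uA; rewrite /tdeg /zo2 /zi2 (negPf uA) /deg big1 // => y _.
    by rewrite /w2 (negPf uA).
  - by move=> v /(subsetP AV) /ta.
  - by move=> v vA; rewrite td2 // pa // (subsetP AV).
  - by lia.
  - by lia.
  - by move=> v vA; rewrite td2 // d // (subsetP AV).
  - by move=> X pX cX; rewrite bc2 ?proper_sub // s // (proper_trans pX).
  by rewrite -fa; apply: eqm_trans (eqm_sym te) (eqm_sym e1).
pose o u v := if u \in A then (if v \in A then o2 u v else h v u)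
              else (if v \in A then w u v - h u v else o1 u v).
exists (fun v => if v \in A then f2 v else f1 v); split; last first.
  move=> v vV; case: ifPn => vA; first exact: hf2.
  have := hf1 v; rewrite ifF; first by apply; rewrite !inE (negPf vA) andbF.
  by apply: contraNF vA => /eqP->.
have o20 u v : v \notin A -> o2 u v = 0 /\ o2 v u = 0.
  by move=> vA; have := ow2 u v; rewrite /w2 (negPf vA) andbF; lia.
exists o; split=> [x y|v].
  rewrite /o; have [xA|xA] := boolP (x \in A); have [yA|yA] := boolP (y \in A).
  - by rewrite ow2 /w2 xA yA.
  - by have := hle y x yA; have := sw x y; lia.
  - by have := hle x y xA; have := sw x y; lia.
  by rewrite ow1 w1_out.
have split_sum (g : T -> nat) : \sum_y g y = \sum_(y in A) g y + \sum_(y | y \notin A) g y.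
  by rewrite (bigID (mem A)).
have [vA|vA] := boolP (v \in A).
  rewrite fo2 /net !split_sum /o vA.
  have z1 : \sum_(y | y \notin A) o2 v y = 0 by rewrite big1 // => y /(o20 v)[].
  have z2 : \sum_(y | y \notin A) o2 y v = 0 by rewrite big1 // => y /(o20 v)[].
  rewrite z1 z2.
  have -> : \sum_(y in A) (if y \in A then o2 v y else h y v) = \sum_(y in A) o2 v y.
    by apply: eq_bigr => y ->.
  have -> : \sum_(y | y \notin A) (if y \in A then o2 v y else h y v) = \sum_(y | y \notin A) h y v.
    by apply: eq_bigr => y /negPf->.
  have -> : \sum_(y in A) (if y \in A then o2 y v else w y v - h y v) = \sum_(y in A) o2 y v.
    by apply: eq_bigr => y ->.
  have -> : \sum_(y | y \notin A) (if y \in A then o2 y v else w y v - h y v) =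
     \sum_(y | y \notin A) (w v y - h y v).
    by apply: eq_bigr => y /negPf->; rewrite sw.
  by rewrite /zi2 /zo2 vA; lia.
rewrite fo1 !push_out // /net !split_sum /o (negPf vA).
have z1 : \sum_(y in A) o1 v y = o1 v a.
  rewrite (big_setD1 a) //= big1 ?addn0 // => y yA.
  by have := ow1 v y; rewrite w1_0 //; lia.
have z2 : \sum_(y in A) o1 y v = o1 a v.
  rewrite (big_setD1 a) //= big1 ?addn0 // => y yA.
  by have := ow1 v y; rewrite w1_0 //; lia.
have -> : \sum_(y in A) (if y \in A then w v y - h v y else o1 v y) = o1 v a.
  by rewrite -hsum' //; apply: eq_bigr => y ->.
have -> : \sum_(y | y \notin A) (if y \in A then w v y - h v y else o1 v y) = \sum_(y | y \notin A) o1 v y.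
  by apply: eq_bigr => y /negPf->.
have -> : \sum_(y in A) (if y \in A then h v y else o1 y v) = o1 a v.
  by rewrite -hsum //; apply: eq_bigr => y ->.
have -> : \sum_(y | y \notin A) (if y \in A then h v y else o1 y v) = \sum_(y | y \notin A) o1 y v.
  by apply: eq_bigr => y /negPf->.
by rewrite z1 z2.
Qed.

End Contract.

(** * The instances with two vertices *)

Lemma half_shift (b : int) (e zi zo : nat) : odd `|b|%N = odd (e + zo + zi) ->
  (Posz zi - Posz zo - Posz e <= b)%R -> exists n : nat, (b = 2 * n%:Z - e%:Z + zi%:Z - zo%:Z)%R.
Proof.
move=> pb lb; exists `|(b + zo%:Z + e%:Z - zi%:Z)%R|./2; lia.
Qed.

(** For the value b at x, the value at the other vertex u is forced. Whichever lower bound is the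
    largest one, every upper bound leaves room for a full period 2K above it. *)
Lemma base_bounds (K e zox zou zix ziu : nat) (b L : int) :
  8 * K <= e + zox + zix -> 8 * K <= e + zou + ziu -> zox + zou <= 12 * K -> zix + ziu <= 12 * K ->
  zox + zou + (zix + ziu) <= 14 * K ->
  [\/ L = (- Posz (9 * K))%R, L = ((zix + ziu)%:Z - (zox + zou)%:Z - Posz (9 * K))%R |
      L = (zix%:Z - zox%:Z - e%:Z)%R] ->
  (- Posz (9 * K) <= L)%R -> ((zix + ziu)%:Z - (zox + zou)%:Z - Posz (9 * K) <= L)%R ->
  (L <= b)%R -> (b < L + Posz (2 * K))%R ->
  [/\ (b <= e%:Z + zix%:Z - zox%:Z)%R, `|b|%N <= 9 * K &
      `|((zix + ziu)%:Z - (zox + zou)%:Z - b)%R|%N <= 9 * K].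
Proof.
by move=> h1 h2 h3 h4 h5 hL l1 l2 lb bL; split; case: hL => eL; move: h1 h2 h3 h4 h5 l1 l2 lb bL; rewrite eL; clear; lia.
Qed.

Section Main.
Variables (T : finType) (K : nat).
Hypothesis K0 : 0 < K.
Implicit Types (w o : T -> T -> nat) (zo zi : T -> nat) (f tau : T -> int) (A V : {set T}).

Lemma sol_base V w zo zi tau : inst K V w zo zi tau -> #|V| = 2 -> sol K V w zo zi tau.
Proof.
move=> I /eqP/cards2P[x [u [xu eV]]].
have [sw iw] := in_sym I.
have xV : x \in V by rewrite eV !inE eqxx.
have uV : u \in V by rewrite eV !inE eqxx orbT.
have s2 (g : T -> nat) : (forall y, y \notin V -> g y = 0) -> \sum_y g y = g x + g u.
  move=> g0; rewrite (bigD1 x) //= (bigD1 u) 1?eq_sym //= big1 ?addn0 // => y /andP[yx yu].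
  by apply: g0; rewrite eV !inE negb_or yx.
have dx : tdeg w zo zi x = w x u + zo x + zi x.
  by rewrite /tdeg /deg s2 ?iw // => y yV; apply: (supp_w' I).
have du : tdeg w zo zi u = w x u + zo u + zi u.
  by rewrite /tdeg /deg s2 ?iw ?addn0 1?sw // => y yV; apply: (supp_w' I).
have szo : \sum_y zo y = zo x + zo u by apply: s2 => y; apply: (supp_zo I).
have szi : \sum_y zi y = zi x + zi u by apply: s2 => y; apply: (supp_zi I).
have bx := in_deg I xV; have bu := in_deg I uV.
have c1 := in_zo I; have c2 := in_zi I; have c3 := in_z I.
have px := in_par I xV; have tx := in_tau I xV.
have sum := in_sum I; rewrite szo szi in c1 c2 c3 sum.
have st : (\sum_(v in V) tau v = tau x + tau u)%R.
  by rewrite eV (big_setU1 x) ?inE //= big_set1.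
rewrite st in sum.
set e := w x u in dx du bx bu.
(* The three lower bounds on the value at x: it is at least -9K, the value at u is at most 9K, and
   it cannot fall below the value reached when all e edges enter x. *)
pose L := Order.max (- Posz (9 * K))%R (Order.max
   ((zi x + zi u)%:Z - (zo x + zo u)%:Z - Posz (9 * K))%R ((zi x)%:Z - (zo x)%:Z - e%:Z)%R).
have [b [be bl bh]] := eqm_rep (tau x) L K0.
have L1 : (- Posz (9 * K) <= L)%R by rewrite /L Order.TotalTheory.le_max Order.POrderTheory.lexx.
have L2 : ((zi x + zi u)%:Z - (zo x + zo u)%:Z - Posz (9 * K) <= L)%R.
  by rewrite /L !Order.TotalTheory.le_max Order.POrderTheory.lexx orbT.
have L3 : ((zi x)%:Z - (zo x)%:Z - e%:Z <= L)%R.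
  by rewrite /L !Order.TotalTheory.le_max Order.POrderTheory.lexx !orbT.
have LE : [\/ L = (- Posz (9 * K))%R, L = ((zi x + zi u)%:Z - (zo x + zo u)%:Z - Posz (9 * K))%R |
    L = ((zi x)%:Z - (zo x)%:Z - e%:Z)%R].
  rewrite /L; case: Order.TotalTheory.leP => _; last by constructor 1.
  by case: Order.TotalTheory.leP => _; [constructor 3 | constructor 2].
have dxK : 8 * K <= e + zo x + zi x by rewrite -dx; apply: leq_trans bx; apply: leq_addr.
have duK : 8 * K <= e + zo u + zi u by rewrite -du; apply: leq_trans bu; apply: leq_addr.
have [be1 be2 be3] := base_bounds dxK duK c1 c2 c3 LE L1 L2 bl bh.
have [n bn] : exists n : nat, (b = 2 * n%:Z - e%:Z + (zi x)%:Z - (zo x)%:Z)%R.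
  by apply: half_shift; [rewrite -dx px; exact: eqm_par be | exact: Order.POrderTheory.le_trans L3 bl].
have ne : n <= e by move: bn be1; clear; lia.
have eu : (e%:Z - 2 * n%:Z + (zi u)%:Z - (zo u)%:Z = (zi x + zi u)%:Z - (zo x + zo u)%:Z - b)%R.
  by rewrite bn; clear; lia.
exists (fun v => if v == x then b else if v == u then
   (e%:Z - 2 * n%:Z + (zi u)%:Z - (zo u)%:Z)%R else 0%R); split; last first.
  move=> v; rewrite eV !inE => /orP[/eqP->|/eqP->]; first by rewrite eqxx.
  rewrite eq_sym (negPf xu) eqxx eu; split=> //.
  case: be sum => q -> [r er]; exists (- r - q)%R; move: er.
  by move: (tau x) (tau u) (Posz (2 * K)) => tx' tu' M; clear; lia.
pose o p q := if (p == x) && (q == u) then n else if (p == u) && (q == x) then e - n else 0.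
have ux : (u == x) = false by rewrite eq_sym (negPf xu).
exists o; split=> [p q|v].
  rewrite /o; have [->|npx] := altP (p =P x).
    rewrite /= (negPf xu) /= andbT andbF.
    have [->|nqu] := altP (q =P u); first by rewrite ?eqxx ?ux /= ?subnKC.
    have [->|nqx] := altP (q =P x); first by rewrite iw.
    by rewrite (supp_w' I) // eV !inE negb_or nqx.
  rewrite /= andbF andbC /=; have [->|npu] := altP (p =P u).
    have [->|nqx] := altP (q =P x); rewrite /=; first by rewrite ?eqxx ?ux ?(negPf xu) /= sw subnK.
    have [->|nqu] := altP (q =P u); first by rewrite iw.
    by rewrite (supp_w' I) // eV !inE negb_or nqx.
  by rewrite /= andbF (supp_w I) // eV !inE negb_or npx.
have o0 y v' : v' \notin V -> o y v' = 0 /\ o v' y = 0.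
  rewrite eV !inE negb_or => /andP[/negPf h1 /negPf h2].
  by rewrite /o h1 h2 !andbF.
rewrite /net; rewrite (s2 (o v)); last by move=> y /(o0 v)[].
rewrite (s2 (o^~ v)); last by move=> y /(o0 v)[].
rewrite /o !eqxx ux (negPf xu) !andbF !andbT /=.
have [->|vx] := altP (v =P x); first by rewrite (negPf xu) bn /=; move: ne; clear; lia.
have [->|vu] := altP (v =P u); first by rewrite /=; move: ne; clear; lia.
have vV : v \notin V by rewrite eV !inE negb_or vx.
by rewrite (supp_zo I) // (supp_zi I).
Qed.

(** * The induction step *)

Section Step.
Variables (V : {set T}) (n N : nat).
Hypothesis cV : #|V| <= n.+1.
Hypothesis IHV : forall (V' : {set T}) w' zo' zi' tau', #|V'| <= n -> inst K V' w' zo' zi' tau' ->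
  sol K V' w' zo' zi' tau'.
Hypothesis IHN : forall w' zo' zi' tau', \sum_v tdeg w' zo' zi' v <= N -> inst K V w' zo' zi' tau' ->
  sol K V w' zo' zi' tau'.

(** When z receives no arc, any x can be eliminated with [2K - tau x] virtual edges x -> z: at most
    12K arcs leave z, and fewer than 2K new ones keep its degree within 14K. *)
Lemma sol_allpos w zo zi tau : inst K V w zo zi tau -> \sum_v tdeg w zo zi v <= N.+1 ->
  2 < #|V| -> (forall A, A \proper V -> 2 <= #|A| -> 14 * K < bcut w zo zi A) ->
  (forall u, u \in V -> tdeg w zo zi u <= 9 * K) ->
  (forall u, u \in V -> (0 < tau u)%R) -> sol K V w zo zi tau.
Proof.
move=> I sN V3 big dV pos.
have IHV' (V' : {set T}) w' zo' zi' tau' : #|V'| < #|V| -> inst K V' w' zo' zi' tau' ->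
    sol K V' w' zo' zi' tau'.
  by move=> c; apply: IHV; lia.
have IHN' w' zo' zi' tau' : inst K V w' zo' zi' tau' ->
    \sum_v tdeg w' zo' zi' v < \sum_v tdeg w zo zi v -> sol K V w' zo' zi' tau'.
  by move=> i s; apply: IHN i; lia.
have [/existsP[v /andP[vV zv]]|] := boolP [exists v, (v \in V) && (0 < zi v)].
  exact: (step_zi K0 I big IHN' vV (pos v vV) zv).
rewrite negb_exists => /forallP z0.
have szi : \sum_u zi u = 0.
  rewrite big1 // => u _; have [uV|uV] := boolP (u \in V); last exact: supp_zi I _ uV.
  by have := z0 u; rewrite uV /= lt0n negbK => /eqP.
have [x xV] : exists x, x \in V by apply/card_gt0P; lia.
have tx := in_tau I xV; have px := pos x xV.
apply: (@step_elim T K K0 V w zo zi tau I big V3 IHV' x (2 * K - `|tau x|%N) 0) => //.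
- by exists (-1)%R; lia.
- by lia.
- by have := in_zo I; lia.
- by have := in_zo I; lia.
by lia.
Qed.

Lemma sol_step w zo zi tau : inst K V w zo zi tau -> \sum_v tdeg w zo zi v <= N.+1 ->
  sol K V w zo zi tau.
Proof.
move=> I sN.
have IHV' (V' : {set T}) w' zo' zi' tau' : #|V'| < #|V| -> inst K V' w' zo' zi' tau' ->
    sol K V' w' zo' zi' tau'.
  by move=> c; apply: IHV; lia.
have IHN' w' zo' zi' tau' : inst K V w' zo' zi' tau' ->
    \sum_v tdeg w' zo' zi' v < \sum_v tdeg w zo zi v -> sol K V w' zo' zi' tau'.
  by move=> i s; apply: IHN i; lia.
have [c2|V3] : #|V| = 2 \/ 2 < #|V| by have := in_card I; lia.
  exact: sol_base.
have [/existsP[A /and3P[pA A2 bA]]|] :=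
    boolP [exists A : {set T}, [&& A \proper V, 2 <= #|A| & bcut w zo zi A <= 14 * K]].
  have [a aA] : exists a, a \in A by apply/card_gt0P; lia.
  exact: (step_contract K0 I pA A2 aA bA IHV').
rewrite negb_exists => /forallP nb.
have big A : A \proper V -> 2 <= #|A| -> 14 * K < bcut w zo zi A.
  by move=> pA A2; have := nb A; rewrite pA A2 /= -ltnNge.
have [/existsP[v /andP[vV zv]]|] := boolP [exists v, (v \in V) && (8 * K + `|tau v|%N + 1 < tdeg w zo zi v)].
  exact: (step_lift K0 I big IHN' V3 vV zv).
rewrite negb_exists => /forallP ns.
(* The degree is at most 8K + |tau u| + 1 and has the parity of tau u, so the last unit drops
   out. *)
have dV u : u \in V -> tdeg w zo zi u <= 9 * K.
  move=> uV; have := ns u; rewrite uV /= -leqNgt => h.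
  by have := in_par I uV; have := in_tau I uV; lia.
have [/existsP[x /andP[xV /eqP tx]]|] := boolP [exists x, (x \in V) && (tau x == 0%R)].
  apply: (@step_elim T K K0 V w zo zi tau I big V3 IHV' x 0 0) => //; rewrite ?addn0.
  - by rewrite tx; apply: eqm_refl.
  - exact: in_z I.
  - exact: in_zo I.
  exact: in_zi I.
rewrite negb_exists => /forallP nz.
have [/existsP[u /existsP[v /and5P[uV vV wuv tu tv]]]|] := boolP [exists u, exists v,
    [&& u \in V, v \in V, 0 < w u v, (0 < tau u)%R & (tau v < 0)%R]].
  exact: (step_del K0 I big IHN' uV vV wuv tu tv).
rewrite negb_exists => /forallP nadj.
have adj u v : u \in V -> v \in V -> (0 < tau u)%R -> (tau v < 0)%R -> w u v = 0.
  move=> uV vV tu tv; have := nadj u; rewrite negb_exists => /forallP/(_ v).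
  by rewrite uV vV tu tv /= andbT; lia.
have small A : A \subset V -> (forall u v, u \in A -> v \in V -> v \notin A -> w u v = 0) ->
    bcut w zo zi A <= 14 * K.
  move=> AV h; rewrite /bcut [cut w A]big1 ?add0n.
    apply: leq_trans (in_z I); rewrite -big_split /=.
    by rewrite [X in _ <= X](bigID (mem A)) leq_addr.
  move=> a _; rewrite big1 // => b _; case aA: (a \in A); last by rewrite muln0.
  have [bA|bA] := boolP (b \in A); first by rewrite muln0.
  by have [bV|bV] := boolP (b \in V); [rewrite h | rewrite (supp_w' I)].
(* No edge joins a positive residue to a negative one, so only edges to z leave either class, at
   most 14K. If both classes were nonempty, one of them would have two vertices and a small
   boundary. *)
pose P := [set v in V | (0 < tau v)%R]; pose M := [set v in V | (tau v < 0)%R].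
have nzV v : v \in V -> tau v <> 0%R by move=> vV e; have := nz v; rewrite vV e eqxx.
have bP : bcut w zo zi P <= 14 * K.
  apply: small; first by apply/subsetP => v; rewrite inE => /andP[].
  by move=> u v; rewrite !inE => /andP[uV tu] vV; rewrite vV /= => tv; apply: adj => //; have := nzV v vV; lia.
have bM : bcut w zo zi M <= 14 * K.
  apply: small; first by apply/subsetP => v; rewrite inE => /andP[].
  move=> u v; rewrite !inE => /andP[uV tu] vV; rewrite vV /= => tv.
  by rewrite (in_sym I).1; apply: adj => //; have := nzV v vV; lia.
have cPM : #|P| + #|M| = #|V|.
  rewrite -cardsUI; have -> : P :&: M = set0.
    by apply/setP => v; rewrite !inE; case: (v \in V) => //=; lia.
  rewrite cards0 addn0; apply: eq_card => v; rewrite !inE.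
  by case vV: (v \in V) => //=; have := nzV v vV; lia.
have PV : P \subset V by apply/subsetP => v; rewrite inE => /andP[].
have MV : M \subset V by apply/subsetP => v; rewrite inE => /andP[].
have [P0|P0] := posnP #|P|.
  apply: sol_opp; apply: sol_allpos => //.
  - exact: inst_opp.
  - by apply: leq_trans sN; apply: leq_sum => v _; rewrite /tdeg addnAC.
  - move=> A pA cA; have := big A pA cA; rewrite /bcut; congr (_ < _ + _).
    by apply: eq_bigr => u _; rewrite addnC.
  - by move=> u /dV; rewrite /tdeg addnAC.
  move=> u uV; have : u \notin P by rewrite (cards0_eq P0) inE.
  by rewrite inE uV /=; have := nzV u uV; lia.
have [M0|M0] := posnP #|M|.
  apply: (sol_allpos I) => // u uV; have : u \notin M by rewrite (cards0_eq M0) inE.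
  by rewrite inE uV /=; have := nzV u uV; lia.
have [P2|M2] : 2 <= #|P| \/ 2 <= #|M| by lia.
  have : P \proper V by rewrite properEcard PV; lia.
  by move/big => /(_ P2); lia.
have : M \proper V by rewrite properEcard MV; lia.
by move/big => /(_ M2); lia.
Qed.

End Step.

Lemma inst_sol V w zo zi tau : inst K V w zo zi tau -> sol K V w zo zi tau.
Proof.
move: {2}#|V| (leqnn #|V|) => n; elim: n V w zo zi tau => [|n IHV] V w zo zi tau cV.
  by move=> I; have := in_card I; lia.
move: {2}(\sum_v _) (leqnn (\sum_v tdeg w zo zi v)) => N.
elim: N w zo zi tau => [|N IHN] w zo zi tau sN I; last exact: (sol_step cV IHV IHN I sN).
have [x xV] : exists x, x \in V by apply/card_gt0P; have := in_card I; lia.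
have := in_deg I xV.
by move: sN; rewrite (bigD1 x) //=; lia.
Qed.

Theorem mod_orient (w : T -> T -> nat) (V : {set T}) (tau : T -> int) : wsym w ->
  (forall u v, u \notin V -> w u v = 0) ->
  (forall A, A \proper V -> A != set0 -> 9 * K <= cut w A) ->
  (forall v, v \in V -> odd (deg w v) = odd `|tau v|%N) ->
  eqm K (\sum_(v in V) tau v)%R 0%R ->
  exists f, Ori w (fun=> 0) (fun=> 0) f /\ forall v, v \in V -> eqm K (f v) (tau v).
Proof.
move=> sw su hc par e0.
have w0 u v : v \notin V -> w u v = 0 by move=> vV; rewrite sw.1 su.
have [c1|c2] := leqP #|V| 1.
  exists (fun=> 0%R); split.
    exists (fun _ _ => 0); split=> [x y|v]; last by rewrite /net !big1.
    have [xV|/su //] := boolP (x \in V); have [yV|/w0 //] := boolP (y \in V).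
    by move/card_le1_eqP: c1 => /(_ x y xV yV) ->; rewrite sw.2.
  move=> v vV; apply: eqm_sym; move: e0; rewrite (sumz_D1 _ vV) big1 ?GRing.addr0 //.
  by move=> i /setD1P[iv iV]; move/card_le1_eqP: c1 => /(_ i v iV vV) h; rewrite h eqxx in iv.
have exq (v : T) : exists t : int, eqm K t (tau v) /\ `|t|%N <= K.
  have [t [te tl tu]] := eqm_rep (tau v) (- K%:Z)%R K0.
  by exists t; split=> //; lia.
have [tau1 htau] := fin_all_exists exq.
have I : inst K V w (fun=> 0) (fun=> 0) tau1.
  have td v : tdeg w (fun=> 0) (fun=> 0) v = deg w v by rewrite /tdeg !addn0.
  split=> //=; rewrite ?big1_eq //.
  - by move=> u uV; rewrite td /deg big1 // => v _; apply: su.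
  - by move=> v _; case: (htau v).
  - by move=> v vV; rewrite td par //; case: (htau v) => /eqm_par -> _.
  - move=> v vV; rewrite td -(cut1 _ sw.2).
    have : [set v] \proper V by rewrite properEcard sub1set vV cards1.
    have v0 : [set v] != set0 by rewrite -card_gt0 cards1.
    move/hc => /(_ v0) h.
    by case: (htau v) => _; lia.
  - move=> A pA cA; rewrite /bcut; apply: leq_trans (leq_addr _ _); apply: hc => //.
    by rewrite -cards_eq0; lia.
  have h0 : eqm K (\sum_(v in V) tau1 v)%R (\sum_(v in V) tau v)%R.
    by apply: eqm_sum => v _; case: (htau v).
  exact: eqm_trans h0 e0.
have [f [of_ hf]] := inst_sol I.
exists f; split=> // v vV; have [_ ef] := hf v vV.
exact: eqm_trans ef (htau v).1.
Qed.

End Main.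

(** * Lovász splitting *)

Section Splitting.
Variable T : finType.
Implicit Types (w : T -> T -> nat) (A X Y Z : {set T}).

(* The edge replacing the path p - s - r; it is dropped when it is a loop *)
Definition shortcut (p r a b : T) := if p == r then 0 else edge1 p r a b.

Definition separates A X := (A :&: X != set0) && (A :\: X != set0).

Lemma separatesC A X : separates A (~: X) = separates A X.
Proof. by rewrite /separates !setDE setCK andbC. Qed.

Definition split_at w s p r w' :=
  [/\ wsym w', 0 < w s p, 0 < w s r &
      forall a b, w a b + shortcut p r a b = w' a b + edge1 s p a b + edge1 s r a b].

Lemma cut_shortcut p r X : cut (shortcut p r) X = ((p \in X) (+) (r \in X)).
Proof.
rewrite /shortcut; case: eqP => [->|_]; last exact: cut_edge1.
by rewrite addbb /cut big1 // => a _; rewrite big1.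
Qed.

Lemma cut_split w s p r w' X : split_at w s p r w' ->
  cut w X + ((p \in X) (+) (r \in X)) =
  cut w' X + ((s \in X) (+) (p \in X)) + ((s \in X) (+) (r \in X)).
Proof.
case=> _ _ _ e; have := eq_cut X e.
by rewrite (cutD w) cut_shortcut (cutD (fun a b => w' a b + edge1 s p a b)) (cutD w') !cut_edge1.
Qed.

(** The condition [(r == p) < w s r] says that an edge s r is left after one edge s p is set aside;
    thus r = p is allowed for a multiple edge. *)
Lemma split_exists w s p r : wsym w -> 0 < w s p -> (r == p) < w s r ->
  exists w', split_at w s p r w'.
Proof.
move=> [sw iw] wp wr; have wr0 : 0 < w s r by lia.
have nsp : s != p by apply: contraL wp => /eqP <-; rewrite iw.
have nsr : s != r by apply: contraL wr => /eqP <-; rewrite iw.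
pose w' a b := w a b + shortcut p r a b - (edge1 s p a b + edge1 s r a b).
have ew a b : w a b + shortcut p r a b = w' a b + edge1 s p a b + edge1 s r a b.
  rewrite -addnA /w' subnK //; apply: leq_trans (leq_addr _ _).
  have key c : (c == p) + (c == r) <= w s c.
    move: wp wr; have [->|ncp] := altP (c =P p); last by have [->|_] := altP (c =P r); lia.
    by rewrite eq_sym; case: eqP => [->|]; lia.
  have -> : edge1 s p a b + edge1 s r a b =
      (a == s) * ((b == p) + (b == r)) + (b == s) * ((a == p) + (a == r)).
    by rewrite /edge1 /arc1 -!mulnb; lia.
  have [->|nas] := altP (a =P s).
    by rewrite (negPf nsp) (negPf nsr) /=; have := key b; lia.
  have [->|nbs] := altP (b =P s); last by lia.
  by rewrite (sw a s); have := key a; lia.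
clearbody w'; exists w'; split=> //; split=> [a b|a].
  have sc : shortcut p r a b = shortcut p r b a by rewrite /shortcut edge1C.
  by move: (ew a b) (ew b a); rewrite sc (sw a b) (edge1C s p) (edge1C s r); lia.
move: (ew a a); rewrite iw /shortcut; case: eqP => [_|/eqP npr]; first by lia.
rewrite {1}/edge1 /arc1.
have [->|_] := altP (a =P p); first by rewrite (negPf npr) /=; lia.
by rewrite andbF /=; lia.
Qed.

(** The inequality holds pair by pair. An edge st crosses all three sets on the right, but only
    their intersection on the left, which leaves a surplus of 2 for each such edge. *)
Lemma cut_triple w s t X Y Z : (forall a b, w a b = w b a) -> s != t ->
  t \in X -> t \in Y -> t \in Z -> s \notin X -> s \notin Y -> s \notin Z ->
  cut w (X :&: Y :&: Z) + cut w (X :\: (Y :|: Z)) + cut w (Y :\: (X :|: Z)) +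
  cut w (Z :\: (X :|: Y)) + 2 * w s t <= cut w X + cut w Y + cut w Z.
Proof.
move=> sw st tX tY tZ sX sY sZ.
have es : \sum_a \sum_b w a b * edge1 s t a b = 2 * w s t.
  transitivity (\sum_a \sum_b edge1 s t a b * w a b).
    by do 2!(apply: eq_bigr => ? _); rewrite mulnC.
  under eq_bigr do under eq_bigr do rewrite /edge1 mulnDl.
  under eq_bigr do rewrite big_split /=.
  by rewrite big_split /= !sum_arc1_mul (sw t s) mul2n addnn.
have es2 : (2 * w s t).*2 = \sum_a \sum_b w a b * (edge1 s t a b).*2.
  rewrite -es -mul2n big_distrr /=; apply: eq_bigr => a _; rewrite big_distrr /=.
  by apply: eq_bigr => b _; rewrite -mul2n mulnCA.
move: es2; move: (2 * w s t) => c es2.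
rewrite -leq_double !doubleD !cut_xor // es2.
rewrite -!big_split /=; apply: leq_sum => a _; rewrite -!big_split /=.
apply: leq_sum => b _; rewrite -!mulnDr leq_mul2l; apply/orP; right.
have [e0|] := posnP (edge1 s t a b).
  rewrite e0 addn0 !inE.
  by case: (a \in X); case: (a \in Y); case: (a \in Z);
     case: (b \in X); case: (b \in Y); case: (b \in Z).
rewrite /edge1 /arc1; have [->|nas] := altP (a =P s).
  have [->|nbt] := altP (b =P t); rewrite (negPf st) //.
  by rewrite !inE tX tY tZ (negPf sX) (negPf sY) (negPf sZ).
have [->|nat_] := altP (a =P t) => //=; have [->|nbs] := altP (b =P s) => //.
by rewrite !inE tX tY tZ (negPf sX) (negPf sY) (negPf sZ).
Qed.

(** For a fixed edge st, a partner r fails only because of a dangerous set: one that avoids s,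
    contains t and r, separates A and has cut at most lam + 1. If every partner failed, a minimal
    cover of the partners by dangerous sets would have three members, contradicting the three-set
    inequality. *)
Lemma lovasz_split w A s lam : wsym w -> s \notin A -> (forall x, 0 < w s x -> x \in A) ->
  1 < lam -> ~~ odd (deg w s) -> 0 < deg w s ->
  (forall X, separates A X -> lam <= cut w X) ->
  exists p r w', split_at w s p r w' /\ forall X, separates A X -> lam <= cut w' X.
Proof.
move=> sw sA nA lam2 ev dpos hc.
have [t wt] : exists t, 0 < w s t.
  apply/existsP; apply: contraLR dpos; rewrite negb_exists => /forallP h.
  by rewrite /deg big1 // => x _; have := h x; lia.
have st : s != t by apply: contraL wt => /eqP <-; rewrite sw.2.
pose good r := [forall X, separates A X && (s \notin X) && (t \in X) && (r \in X) ==> (lam.+1 < cut w X)].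
have [/existsP[r /andP[wr gr]]|] := boolP [exists r, ((r == t) < w s r) && good r].
  have [w' sp] := split_exists sw wt wr; exists t, r, w'; split=> // X.
  wlog sX : X / s \notin X => [H sep|sep].
    have [sX|] := boolP (s \in X); last by move=> sX; apply: H.
    have [sw' _ _ _] := sp.
    by rewrite -(cutC X sw'.1); apply: H; rewrite ?separatesC // inE sX.
  have := cut_split X sp; have := hc X sep; rewrite (negPf sX) /=.
  have [tX|tX] := boolP (t \in X); have [rX|rX] := boolP (r \in X) => /=; try by clear; lia.
  by have /forallP/(_ X) := gr; rewrite sep sX tX rX /=; lia.
rewrite negb_exists => /forallP bad; exfalso.
pose D := [set X | [&& separates A X, s \notin X, t \in X & cut w X <= lam.+1]].
pose cov (F : {set {set T}}) := (F \subset D) && [forall r, ((r == t) < w s r) ==> [exists X, (X \in F) && (r \in X)]].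
have covD : cov D.
  rewrite /cov subxx; apply/forallP => r; apply/implyP => wr.
  have := bad r; rewrite wr /= negb_forall => /existsP[X].
  rewrite negb_imply -leqNgt => /andP[/andP[/andP[/andP[h1 h2] h3] h4] h5].
  by apply/existsP; exists X; rewrite inE h1 h2 h3 h5.
have [F /minsetP[/andP[FD /forallP cF] Fmin] _] := minset_exists covD.
have FP X : X \in F -> [/\ separates A X, s \notin X, t \in X & cut w X <= lam.+1].
  by move/(subsetP FD); rewrite inE => /and4P.
have priv X : X \in F -> exists r, [/\ (r == t) < w s r, r \in X & forall Y, Y \in F -> Y != X -> r \notin Y].
  move=> XF; have : ~~ cov (F :\ X).
    apply/negP => c; have := Fmin _ c (subD1set _ _) => /setP/(_ X).
    by rewrite !inE eqxx XF.
  rewrite /cov negb_and => /orP[|].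
    by rewrite (subset_trans (subD1set _ _) FD).
  rewrite negb_forall => /existsP[r]; rewrite negb_imply negb_exists => /andP[wr /forallP h].
  have hY Y : Y \in F -> Y != X -> r \notin Y.
    by move=> YF YX; have := h Y; rewrite !inE YX YF.
  exists r; split=> //; have := cF r; rewrite wr /= => /existsP[Y /andP[YF rY]].
  by have [<-|YX] := altP (Y =P X) => //; have := hY Y YF YX; rewrite rY.
(* Adding s to X keeps the cut at least lam, so twice the number of edges from s to X is at most
   [deg w s + 1]; evenness of the degree removes the 1. *)
have half X : X \in F -> (\sum_(x in X) w s x).*2 <= deg w s.
  move=> /FP[sep sX tX cX]; have := cutU1 sw sX.
  have : lam <= cut w (s |: X).
    rewrite -(cutC _ sw.1); apply: hc; rewrite separatesC.
    move: sep; rewrite /separates; suff -> : A :&: (s |: X) = A :&: X.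
      by suff -> : A :\: (s |: X) = A :\: X => //; apply/setP => x; rewrite !inE;
         have [->|] := altP (x =P s) => //=; rewrite (negPf sA) !andbF.
    by apply/setP => x; rewrite !inE; have [->|] := altP (x =P s) => //=; rewrite (negPf sA).
  by lia.
have tot : \sum_r (w s r - (r == t)) = (deg w s).-1.
  have : \sum_r (w s r - (r == t)) + \sum_r (r == t) = deg w s.
    by rewrite -big_split; apply: eq_bigr => r _ /=; rewrite subnK //; case: eqP => [->|].
  by rewrite sum_eqb; lia.
have le1 : (deg w s).-1 <= \sum_(X in F) \sum_(r in X) (w s r - (r == t)).
  rewrite -tot (exchange_big_dep xpredT) //=; apply: leq_sum => r _.
  have [->//|pos] := posnP (w s r - (r == t)).
  have wr : (r == t) < w s r by lia.
  have := cF r; rewrite wr /= => /existsP[X /andP[XF rX]].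
  by rewrite (bigD1 X) ?XF //= leq_addr.
have le2 X : X \in F -> (\sum_(r in X) (w s r - (r == t))).*2 <= deg w s - 2.
  move=> XF; have [_ _ tX _] := FP X XF.
  suff : \sum_(r in X) (w s r - (r == t)) + 1 = \sum_(x in X) w s x by have := half X XF; lia.
  rewrite (bigD1 t) //= [RHS](bigD1 t) //= eqxx [X in _ + X + 1](eq_bigr (w s)); first by lia.
  by move=> r /andP[_ /negPf->]; rewrite subn0.
(* With one edge st set aside, [deg w s - 1] edges must be covered, and each dangerous set covers at
   most half of [deg w s - 2]; two sets do not suffice. *)
have F3 : 2 < #|F|.
  rewrite ltnNge; apply/negP => F2.
  have : (\sum_(X in F) \sum_(r in X) (w s r - (r == t))).*2 <= #|F| * (deg w s - 2).
    rewrite -mul2n big_distrr -sum_nat_const /=; apply: leq_sum => X XF.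
    by rewrite mul2n; apply: le2.
  have : #|F| * (deg w s - 2) <= 2 * (deg w s - 2) by rewrite leq_mul2r F2 orbT.
  by move: dpos ev; lia.
have [X [Y [Z [[XF YF ZF] [XY YZ ZX]]]]] := card_gt2P F3.
have [sX1 sX2 sX3 cX] := FP X XF; have [sY1 sY2 sY3 cY] := FP Y YF.
have [sZ1 sZ2 sZ3 cZ] := FP Z ZF.
have nAr r : (r == t) < w s r -> r \in A by move=> h; apply: nA; apply: leq_ltn_trans h.
have sub (W U : {set T}) r : separates A W -> U \subset W -> r \in U -> r \in A -> lam <= cut w U.
  move=> /andP[_ AW] UW rU rA; apply: hc; rewrite /separates.
  apply/andP; split; first by apply/set0Pn; exists r; rewrite inE rA.
  apply: contraNneq AW => e; rewrite -subset0 -e; exact: setDS.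
have [x [wx xX nx]] := priv X XF; have [y [wy yY ny]] := priv Y YF.
have [z [wz zZ nz]] := priv Z ZF.
(* The intersection contains t, and each difference contains a private neighbour given by
   minimality, so all four sets separate A. This gives 4 lam + 2 <= 3 (lam + 1), against lam > 1. *)
have := cut_triple sw.1 st sX3 sY3 sZ3 sX2 sY2 sZ2.
have l1 : lam <= cut w (X :&: Y :&: Z).
  apply: (sub X _ t sX1) => //; [by rewrite -setIA subsetIl | by rewrite !inE sX3 sY3|exact: nA].
have l2 : lam <= cut w (X :\: (Y :|: Z)).
  apply: (sub X _ x sX1) => //; [exact: subsetDl| |exact: nAr].
  by rewrite !inE xX andbT negb_or (nx Y) ?(nx Z) // eq_sym.
have l3 : lam <= cut w (Y :\: (X :|: Z)).
  apply: (sub Y _ y sY1) => //; [exact: subsetDl| |exact: nAr].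
  by rewrite !inE yY andbT negb_or (ny X) ?(ny Z) // eq_sym.
have l4 : lam <= cut w (Z :\: (X :|: Y)).
  apply: (sub Z _ z sZ1) => //; [exact: subsetDl| |exact: nAr].
  by rewrite !inE zZ andbT negb_or (nz X) ?(nz Y) // eq_sym.
by move: l1 l2 l3 l4 cX cY cZ lam2 wt; clear; lia.
Qed.

End Splitting.

(** * Orientations balanced outside A *)

Section Balanced.
Variables (T : finType) (K : nat).
Hypothesis K0 : 0 < K.
Implicit Types (w o : T -> T -> nat) (A X : {set T}).

Lemma split_deg w s p r w' u : split_at w s p r w' ->
  deg w u + (p != r) * ((u == p) + (u == r)) = deg w' u + ((u == s) + (u == p)) + ((u == s) + (u == r)).
Proof.
case=> _ _ _ e; have := @eq_deg T (fun a b => w a b + shortcut p r a b)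
  (fun a b => w' a b + edge1 s p a b + edge1 s r a b) u (e u).
rewrite (degD w (shortcut p r)) (degD (fun a b => w' a b + edge1 s p a b)) (degD w') !deg_edge1.
move=> <-; congr (_ + _); rewrite /shortcut; case: eqP => _; last by rewrite mul1n deg_edge1.
by rewrite /deg big1_eq.
Qed.

Lemma split_ori w s p r w' f : wsym w -> split_at w s p r w' ->
  Ori w' (fun=> 0) (fun=> 0) f -> Ori w (fun=> 0) (fun=> 0) f.
Proof.
move=> [sw iw] [sw' wp wr]; rewrite /shortcut; have [<-|npr] := altP (p =P r) => e.
  by apply: (@Ori_loop _ _ _ _ _ _ s p) => a b; rewrite -e addn0.
apply: (Ori_lift npr e).
have sp : (p == s) = false by apply: contraTF wp => /eqP->; rewrite iw.
have sr : (r == s) = false by apply: contraTF wr => /eqP->; rewrite iw.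
by have := e p r; rewrite /edge1 /arc1 !eqxx sp sr !andbF /=; lia.
Qed.

(** Splitting off all edges at the vertices outside A leaves a graph on A, to which the modular
    orientation applies. Undoing a splitting sends one arc into the vertex and one out of it, so
    these vertices keep net degree 0. *)
Lemma balanced_orient_f w A (tau : T -> int) : wsym w ->
  (forall b x, b \notin A -> 0 < w b x -> x \in A) ->
  (forall b, b \notin A -> ~~ odd (deg w b)) ->
  (forall X, separates A X -> 9 * K <= cut w X) ->
  (forall a, a \in A -> odd (deg w a) = odd `|tau a|%N) ->
  eqm K (\sum_(a in A) tau a)%R 0%R ->
  exists f, [/\ Ori w (fun=> 0) (fun=> 0) f, forall b, b \notin A -> f b = 0%R &
    forall a, a \in A -> eqm K (f a) (tau a)].
Proof.
move: {2}(\sum_(b | b \notin A) _) (leqnn (\sum_(b | b \notin A) deg w b)) => n.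
elim: n w => [|n IH] w sn sw nA ev hc par e0.
  have wz u v : u \notin A -> w u v = 0.
    move=> uA; move: sn; rewrite (bigD1 u) //= /deg (bigD1 v) //=; lia.
  have [|f [of_ hf]] := mod_orient K0 sw wz _ par e0.
    move=> X /properP[XA [y yA yX]] X0; apply: hc; rewrite /separates.
    rewrite (setIidPr XA) X0 /=; apply/set0Pn; exists y; by rewrite inE yX.
  exists f; split=> // b bA; case: of_ => o [ow ->].
  have o0 y : o b y = 0 /\ o y b = 0 by have := ow b y; rewrite wz //; lia.
  by rewrite /net !big1 // => y _; case: (o0 y).
have [s0|pos] := posnP (\sum_(b | b \notin A) deg w b); first by apply: IH => //; rewrite s0.
have [s sA ds] : exists2 s, s \notin A & 0 < deg w s.
  apply/exists_inP; apply: contraLR pos; rewrite negb_exists => /forallP h.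
  rewrite big1 // => b bA; have := h b; rewrite bA /=; lia.
have lam2 : 1 < 9 * K by lia.
have [p [r [w' [sp hc']]]] := lovasz_split sw sA (fun x => nA s x sA) lam2 (ev s sA) ds hc.
have [sw' wp wr e] := sp.
have pA := nA s p sA wp; have rA := nA s r sA wr.
have ne b : b \notin A -> (b == p) = false /\ (b == r) = false.
  by move=> bA; split; apply: contraNF bA => /eqP->.
have dA b : b \notin A -> deg w b = deg w' b + (b == s) * 2.
  by move=> bA; have := split_deg b sp; have [-> ->] := ne b bA; rewrite addn0 muln0; lia.
have [||||f [of_ f0 hf]] := IH w' _ sw' _ _ hc' _ e0.
- move: sn; rewrite (eq_bigr _ dA) big_split /= -big_distrl /=.
  by rewrite (bigD1 s) //= [X in _ + X * 2](bigD1 s) //= eqxx; lia.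
- move=> b x bA wbx; have := e b x; have [bp br] := ne b bA.
  have [//|xA] := boolP (x \in A); have [xp xr] := ne x xA.
  rewrite /shortcut /edge1 /arc1 bp br xp xr !andbF /=.
  have := nA b x bA; rewrite (negPf xA); case: (w b x) => [|k] h; last by have := h isT.
  by move: wbx; case: eqP => _; clear; lia.
- by move=> b bA; have := ev b bA; rewrite dA //; lia.
- move=> a aA; rewrite -par //; have := split_deg a sp.
  have -> : (a == s) = false by apply: contraNF sA => /eqP<-.
  have [->|npr] := altP (p =P r); first by lia.
  by lia.
by exists f; split=> //; apply: split_ori sw sp of_.
Qed.

Lemma balanced_orient w A (tau : T -> int) : wsym w ->
  (forall b x, b \notin A -> 0 < w b x -> x \in A) ->
  (forall b, b \notin A -> ~~ odd (deg w b)) ->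
  (forall X, separates A X -> 9 * K <= cut w X) ->
  (forall a, a \in A -> odd (deg w a) = odd `|tau a|%N) ->
  eqm K (\sum_(a in A) tau a)%R 0%R ->
  exists o, [/\ forall x y, o x y + o y x = w x y, forall b, b \notin A -> net o b = 0%R &
    forall a, a \in A -> eqm K (net o a) (tau a)].
Proof.
move=> h1 h2 h3 h4 h5 h6; have [f [[o [ow fo]] f0 hf]] := balanced_orient_f h1 h2 h3 h4 h5 h6.
have nf v : net o v = f v by rewrite fo; lia.
exists o; split=> // v vA; rewrite nf; [exact: f0 | exact: hf].
Qed.

End Balanced.

(** * Packing connected layers *)

Section Packing.
Variables (T : finType) (c : nat).
Hypothesis c0 : 0 < c.
Implicit Types (w : T -> T -> nat) (S A X Y : {set T}) (t : 'I_c -> T -> T -> nat).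

Definition supported w S := forall u v, u \notin S -> w u v = 0.

Lemma cut_supp w S X : wsym w -> supported w S -> cut w (X :&: S) = cut w X.
Proof.
move=> [sw _] su; apply: eq_bigr => a _; apply: eq_bigr => b _; rewrite !inE.
have [aS|aS] := boolP (a \in S); last by rewrite (su a b).
by have [bS|bS] := boolP (b \in S); rewrite ?andbT // sw (su b a).
Qed.

Lemma cut_suppC w S X : wsym w -> supported w S -> cut w (S :\: X) = cut w X.
Proof. by move=> sw su; rewrite setDE setIC cut_supp // cutC //; case: sw. Qed.

Lemma cut_gt0 w X a b : a \in X -> b \notin X -> 0 < w a b -> 0 < cut w X.
Proof.
move=> aX bX wab; rewrite /cut (bigD1 a) //= (bigD1 b) //= aX bX muln1.
by rewrite -addnA; apply: leq_trans wab (leq_addr _ _).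
Qed.

(** In a minimal tight set X no edge uv remains: a tight Y containing u but not v is either inside X
    or, by posimodularity, makes [X :\: Y] tight. So the cut of X is the sum of its degrees, each at
    least 2c, and it is at most 2c. *)
Lemma tight_vertex w S : wsym w -> supported w S -> 1 < #|S| ->
  (forall X, X \proper S -> X != set0 -> 2 * c <= cut w X) ->
  (forall u v, 0 < w u v -> exists X, [/\ X \proper S, u \in X, v \notin X & cut w X <= 2 * c]) ->
  exists2 s, s \in S & deg w s = 2 * c.
Proof.
move=> sw su S2 hc ht.
have [a aS] : exists a, a \in S by apply/card_gt0P; lia.
pose tight X := [&& X \proper S, X != set0 & cut w X <= 2 * c].
have [X0 t0] : exists X, tight X.
  have pa : [set a] \proper S by rewrite properEcard sub1set aS cards1.
  have na : [set a] != set0 by rewrite -card_gt0 cards1.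
  have [v wv] : exists v, 0 < w a v.
    apply/existsP; have := hc _ pa na; rewrite cut1; last by case: sw.
    apply: contraTT; rewrite negb_exists => /forallP h.
    by rewrite /deg big1; [lia | move=> v _; have := h v; lia].
  have [X [pX aX _ cX]] := ht a v wv; exists X; rewrite /tight pX cX andbT /=.
  by apply/set0Pn; exists a.
have [X /minsetP[/and3P[pX nX cX] Xmin] _] := minset_exists t0.
have [s sX] := set0Pn _ nX.
have XS := proper_sub pX.
have [/existsP[u /existsP[v /and3P[uX vX wuv]]]|] :=
   boolP [exists u, exists v, [&& u \in X, v \in X & 0 < w u v]].
  have [Y [pY uY vY cY]] := ht u v wuv.
  have [YX|] := boolP (Y \subset X).
    have tY : tight Y by rewrite /tight pY cY andbT; apply/set0Pn; exists u.
    by move: vY; rewrite (Xmin _ tY YX) vX.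
  move/subsetPn => [y yY yX]; have := cut_posimod X Y sw.1.
  have pXY : X :\: Y \proper S by apply: sub_proper_trans pX; apply: subsetDl.
  have nXY : X :\: Y != set0 by apply/set0Pn; exists v; rewrite inE vX vY.
  have pYX : Y :\: X \proper S by apply: sub_proper_trans pY; apply: subsetDl.
  have nYX : Y :\: X != set0 by apply/set0Pn; exists y; rewrite inE yX yY.
  have h1 := hc _ pXY nXY; have h2 := hc _ pYX nYX => h3.
  have tXY : tight (X :\: Y) by rewrite /tight pXY nXY /=; move: h1 h2 h3 cX cY; clear; lia.
  by move: uX; rewrite -(Xmin _ tXY (subsetDl _ _)) inE uY.
rewrite negb_exists => /forallP h.
have noin u v : u \in X -> v \in X -> w u v = 0.
  by move=> uX vX; have := h u; rewrite negb_exists => /forallP/(_ v); rewrite uX vX /=; lia.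
have d2 x : x \in X -> 2 * c <= deg w x.
  move=> xX; rewrite -cut1; last by case: sw.
  apply: hc; last by rewrite -card_gt0 cards1.
  by rewrite properEcard sub1set cards1 S2 (subsetP XS).
have cutE : cut w X = \sum_(x in X) deg w x.
  rewrite [RHS]big_mkcond; apply: eq_bigr => x _; case: ifPn => xX.
    apply: eq_bigr => y _; have [yX|yX] := boolP (y \in X); first by rewrite noin.
    by rewrite muln1.
  by rewrite big1 // => y _; rewrite muln0.
exists s; first exact: (subsetP XS).
have := d2 s sX; move: cX; rewrite cutE (bigD1 s) //=; lia.
Qed.

(** A packing of c edge-disjoint subgraphs, each of which connects the vertices of A, possibly
    through vertices outside A; connectedness is expressed by cuts. *)
Definition layered w A t := [/\ forall i, wsym (t i),
  forall x y, \sum_i t i x y <= w x y & forall i X, separates A X -> 0 < cut (t i) X].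

Definition upd t i (g : T -> T -> nat) j := if j == i then g else t j.

Lemma sum_upd t i g x y : \sum_j upd t i g j x y + t i x y = \sum_j t j x y + g x y.
Proof.
rewrite (bigD1 i) //= [X in _ = X + _](bigD1 i) //= /upd eqxx.
rewrite (eq_bigr (fun j => t j x y)); last by move=> j /negPf ->.
by lia.
Qed.

Lemma layer_le w A t i x y : layered w A t -> t i x y <= w x y.
Proof. by case=> _ h _; apply: leq_trans (h x y); rewrite (bigD1 i) //= leq_addr. Qed.

Lemma add_edge_sym w u v : u != v -> wsym w -> wsym (fun a b => w a b + edge1 u v a b).
Proof.
move=> uv [sw iw]; split=> [a b|a]; first by rewrite sw edge1C.
rewrite iw /edge1 /arc1; have [->|_] := altP (a =P u); first by rewrite (negPf uv).
by rewrite andbF.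
Qed.

(* Undo the splitting of s along p, r.  A layer through the edge pr is rerouted
   through s; if it already reaches s, one of the edges sp, sr suffices. *)
Lemma unsplit w A s p r w' t' : wsym w -> s \notin A -> p \in A -> r \in A ->
  (forall x, 0 < w s x -> x \in A) -> split_at w s p r w' -> layered w' A t' ->
  exists t, layered w A t /\
    \sum_i maxn (deg (t i) s) 1 <= \sum_i maxn (deg (t' i) s) 1 + 1.
Proof.
move=> sw sA pA rA nA sp lay; have [st le cn] := lay.
have [sw' wp wr e] := sp.
have ps : (p == s) = false by apply: contraNF sA => /eqP<-.
have rs : (r == s) = false by apply: contraNF sA => /eqP<-.
have [epr|npr] := altP (p =P r).
  exists t'; split; last by rewrite leq_addr.
  split=> // x y; apply: leq_trans (le x y) _; have := e x y.
  by rewrite /shortcut epr eqxx; lia.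
have e2 a b : w a b + edge1 p r a b = w' a b + edge1 s p a b + edge1 s r a b.
  by have := e a b; rewrite /shortcut (negPf npr).
have edge_pr a b : edge1 p r a b = 0 \/ ((a = p /\ b = r) \/ (a = r /\ b = p)).
  have [/andP[/eqP-> /eqP->]|n1] := boolP ((a == p) && (b == r)); first by right; left.
  have [/andP[/eqP-> /eqP->]|n2] := boolP ((a == r) && (b == p)); first by right; right.
  by left; rewrite /edge1 /arc1 (negPf n1) (negPf n2).
have wpr : w' p r = w p r + 1.
  have := e2 p r; rewrite /edge1 /arc1 !eqxx ps rs (negPf npr) /=.
  by rewrite ?andbF /=; lia.
have [lepr|ltpr] := leqP (\sum_i t' i p r) (w p r).
  exists t'; split; last by rewrite leq_addr.
  split=> // x y; case: (edge_pr x y) => [z|[[-> ->]|[-> ->]]] //.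
    by apply: leq_trans (le x y) _; have := e2 x y; rewrite z; lia.
  by rewrite (eq_bigr (fun i => t' i p r)) ?(sw.1 r p) // => i _; rewrite (st i).1.
have [i ti] : exists i, 0 < t' i p r.
  apply/existsP; apply: contraLR ltpr; rewrite negb_exists => /forallP h.
  by rewrite big1 // => i _; have := h i; lia.
pose base a b := t' i a b - edge1 p r a b.
have eb a b : t' i a b = base a b + edge1 p r a b.
  rewrite /base subnK //; case: (edge_pr a b) => [->//|[[-> ->]|[-> ->]]].
    by rewrite /edge1 /arc1 !eqxx (negPf npr) /=; lia.
  by rewrite /edge1 /arc1 !eqxx (negPf npr) andbF /= (st i).1; lia.
clearbody base.
have sb : wsym base.
  split=> [a b|a]; last by have := eb a a; rewrite (st i).2; lia.
  by have := eb a b; have := eb b a; rewrite (st i).1 edge1C; lia.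
have cb X : cut (t' i) X = cut base X + ((p \in X) (+) (r \in X)).
  by rewrite (eq_cut X eb) (cutD base) cut_edge1.
have db : deg base s = deg (t' i) s.
  apply: eq_bigr => y _; rewrite eb; suff -> : edge1 p r s y = 0 by rewrite addn0.
  by rewrite /edge1 /arc1 ![s == _]eq_sym ps rs.
have done g : wsym g -> (forall X, separates A X -> 0 < cut g X) ->
   (forall a b, g a b <= base a b + edge1 s p a b + edge1 s r a b) ->
   maxn (deg g s) 1 <= maxn (deg (t' i) s) 1 + 1 ->
   exists t, layered w A t /\ \sum_i maxn (deg (t i) s) 1 <= \sum_i maxn (deg (t' i) s) 1 + 1.
  move=> sg cg gle gd; exists (upd t' i g); split.
    split=> [j|x y|j X sep]; rewrite /upd; try by case: eqP => // _; auto.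
    have := sum_upd t' i g x y; have := le x y; have := e2 x y; have := eb x y; have := gle x y.
    by rewrite /upd; clear; lia.
  rewrite [X in X <= _](bigD1 i) //= [X in _ <= X + _](bigD1 i) //= /upd eqxx.
  rewrite [X in _ + X <= _](eq_bigr (fun j => maxn (deg (t' j) s) 1)); last by move=> j /negPf ->.
  by lia.
have nsp : s != p by rewrite eq_sym ps.
have nsr : s != r by rewrite eq_sym rs.
(* A layer not reaching s already counts 1 in the sum of [maxn (deg _ s) 1], so taking both new
   edges raises the sum only by 1. *)
have [d0|dpos] := posnP (deg (t' i) s).
  apply: (done (fun a b => base a b + edge1 s p a b + edge1 s r a b)) => //.
  - by do 2!apply: add_edge_sym => //.
  - move=> X sep; have := cn i X sep; rewrite cb.
    rewrite (cutD (fun a b => base a b + edge1 s p a b)) (cutD base) !cut_edge1.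
    by clear; case: (p \in X); case: (r \in X); case: (s \in X) => /=; lia.
  rewrite (degD (fun a b => base a b + edge1 s p a b)) (degD base) !deg_edge1 db d0 eqxx.
  by rewrite (negPf nsp) (negPf nsr).
have md g : deg g s = deg base s + 1 -> maxn (deg g s) 1 <= maxn (deg (t' i) s) 1 + 1.
  by move=> ->; rewrite db; clear; lia.
have dq q : s != q -> deg (fun a b => base a b + edge1 s q a b) s = deg base s + 1.
  by move=> sq; rewrite (degD base) deg_edge1 eqxx (negPf sq) addn0.
have [/forallP h1|] := boolP [forall X, separates A X ==> (0 < cut (fun a b => base a b + edge1 s p a b) X)].
  apply: (done _ (add_edge_sym nsp sb)).
  - by move=> X sep; have := h1 X; rewrite sep.
  - by move=> a b; apply: leq_addr.
  exact: md (dq p nsp).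
have [/forallP h2 _|] := boolP [forall X, separates A X ==> (0 < cut (fun a b => base a b + edge1 s r a b) X)].
  apply: (done _ (add_edge_sym nsr sb)).
  - by move=> X sep; have := h2 X; rewrite sep.
  - by move=> a b; rewrite addnAC; apply: leq_addr.
  exact: md (dq r nsr).
have key q : q \in A -> ~~ [forall X, separates A X ==> (0 < cut (fun a b => base a b + edge1 s q a b) X)] ->
   exists X, [/\ separates A X, s \in X, q \in X & cut base X = 0].
  move=> qA; rewrite negb_forall => /existsP[X]; rewrite negb_imply (cutD base) cut_edge1.
  case/andP=> sep h; have [sX|sX] := boolP (s \in X).
    by exists X; split=> //; move: h; rewrite sX; clear; case: (q \in X) => //=; lia.
  exists (~: X); rewrite separatesC cutC ?inE ?sX; last exact: sb.1.
  by split=> //; move: h; rewrite (negPf sX) ?inE; clear; case: (q \in X) => //=; lia.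
(* If neither edge alone reconnects the layer, X holds s and p but not r, Y holds s and r but not p,
   and no edge of [base] leaves either. Then none leaves their intersection, which contains s and a
   neighbour of s in A but neither p nor r; so the original layer was disconnected. *)
move=> /(key r rA) [Y [sepY sY rY cY]] /(key p pA) [X [sepX sX pX cX]].
have rX : r \notin X by have := cn i X sepX; rewrite cb cX pX; case: (r \in X).
have pY : p \notin Y by have := cn i Y sepY; rewrite cb cY rY; case: (p \in Y).
have cXY : cut base (X :&: Y) = 0 by have := cut_submod base X Y; move: cX cY; clear; lia.
have [y ty] : exists y, 0 < t' i s y.
  apply/existsP; apply: contraLR dpos; rewrite negb_exists => /forallP h.
  by rewrite /deg big1 // => y _; have := h y; clear; lia.
have yA : y \in A.
  apply: nA; have := e2 s y; have := layer_le i s y lay; move: ty.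
  by rewrite /edge1 /arc1 ![s == _]eq_sym ps rs /=; clear; lia.
have by_ : 0 < base s y.
  by have := eb s y; move: ty; rewrite /edge1 /arc1 ![s == _]eq_sym ps rs /=; clear; lia.
have yXY : y \in X :&: Y.
  by apply: contraT => h; have := cut_gt0 _ h by_; rewrite cXY inE sX sY => /(_ isT).
have : separates A (X :&: Y).
  apply/andP; split; apply/set0Pn; first by exists y; rewrite inE yA.
  by exists p; rewrite !inE (negPf pY) andbF pA.
by move/(cn i); rewrite cb cXY !inE (negPf pY) (negPf rX) andbF.
Qed.

(** The hypothesis reserves one edge at s for each layer that does not yet reach s, so a free edge
    is available as long as such a layer exists. *)
Lemma attach w A s t : s \notin A -> wsym w -> (forall i, wsym (t i)) ->
  layered w A t -> \sum_i maxn (deg (t i) s) 1 <= deg w s ->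
  exists t, layered w A t /\ forall i, 0 < deg (t i) s.
Proof.
move=> sA sw _; move: {2}#|[set i | deg (t i) s == 0]| (leqnn #|[set i | deg (t i) s == 0]|) => n.
elim: n t => [|n IH] t cn lay hm.
  exists t; split=> // i; move: cn; rewrite leqn0 cards_eq0 => /eqP/setP/(_ i).
  by rewrite !inE; lia.
have [/existsP[i /eqP di]|] := boolP [exists i, deg (t i) s == 0]; last first.
  by rewrite negb_exists => /forallP h; exists t; split=> // i; have := h i; lia.
have lt1 : \sum_j deg (t j) s < deg w s.
  apply: leq_trans hm; rewrite (bigD1 i) //= [X in _ < X](bigD1 i) //= di add0n.
  by rewrite add1n ltnS; apply: leq_sum => j _; apply: leq_maxl.
have [x hx] : exists x, \sum_j t j s x < w s x.
  apply/existsP; apply: contraLR lt1; rewrite negb_exists -leqNgt => /forallP h.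
  by rewrite exchange_big; apply: leq_sum => x _; rewrite leqNgt.
have sx : s != x by apply: contraTneq hx => <-; rewrite sw.2.
have [st le co] := lay.
pose g a b := t i a b + edge1 s x a b.
have dg : deg g s = 1 by rewrite /g (degD (t i)) deg_edge1 di eqxx (negPf sx).
have lay' : layered w A (upd t i g).
  split=> [j|a b|j X sep].
  - by rewrite /upd; case: eqP => // _; apply: add_edge_sym.
  - have su := sum_upd t i g a b; have l := le a b.
    have eg : g a b = t i a b + edge1 s x a b by [].
    have [e0|e1] := posnP (edge1 s x a b); first by move: su l eg e0; clear; lia.
    suff l1 : \sum_j t j a b < w a b /\ edge1 s x a b <= 1.
      by move: su eg l1; clear; lia.
    move: hx e1 {l su eg}; rewrite /edge1 /arc1 => hx; have [->|nas] := altP (a =P s).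
      by rewrite (negPf sx) /=; have [->|nbx] := altP (b =P x).
    have [->|nax] := altP (a =P x) => //=; have [->|nbs] := altP (b =P s) => //= _.
    have -> : \sum_j t j x s = \sum_j t j s x by apply: eq_bigr => j _; rewrite (st j).1.
    by rewrite (sw.1 x s); split.
  rewrite /upd; case: eqP => _; last exact: co.
  by rewrite /g (cutD (t i)); apply: leq_trans (co i X sep) (leq_addr _ _).
apply: (IH (upd t i g)) => //.
  have : [set j | deg (upd t i g j) s == 0] \subset [set j | deg (t j) s == 0] :\ i.
    apply/subsetP => j; rewrite !inE /upd; have [->|_] := altP (j =P i) => //=.
    by rewrite dg.
  move/subset_leq_card; move: cn; rewrite (cardsD1 i) inE di eqxx; lia.
apply: leq_trans hm; rewrite [X in X <= _](bigD1 i) //= [X in _ <= X](bigD1 i) //=.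
rewrite /upd eqxx dg di; apply: leq_add => //.
by apply: leq_sum => j /negPf ->.
Qed.

(** Each splitting lowers the degree of s by 2, and undoing it raises the sum by at most 1; when s
    is isolated the sum is c. For a vertex of degree 2c the bound is exactly what attaching every
    layer to s requires. *)
Lemma pack_split n : (forall w S, #|S| <= n -> wsym w -> supported w S ->
    (forall X, X \proper S -> X != set0 -> 2 * c <= cut w X) ->
    exists t, layered w S t) ->
  forall w A s, #|A| <= n -> wsym w -> supported w (s |: A) -> s \notin A ->
  ~~ odd (deg w s) -> (forall X, separates A X -> 2 * c <= cut w X) ->
  exists t, layered w A t /\ (\sum_i maxn (deg (t i) s) 1).*2 <= 2 * c + deg w s.
Proof.
move=> IH w A s; move: {2}(deg w s) (leqnn (deg w s)) => d.
elim: d w => [|d IHd] w dd cA sw su sA ev hc.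
  have d0 : deg w s = 0 by lia.
  have ws y : w s y = 0 by move: d0; rewrite /deg (bigD1 y) //=; lia.
  have suA : supported w A.
    move=> u v uA; have [->|us] := altP (u =P s); first exact: ws.
    by apply: su; rewrite !inE negb_or us.
  have [|t lay] := IH w A cA sw suA.
    move=> X /properP[XA [y yA yX]] nX; apply: hc; apply/andP; split.
      by rewrite (setIidPr XA).
    by apply/set0Pn; exists y; rewrite inE yX.
  exists t; split=> //; rewrite d0 addn0 (eq_bigr (fun=> 1)).
    by rewrite sum1_card card_ord; lia.
  move=> i _; suff -> : deg (t i) s = 0 by [].
  by rewrite /deg big1 // => y _; have := layer_le i s y lay; rewrite ws; lia.
have [d0|dpos] := posnP (deg w s); first by apply: IHd => //; rewrite d0.
have nA x : 0 < w s x -> x \in A.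
  move=> wx; have : x \in s |: A by apply: contraLR wx => h; rewrite sw.1 su.
  by rewrite !inE; case/orP=> // /eqP e; rewrite e sw.2 in wx.
have lam2 : 1 < 2 * c by lia.
have [p [r [w' [sp hc']]]] := lovasz_split sw sA nA lam2 ev dpos hc.
have [sw' wp wr e] := sp; have pA := nA p wp; have rA := nA r wr.
have ps : (s == p) = false by apply: contraNF sA => /eqP->.
have rs : (s == r) = false by apply: contraNF sA => /eqP->.
have ds : deg w s = deg w' s + 2.
  by have := split_deg s sp; rewrite eqxx ps rs muln0; lia.
have [|||t' [lay' m']] := IHd w' _ cA sw' _ sA _ hc'.
- by lia.
- move=> u v; rewrite !inE negb_or => /andP[us uA].
  have := e u v; rewrite su ?inE ?negb_or ?us // /shortcut.
  have up : (u == p) = false by apply: contraNF uA => /eqP->.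
  have ur : (u == r) = false by apply: contraNF uA => /eqP->.
  by case: eqP => _; rewrite /edge1 /arc1 up ur (negPf us) /=; clear; lia.
- by move: ev; rewrite ds; lia.
have [t [lay m]] := unsplit sw sA pA rA nA sp lay'.
by exists t; split=> //; lia.
Qed.

(** An edge outside all tight cuts can be deleted. When there is none, a vertex of degree 2c exists;
    it is split off, the smaller vertex set is packed, and every layer is then attached to that
    vertex. *)
Theorem pack_layers w S : wsym w -> supported w S ->
  (forall X, X \proper S -> X != set0 -> 2 * c <= cut w X) -> exists t, layered w S t.
Proof.
move: {2}#|S| (leqnn #|S|) => n; elim: n w S => [|n IH] w S cS sw su hc.
  exists (fun _ _ _ => 0); split=> //; first by move=> x y; rewrite big1.
  move=> i X; move: cS; rewrite leqn0 cards_eq0 => /eqP ->.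
  by rewrite /separates set0I eqxx.
have [S1|S2] := leqP #|S| 1.
  exists (fun _ _ _ => 0); split=> //; first by move=> x y; rewrite big1.
  move=> i X /andP[/set0Pn[x /setIP[xS xX]] /set0Pn[y /setDP[yS yX]]].
  by move/card_le1_eqP: S1 => /(_ x y xS yS) e; rewrite e xX in yX.
move: {2}(\sum_u deg w u) (leqnn (\sum_u deg w u)) => N.
elim: N w sw su hc => [|N IHN] w sw su hc sN.
  have [a aS] : exists a, a \in S by apply/card_gt0P; lia.
  have : 2 * c <= cut w [set a].
    by apply: hc; rewrite ?properEcard ?sub1set ?aS ?cards1 // -card_gt0 cards1.
  rewrite cut1; last exact: sw.2.
  by move: sN; rewrite (bigD1 a) //=; move: c0; clear; lia.
have [/existsP[u /existsP[v /andP[wuv /forallP h]]]|] := boolP [exists u, exists v, (0 < w u v) &&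
   [forall X : {set T}, (X \proper S) && (X != set0) && (u \in X) && (v \notin X) ==> (2 * c < cut w X)]].
  have uv : u != v by apply: contraTneq wuv => ->; rewrite sw.2.
  pose w' a b := w a b - edge1 u v a b.
  have ew a b : w a b = w' a b + edge1 u v a b.
    rewrite /w' subnK // /edge1 /arc1.
    have [->|nau] := altP (a =P u).
      rewrite (negPf uv) /=.
      by have [->|_] := altP (b =P v); lia.
    have [->|nav] := altP (a =P v); rewrite /=; last lia.
    by have [->|nbu] := altP (b =P u); rewrite 1?sw.1; lia.
  have sw' : wsym w'.
    split=> [a b|a]; last by have := ew a a; rewrite sw.2; lia.
    by have := ew a b; have := ew b a; rewrite sw.1 edge1C; lia.
  have su' : supported w' S by move=> a b aS; have := ew a b; rewrite su //; lia.
  have ce X : cut w X = cut w' X + ((u \in X) (+) (v \in X)).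
    by rewrite (eq_cut X ew) (cutD w') cut_edge1.
  clearbody w'.
  have [||t [st le co]] := IHN w' sw' su'.
  - move=> X pX nX; have c1 := ce X; have c2 := hc X pX nX.
    have := h X; have := h (S :\: X); rewrite pX nX /= cut_suppC // !inE.
    have uS : u \in S by apply: contraLR wuv => /su ->.
    have vS : v \in S by apply: contraLR wuv => vS; rewrite sw.1 su.
    have [y yX] := set0Pn _ nX; have yS := subsetP (proper_sub pX) _ yX.
    have -> : S :\: X \proper S.
      by apply/properP; split; [exact: subsetDl | exists y; rewrite ?inE ?yX].
    have -> : S :\: X != set0.
      by have /properP[_ [z zS zX]] := pX; apply/set0Pn; exists z; rewrite inE zX.
    rewrite uS vS /=.
    by move: c1 c2; clear; case: (u \in X); case: (v \in X) => /=; lia.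
  - have d a : deg w a = deg w' a + ((a == u) + (a == v)).
      rewrite -deg_edge1 -(degD w'); exact: eq_deg (ew a).
    by move: sN; rewrite (eq_bigr _ (fun a _ => d a)) !big_split /= !sum_eqb; lia.
  by exists t; split=> // x y; apply: leq_trans (le x y) _; rewrite ew leq_addr.
rewrite negb_exists => /forallP h.
have [|s sS ds] := @tight_vertex w S sw su S2 hc.
  move=> u v wuv; have := h u; rewrite negb_exists => /forallP/(_ v).
  rewrite wuv /= negb_forall => /existsP[X]; rewrite negb_imply -leqNgt.
  by case/andP=> /andP[/andP[/andP[h1 h2] h3] h4] h5; exists X.
have sA : s \notin S :\ s by rewrite !inE eqxx.
have SE : s |: (S :\ s) = S by rewrite setD1K.
have [||||t [lay m]] := @pack_split n IH w (S :\ s) s _ sw _ sA.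
- by move: cS; rewrite (cardsD1 s) sS; lia.
- by rewrite SE.
- by rewrite ds; lia.
- move=> X /andP[/set0Pn[x /setIP[xA xX]] /set0Pn[y /setDP[yA yX]]].
  rewrite -(cut_supp X sw su); apply: hc.
    apply/properP; split; first exact: subsetIr.
    by exists y; [case/setD1P: yA | rewrite inE (negPf yX)].
  by apply/set0Pn; exists x; rewrite inE xX; case/setD1P: xA.
have st := let: And3 a _ _ := lay in a.
have [|t1 [[st1 le1 co1] dt]] := attach sA sw st lay; first by lia.
have su1 i : supported (t1 i) S.
  by move=> u v uS; have := @layer_le w (S :\ s) t1 i u v (And3 st1 le1 co1); rewrite su //; lia.
exists t1; split=> // i X /andP[/set0Pn[x /setIP[xA xX]] /set0Pn[y /setDP[yA yX]]].
have [sep|] := boolP (separates (S :\ s) X); first exact: co1.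
rewrite negb_and !negbK => /orP[/eqP e0|/eqP e0].
  have xs : x = s.
    by apply: contra_eq e0 => xs; apply/set0Pn; exists x; rewrite !inE xs xA.
  have -> : cut (t1 i) X = deg (t1 i) s; last exact: dt.
  rewrite -(cut_supp X (st1 i) (su1 i)) -(cut1 s (st1 i).2); congr cut.
  apply/setP => z; rewrite !inE; have [->|zs] := altP (z =P s); first by rewrite -xs xX xA.
  by move/setP: e0 => /(_ z); rewrite !inE zs andbC.
have ys : y = s.
  by apply: contra_eq e0 => ys; apply/set0Pn; exists y; rewrite !inE ys yA (negPf yX).
have -> : cut (t1 i) X = deg (t1 i) s; last exact: dt.
rewrite -(cut_suppC X (st1 i) (su1 i)) -(cut1 s (st1 i).2); congr cut.
apply/setP => z; rewrite !inE; have [->|zs] := altP (z =P s); first by rewrite -ys yX yA.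
by move/setP: e0 => /(_ z); rewrite !inE zs.
Qed.

End Packing.

(** * Rounding *)

Section Round.
Import Order.TTheory GRing.Theory Num.Theory.
Variables (I J : finType).
Implicit Types (x z : I * J -> rat) (p : I * J).

Definition frac x := [set p | (0 < x p < 1)%R].

Lemma natq_gap (r n : nat) (a : rat) : (0 < a < 1)%R -> (a + n%:R)%R <> r%:R%R.
Proof.
move=> /andP[a0 a1] e.
have h1 : (n%:R < r%:R :> rat)%R by rewrite -e; lra.
have h2 : (r%:R < n.+1%:R :> rat)%R by rewrite -e -natr1; lra.
by move: h1 h2; rewrite !ltr_nat; lia.
Qed.

Lemma lone_frac (L : finType) (a : L -> rat) (r : nat) (l : L) :
  (forall k, 0 <= a k <= 1)%R -> (\sum_k a k = r%:R)%R -> (0 < a l < 1)%R ->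
  exists2 k, k != l & (0 < a k < 1)%R.
Proof.
move=> a01 sr fl; apply/exists_inP; apply: contraT; rewrite negb_exists => /forallP h.
have : (\sum_k a k = a l + (\sum_(k | k != l) (a k == 1%R))%:R)%R.
  rewrite (bigD1 l) //=; congr (_ + _)%R; rewrite natr_sum; apply: eq_bigr => k kl.
  have := h k; have := a01 k; rewrite kl /= negb_and -!leNgt => /andP[k0 k1] /orP[k2|k2].
    have -> : a k = 0%R by lra.
    by rewrite eq_sym oner_eq0.
  have -> : a k = 1%R by lra.
  by rewrite eqxx.
by rewrite sr => e; case: (natq_gap fl (esym e)).
Qed.

(* The constraints on the fractional entries are dependent and each row or column
   meeting them has at least two, so they outnumber the independent constraints. *)
Lemma exists_shift x (p0 : I * J) : p0 \in frac x ->
  (forall p, p \in frac x -> exists2 j, j != p.2 & (p.1, j) \in frac x) ->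
  (forall p, p \in frac x -> exists2 i, i != p.1 & (i, p.2) \in frac x) ->
  exists z, [/\ exists p, z p != 0%R, forall p, p \notin frac x -> z p = 0%R,
    forall i, (\sum_j z (i, j) = 0)%R & forall j, (\sum_i z (i, j) = 0)%R].
Proof.
set F := frac x => p0F rowF colF.
pose Rw := [set p.1 | p in F]; pose Cl := [set p.2 | p in F].
have cR : (#|Rw|).*2 <= #|F|.
  rewrite -[#|F|]sum1_card (partition_big fst (mem Rw)) /=; last by move=> p pF; apply: imset_f.
  rewrite -muln2 -sum_nat_const; apply: leq_sum => i /imsetP[p pF ->].
  have [j jp jF] := rowF p pF.
  rewrite (bigD1 p) /= ?pF ?eqxx // (bigD1 (p.1, j)) /=; first by rewrite addnA leq_addr.
  by rewrite jF eqxx /= -pair_eqE /= eqxx.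
have cC : (#|Cl|).*2 <= #|F|.
  rewrite -[#|F|]sum1_card (partition_big snd (mem Cl)) /=; last by move=> p pF; apply: imset_f.
  rewrite -muln2 -sum_nat_const; apply: leq_sum => i /imsetP[p pF ->].
  have [j jp jF] := colF p pF.
  rewrite (bigD1 p) /= ?pF ?eqxx // (bigD1 (j, p.2)) /=; first by rewrite addnA leq_addr.
  by rewrite jF eqxx /= -pair_eqE /= eqxx andbT.
(* The row sums and the column sums have the same total, so one row equation follows from the
   others; without it the equations are fewer than the entries of F. *)
pose R' := Rw :\ p0.1.
have p0R : p0.1 \in Rw by apply: imset_f.
have cR' : #|Rw| = #|R'|.+1 by rewrite (cardsD1 p0.1) p0R.
pose M : 'M[rat]_(#|F|, #|R'| + #|Cl|) :=
  row_mx (\matrix_(a, b) ((enum_val a).1 == enum_val b)%:R)%R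
         (\matrix_(a, b) ((enum_val a).2 == enum_val b)%:R)%R.
have : kermx M != 0%R.
  rewrite kermx_eq0 /row_free; apply/eqP => e.
  by have := rank_leq_col M; rewrite e; lia.
case/rowV0Pn => v /sub_kermxP vM v0.
pose z p : rat := if p \in F then v ord0 (enum_rank_in p0F p) else 0%R.
have zF p : p \notin F -> z p = 0%R by rewrite /z => /negPf ->.
have zE a : z (enum_val a) = v ord0 a by rewrite /z enum_valP enum_valK_in.
have sumz (P : pred (I * J)) : (\sum_(p | P p) z p = \sum_a v ord0 a * (P (enum_val a))%:R)%R.
  rewrite (bigID (mem F)) /= [X in (_ + X)%R]big1 ?addr0; last by move=> p /andP[_ /zF].
  rewrite big_andbC big_mkcondr /= (big_enum_val (fun p => if P p then z p else 0%R)).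
  apply: eq_bigr => a _; rewrite zE; by case: (P _); rewrite ?mulr1 ?mulr0.
have vM1 (b : 'I_#|R'|) : (\sum_(p | p.1 == enum_val b) z p = 0)%R.
  rewrite sumz; move/matrixP/(_ ord0 (lshift _ b)): vM; rewrite !mxE => vM.
  by rewrite -[RHS]vM; apply: eq_bigr => a _; rewrite row_mxEl mxE.
have vM2 (b : 'I_#|Cl|) : (\sum_(p | p.2 == enum_val b) z p = 0)%R.
  rewrite sumz; move/matrixP/(_ ord0 (rshift _ b)): vM; rewrite !mxE => vM.
  by rewrite -[RHS]vM; apply: eq_bigr => a _; rewrite row_mxEr mxE.
have rowE i : (\sum_j z (i, j) = \sum_(p | p.1 == i) z p)%R.
  transitivity (\sum_(i' | i' == i) \sum_j z (i', j))%R; first by rewrite big_pred1_eq.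
  by rewrite pair_big_dep /=; apply: eq_big => [[a b]|[a b] _] //=; rewrite andbT.
have colE j : (\sum_i z (i, j) = \sum_(p | p.2 == j) z p)%R.
  transitivity (\sum_i \sum_(j' | j' == j) z (i, j'))%R.
    by apply: eq_bigr => i _; rewrite big_pred1_eq.
  by rewrite pair_big_dep /=; apply: eq_big => [[a b]|[a b] _].
have col0 j : (\sum_i z (i, j) = 0)%R.
  have [jC|jC] := boolP (j \in Cl).
    by rewrite colE -(enum_rankK_in jC jC) vM2.
  rewrite big1 // => i _; apply: zF; apply: contra jC => h.
  by apply/imsetP; exists (i, j).
have row0 i : i \in R' -> (\sum_j z (i, j) = 0)%R.
  by move=> iR; rewrite rowE -(enum_rankK_in iR iR) vM1.
have rowN i : i \notin Rw -> (\sum_j z (i, j) = 0)%R.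
  move=> iR; rewrite big1 // => j _; apply: zF; apply: contra iR => h.
  by apply/imsetP; exists (i, j).
exists z; split=> //.
  have [a va] : exists a, v ord0 a != 0%R.
    apply/existsP; apply: contraNT v0; rewrite negb_exists => /forallP h.
    apply/eqP/rowP => a; rewrite mxE; apply/eqP.
    by have := h a; rewrite negbK.
  by exists (enum_val a); rewrite zE.
move=> i; have [iR|iR] := boolP (i \in Rw); last exact: rowN.
have [ei|ni] := altP (i =P p0.1); last by apply: row0; rewrite !inE ni.
have : (\sum_i \sum_j z (i, j) = 0)%R.
  by rewrite exchange_big big1 // => j _; apply: col0.
rewrite (bigD1 i) //= [X in (_ + X)%R]big1 ?addr0 // => k ki.
have [kR|] := boolP (k \in Rw); last exact: rowN.
by apply: row0; rewrite !inE -ei ki.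
Qed.

(** A shift with zero row and column sums is followed until some entry becomes 0 or 1, which lowers
    the number of fractional entries. *)
Lemma round_rat x (r : I -> nat) (c : J -> nat) : (forall p, 0 <= x p <= 1)%R ->
  (forall i, \sum_j x (i, j) = (r i)%:R)%R -> (forall j, \sum_i x (i, j) = (c j)%:R)%R ->
  exists y : pred (I * J), [/\ forall p, y p -> (0 < x p)%R,
    forall i, \sum_j (y (i, j) : nat) = r i & forall j, \sum_i (y (i, j) : nat) = c j].
Proof.
move: {2}#|frac x| (leqnn #|frac x|) => n; elim: n x => [|n IH] x cn x01 xr xc.
  exists (fun p => x p == 1%R).
  have x1 p : x p = (x p == 1%R)%:R%R.
    have : p \notin frac x by move: cn; rewrite leqn0 cards_eq0 => /eqP->; rewrite inE.
    rewrite inE negb_and -!leNgt; have /andP[h1 h2] := x01 p; case/orP=> h3.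
      have -> : x p = 0%R by lra.
      by rewrite eq_sym oner_eq0.
    have -> : x p = 1%R by lra.
    by rewrite eqxx.
  split=> [p /eqP->|i|j] //; apply/eqP; rewrite -(eqr_nat rat) natr_sum.
    by rewrite -xr; apply/eqP/eq_bigr => j _; rewrite -x1.
  by rewrite -xc; apply/eqP/eq_bigr => i _; rewrite -x1.
have [f0|/set0Pn[p0 p0F]] := eqVneq (frac x) set0.
  by apply: IH => //; rewrite f0 cards0.
have [||z [[q zq] zF zr zc]] := exists_shift p0F.
- move=> [i j]; rewrite inE /= => h.
  have [k kj kf] := @lone_frac _ (fun j => x (i, j)) (r i) j (fun j => x01 (i, j)) (xr i) h.
  by exists k; rewrite ?inE.
- move=> [i j]; rewrite inE /= => h.
  have [k kj kf] := @lone_frac _ (fun i => x (i, j)) (c j) i (fun i => x01 (i, j)) (xc j) h.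
  by exists k; rewrite ?inE.
(* The distance that entry p can travel along z before it reaches 1 or 0; the shortest one is
   used. *)
pose st p : rat := (if (0 < z p)%R then (1 - x p) / z p else x p / - z p)%R.
have fz p : z p != 0%R -> (0 < x p < 1)%R.
  by apply: contraNT => h; rewrite zF // inE.
pose m := [arg min_(p < q | z p != 0%R) st p]%O.
have [zm stm] : z m != 0%R /\ forall p, z p != 0%R -> (st m <= st p)%R.
  by rewrite /m; case: arg_minP.
have st0 p : z p != 0%R -> (0 < st p)%R.
  move=> zp; have /andP[h1 h2] := fz p zp; rewrite /st; case: ifPn => h.
    by rewrite divr_gt0 // subr_gt0.
  by rewrite divr_gt0 // oppr_gt0 lt_neqAle zp leNgt.
pose x' p := (x p + st m * z p)%R.
have b p : (0 <= x' p <= 1)%R.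
  have [z0|zp] := eqVneq (z p) 0%R; first by rewrite /x' z0 mulr0 addr0.
  have /andP[h1 h2] := fz p zp; have h3 := stm p zp; have h4 := st0 m zm.
  move: h3; rewrite /x' /st -/(st m); case: (ltrgtP 0%R (z p)) => [zp0|zp0|e].
  - rewrite ler_pdivlMr // => h5; have := mulr_ge0 (ltW h4) (ltW zp0); lra.
  - rewrite ler_pdivlMr ?oppr_gt0 // => h5.
    have : (0 <= st m * - z p)%R by rewrite mulr_ge0 ?ltW // oppr_gt0.
    by move: h5; rewrite mulrN; lra.
  by rewrite -e eqxx in zp.
have [|||y [y1 y2 y3]] := IH x' _ b.
- have : frac x' \subset frac x :\ m.
    apply/subsetP => p; rewrite !inE => h.
    have [z0|zp] := eqVneq (z p) 0%R.
      rewrite /x' z0 mulr0 addr0 in h; rewrite h andbT.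
      by apply: contraNneq zm => <-; rewrite z0.
    rewrite (fz p zp) andbT; apply: contraTneq h => ->.
    have : x' m = 0%R \/ x' m = 1%R.
      rewrite /x' {1 2}/st; case: ifPn => h.
        by right; rewrite divfK //; lra.
      by left; rewrite invrN mulrN mulNr divfK //; lra.
    by case=> ->; rewrite ltxx ?andbF.
  move/subset_leq_card => h; have : m \in frac x by rewrite inE fz.
  by move: h cn; rewrite (cardsD1 m (frac x)) => h1 h2 h3; move: h1 h2; rewrite h3; lia.
- by move=> i; rewrite big_split /= xr -mulr_sumr zr mulr0 addr0.
- by move=> j; rewrite big_split /= xc -mulr_sumr zc mulr0 addr0.
exists y; split=> // p /y1; have [z0|zp] := eqVneq (z p) 0%R.
  by rewrite /x' z0 mulr0 addr0.
by move=> _; have /andP[] := fz p zp.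
Qed.

Lemma round_exact N (x : I -> J -> nat) (r : I -> nat) (c : J -> nat) : 0 < N ->
  (forall i j, x i j <= N) -> (forall i, \sum_j x i j = N * r i) ->
  (forall j, \sum_i x i j = N * c j) ->
  exists y : I -> J -> bool, [/\ forall i j, y i j -> 0 < x i j,
    forall i, \sum_j (y i j : nat) = r i & forall j, \sum_i (y i j : nat) = c j].
Proof.
move=> N0 xN xr xc; pose xq (p : I * J) : rat := ((x p.1 p.2)%:R / N%:R)%R.
have Nq : (0 < N%:R :> rat)%R by rewrite ltr0n.
have [|i|j|y [y1 y2 y3]] := @round_rat xq r c.
- move=> p; rewrite divr_ge0 ?ler0n //= ler_pdivrMr // mul1r ler_nat; exact: xN.
- rewrite -mulr_suml -natr_sum xr natrM mulrAC divff ?mul1r //; lra.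
- rewrite -mulr_suml -natr_sum xc natrM mulrAC divff ?mul1r //; lra.
exists (fun i j => y (i, j)); split=> // i j /y1.
by rewrite pmulr_lgt0 ?invr_gt0 // ltr0n.
Qed.

End Round.

(* A dummy row and column absorb the residues of the sums. *)
Lemma round_near (I J : finType) N (x : I -> J -> nat) : 0 < N ->
  (forall i j, x i j <= N) ->
  exists y : I -> J -> bool, [/\ forall i j, y i j -> 0 < x i j,
    forall i, N * \sum_j (y i j : nat) < \sum_j x i j + N,
    forall i, \sum_j x i j < N * \sum_j (y i j : nat) + N,
    forall j, N * \sum_i (y i j : nat) < \sum_i x i j + N &
    forall j, \sum_i x i j < N * \sum_i (y i j : nat) + N].
Proof.
move=> N0 xN.
(* [cp a] completes a to a multiple of N and is 0, not N, when a already is one; [up a] is the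
   resulting quotient. *)
pose cp a := (N - a %% N) %% N; pose up a := (a + cp a) %/ N.
have cpN a : cp a < N by rewrite ltn_mod.
have cpE a : a + cp a = N * up a.
  rewrite /up mulnC divnK // /dvdn modnDmr -modnDml subnKC ?modnn //.
  exact/ltnW/ltn_pmod.
pose R i := \sum_j x i j; pose C j := \sum_i x i j.
pose D := \sum_j cp (C j).
pose x' (i : option I) (j : option J) := match i, j with
  | Some i, Some j => x i j | Some i, None => cp (R i)
  | None, Some j => cp (C j) | None, None => cp D end.
have rowS i : \sum_j x' (Some i) j = N * up (R i) by rewrite big_optionE /= addnC cpE.
have row0 : \sum_j x' None j = N * up D by rewrite big_optionE /= addnC cpE.
have colS j : \sum_i x' i (Some j) = N * up (C j) by rewrite big_optionE /= addnC cpE.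
have col0 : \sum_i x' i None = N * ((\sum_i x' i None) %/ N).
  rewrite mulnC divnK //.
  have : N %| \sum_j \sum_i x' i j.
    by rewrite exchange_big big_optionE row0 /= dvdn_add ?dvdn_mulr // dvdn_sum // => i _; rewrite rowS dvdn_mulr.
  rewrite big_optionE /= dvdn_addl // dvdn_sum // => j _; by rewrite colS dvdn_mulr.
have [|||y [y1 y2 y3]] := @round_exact _ _ N x'
  (fun i => if i is Some i then up (R i) else up D)
  (fun j => if j is Some j then up (C j) else ((\sum_i x' i None) %/ N)) N0.
- by move=> [i|] [j|] //=; apply: ltnW.
- by move=> [i|].
- by move=> [j|].
(* The dummy entry is chosen only where [cp a] is positive, which makes both error bounds strict. *)
have key a n (b : bool) : b + n = up a -> (b -> 0 < cp a) -> N * n < a + N /\ a < N * n + N.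
  by move=> e; have := cpE a; have := cpN a; rewrite -e mulnDr; case: b {e} => /= h1 h2 h3;
     [have := h3 isT | clear h3]; move: h1 h2 N0; clear; lia.
have keyR i : N * \sum_j (y (Some i) (Some j) : nat) < R i + N /\ R i < N * \sum_j (y (Some i) (Some j) : nat) + N.
  by apply: (key _ _ (y (Some i) None)); [rewrite -(y2 (Some i)) big_optionE | apply: y1].
have keyC j : N * \sum_i (y (Some i) (Some j) : nat) < C j + N /\ C j < N * \sum_i (y (Some i) (Some j) : nat) + N.
  by apply: (key _ _ (y None (Some j))); [rewrite -(y3 (Some j)) big_optionE | apply: y1].
exists (fun i j => y (Some i) (Some j)); split=> [i j /y1|i|i|j|j] //.
- by case: (keyR i).
- by case: (keyR i).
- by case: (keyC j).
by case: (keyC j).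
Qed.

(** * Bistars *)

Lemma edgesP (T : finType) (g : rel T) (e : {set T}) :
  reflect (exists u v, g u v /\ e = [set u; v]) (e \in edges g).
Proof.
apply: (iffP imsetP) => [[[u v]]|[u [v [guv ->]]]]; rewrite ?inE /=.
  by move=> guv ->; exists u, v.
by exists (u, v); rewrite ?inE.
Qed.

Lemma set2_eq (T : finType) (a b u v : T) : [set a; b] = [set u; v] ->
  (a = u /\ b = v) \/ (a = v /\ b = u).
Proof.
move=> e; have ha : a \in [set u; v] by rewrite -e set21.
have hb : b \in [set u; v] by rewrite -e set22.
have hu : u \in [set a; b] by rewrite e set21.
have hv : v \in [set a; b] by rewrite e set22.
move: ha hb hu hv; rewrite !inE; do 4!(case/orP=> /eqP ?).
all: by [left; split; congruence | right; split; congruence].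
Qed.

Lemma mem_edges (T : finType) (g : rel T) u v : symmetric g -> ([set u; v] \in edges g) = g u v.
Proof.
move=> sg; apply/edgesP/idP => [[a [b [gab /set2_eq[[-> ->]|[-> ->]]]]]|guv] //.
  by rewrite sg.
by exists u, v.
Qed.

Lemma subset_of_card (T : finType) (A : {set T}) n : n <= #|A| ->
  exists2 X : {set T}, X \subset A & #|X| = n.
Proof.
move=> nA; exists [set x in take n (enum A)].
  by apply/subsetP => x; rewrite inE => /mem_take; rewrite mem_enum.
rewrite cardsE; move/card_uniqP: (take_uniq n (enum_uniq A)) => ->.
by rewrite size_take -cardE; case: ltngtP nA.
Qed.

Lemma disjointI (T : finType) (A B : {set T}) : (forall x, x \in A -> x \notin B) -> [disjoint A & B].
Proof.
by move=> h; apply/pred0P => y /=; apply/negP => /andP[/h/negPf ->].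
Qed.

Lemma setD_chain (T : finType) (A B E : {set T}) : B \subset E -> A \subset E :\: B ->
  E :\: A = B :|: ((E :\: B) :\: A).
Proof.
move=> /subsetP BE /subsetP AE; apply/setP => x; move: (BE x) (AE x); rewrite !inE.
case: (x \in A) (x \in B) (x \in E) => [] [] [] //= h1 h2; by [have := h1 isT | have := h2 isT].
Qed.

Section Decomp.
Variables (k l : nat) (T : finType).
Hypotheses (k1 : 1 < k) (kl : k <= l).

Definition star_pair (u v : T) (X Y : {set T}) : {set {set T}} :=
  [set u; v] |: ([set [set u; x] | x in X] :|: [set [set v; y] | y in Y]).

Lemma bistar_build (u v : T) (X Y : {set T}) : u != v -> #|X| = k - 1 -> #|Y| = l - 1 ->
  u \notin X :|: Y -> v \notin X :|: Y -> [disjoint X & Y] -> bistar_copy k l (star_pair u v X Y).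
Proof.
move=> uv cX cY uXY vXY XY.
pose s := [:: u, v & enum X ++ enum Y].
have szX : size (enum X) = k - 1 by rewrite -cardE.
have szY : size (enum Y) = l - 1 by rewrite -cardE.
have szs : size s = k + l by rewrite /= size_cat szX szY; lia.
have us : uniq s.
  rewrite /= cat_uniq !enum_uniq /= andbT inE !mem_cat !mem_enum (negPf uv) /=.
  move: uXY vXY; rewrite !inE => -> -> /=.
  apply/hasPn => y; rewrite !mem_enum => yY; apply/negP => yX.
  by move/pred0P: XY => /(_ y); rewrite /= yX yY.
have nX (j : nat) : 2 <= j <= k -> nth u s j \in X.
  case: j => [|[|j]] //= hj; rewrite nth_cat szX ifT; last by lia.
  by rewrite -mem_enum mem_nth // szX; lia.
have nY (j : nat) : k < j < k + l -> nth u s j \in Y.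
  case: j => [|[|j]] hj; [by lia | by lia |]; rewrite /= nth_cat szX ltnNge (_ : k - 1 <= j) /=; last by lia.
  by rewrite -mem_enum mem_nth // szY; lia.
exists (fun i : 'I_(k + l) => nth u s i); split.
  move=> i j /eqP; rewrite nth_uniq ?szs ?ltn_ord // => /eqP; exact: val_inj.
have o0 : 0 < k + l by lia.
have o1 : 1 < k + l by lia.
apply/setP => e; apply/idP/imsetP.
  rewrite !inE => /orP[/eqP->|/orP[/imsetP[x xX ->]|/imsetP[y yY ->]]].
  - by exists (Ordinal o0, Ordinal o1); rewrite ?inE.
  - have ix : (index x (enum X)) < k - 1 by rewrite -szX index_mem mem_enum.
    have oj : (index x (enum X)).+2 < k + l by lia.
    exists (Ordinal o0, Ordinal oj).
      by rewrite inE /bistar_rel /bistar_arc /=; apply/orP; left; lia.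
    by rewrite /= nth_cat szX ix nth_index ?mem_enum.
  have iy : (index y (enum Y)) < l - 1 by rewrite -szY index_mem mem_enum.
  have oj : (index y (enum Y) + (k - 1)).+2 < k + l by lia.
  exists (Ordinal o1, Ordinal oj).
    by rewrite inE /bistar_rel /bistar_arc /=; apply/orP; left; lia.
  by rewrite /= nth_cat szX ltnNge leq_addl /= addnK nth_index ?mem_enum.
have main (i j : 'I_(k + l)) : bistar_arc k l i j -> [set nth u s i; nth u s j] \in star_pair u v X Y.
  rewrite !inE => /or3P[/andP[/eqP-> /eqP->]|/andP[/eqP-> h]|/andP[/eqP-> h]].
  - by rewrite eqxx.
  - apply/orP; right; apply/orP; left; apply/imsetP; exists (nth u s j) => //; exact: nX.
  by apply/orP; right; apply/orP; right; apply/imsetP; exists (nth u s j) => //; exact: nY.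
case=> -[i j]; rewrite inE /= => /orP[] h ->; first exact: main.
by rewrite setUC; apply: main.
Qed.

Lemma bistar_copy_neq0 (H : {set {set T}}) : bistar_copy k l H -> H != set0.
Proof.
have o0 : 0 < k + l by lia.
have o1 : 1 < k + l by lia.
move=> [f [_ ->]]; apply/set0Pn; exists [set f (Ordinal o0); f (Ordinal o1)].
by apply/imsetP; exists (Ordinal o0, Ordinal o1); rewrite ?inE.
Qed.

Definition decomposable (E : {set {set T}}) :=
  exists P, partition P E /\ forall H, H \in P -> bistar_copy k l H.

Lemma decomposable_family (I : finType) (D : {set I}) (F : I -> {set {set T}}) :
  (forall i, i \in D -> bistar_copy k l (F i)) ->
  {in D &, forall i j, j != i -> [disjoint F i & F j]} ->
  decomposable (\bigcup_(i in D) F i).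
Proof.
move=> hb hd; exists (F @: D); split; last by move=> H /imsetP[i iD ->]; apply: hb.
have n0 : set0 \notin F @: D.
  by apply/imsetP => -[i /hb/bistar_copy_neq0 h e]; rewrite e eqxx in h.
by have [h1 _] := trivIimset hd n0; rewrite /partition cover_imset eqxx h1 n0.
Qed.

Lemma decomposableU (E F : {set {set T}}) : [disjoint E & F] -> decomposable E -> decomposable F ->
  decomposable (E :|: F).
Proof.
move=> EF [P [/and3P[/eqP cP tP nP] hP]] [Q [/and3P[/eqP cQ tQ nQ] hQ]].
exists (P :|: Q); split; last by move=> H /setUP[/hP|/hQ].
apply/and3P; split.
- by rewrite /cover bigcup_setU -/(cover P) -/(cover Q) cP cQ.
- by apply: trivIsetU; rewrite ?cP ?cQ.
by rewrite inE negb_or nP nQ.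
Qed.

Lemma decomposable0 : decomposable set0.
Proof.
exists set0; split; last by move=> H; rewrite inE.
by apply/and3P; rewrite /cover big_set0 inE; split=> //; apply/trivIsetP => A B; rewrite inE.
Qed.

(** An edge uv whose ends both have degree at least m is the centre of a bistar: after k-1 leaves at
    u are chosen, v still has m - 1 - (k - 1) = l - 1 neighbours that avoid u and these leaves. *)
Lemma greedy_bistars (h : rel T) : symmetric h -> irreflexive h ->
  exists h' : rel T, [/\ symmetric h', subrel h' h, decomposable (edges h :\: edges h') &
    forall u v, h' u v -> (#|[set x | h' u x]| < k + l - 1) || (#|[set x | h' v x]| < k + l - 1)].
Proof.
move: {2}#|edges h| (leqnn #|edges h|) => n; elim: n h => [|n IH] h ch sh ih.
  exists h; split=> //; first by rewrite setDv; apply: decomposable0.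
  move=> u v huv; move: ch; rewrite leqn0 cards_eq0 => /eqP/setP/(_ [set u; v]).
  by rewrite mem_edges // huv inE.
have [/existsP[u /existsP[v /and3P[huv du dv]]]|] := boolP [exists u, exists v,
   [&& h u v, k + l - 1 <= #|[set x | h u x]| & k + l - 1 <= #|[set x | h v x]|]]; last first.
  rewrite negb_exists => /forallP nb; exists h; split=> //.
    by rewrite setDv; apply: decomposable0.
  move=> u v huv; have := nb u; rewrite negb_exists => /forallP/(_ v).
  by rewrite huv /= negb_and -!ltnNge.
have uv : u != v by apply: contraTneq huv => ->; rewrite ih.
have [X /subsetP XN cX] : exists2 X : {set T}, X \subset [set x | h u x] :\ v & #|X| = k - 1.
  by apply: subset_of_card; move: du; rewrite (cardsD1 v) inE huv; lia.
have [Y /subsetP YN cY] : exists2 Y : {set T}, Y \subset ([set x | h v x] :\ u) :\: X & #|Y| = l - 1.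
  apply: subset_of_card; have := cardsD ([set x | h v x] :\ u) X.
  have := subset_leq_card (subsetIr ([set x | h v x] :\ u) X).
  by move: dv; rewrite (cardsD1 u [set x | h v x]) inE sh huv cX; lia.
have XP x : x \in X -> h u x /\ x != v by move/XN; rewrite !inE => /andP[].
have YP y : y \in Y -> [/\ h v y, y != u & y \notin X] by move/YN; rewrite !inE => /and3P[].
set B := star_pair u v X Y.
have bB : bistar_copy k l B.
  apply: bistar_build => //.
  - by rewrite inE negb_or; apply/andP; split; apply/negP;
      [move/XP=> [] | move/YP=> [_]]; rewrite ?ih ?eqxx.
  - by rewrite inE negb_or; apply/andP; split; apply/negP;
      [move/XP=> [_] | move/YP=> []]; rewrite ?ih ?eqxx.
  by rewrite disjoint_sym; apply: disjointI => y /YP[_ _ /negPf ->].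
have BE : B \subset edges h.
  apply/subsetP => e; rewrite !inE => /orP[/eqP->|/orP[/imsetP[x /XP[hx _] ->]|/imsetP[y /YP[hy _ _] ->]]];
  by rewrite mem_edges.
pose h1 x y := h x y && ([set x; y] \notin B).
have sh1 : symmetric h1 by move=> x y; rewrite /h1 sh setUC.
have e1 : edges h1 = edges h :\: B.
  apply/setP => e; rewrite inE; apply/edgesP/andP.
    by move=> [x [y [/andP[hxy nB] ->]]]; rewrite nB mem_edges.
  by move=> [nB /edgesP[x [y [hxy ee]]]]; exists x, y; rewrite /h1 hxy -ee.
have [||h' [sh' sub dec low]] := IH h1 _ sh1.
- rewrite e1; have := cardsD (edges h) B; rewrite (setIidPr BE).
  have := bistar_copy_neq0 bB; rewrite -card_gt0 => b0.
  have := subset_leq_card BE; lia.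
- by move=> x; rewrite /h1 ih.
exists h'; split=> //; first by move=> x y /sub /andP[].
have h'1 : edges h' \subset edges h1.
  by apply/subsetP => e /edgesP[x [y [/sub hxy ->]]]; rewrite mem_edges.
rewrite (setD_chain BE) -?e1 //.
apply: decomposableU => //.
  by apply: disjointI => e eB; rewrite e1 !in_setD eB andbF.
have -> : B = \bigcup_(i in [set tt]) B by rewrite big_set1.
by apply: decomposable_family => // -[] [] _ _.
Qed.

End Decomp.

(** * The bipartite case *)

Lemma sum_pred_card (T : finType) (P : pred T) : \sum_x (P x : nat) = #|[set x | P x]|.
Proof.
by rewrite -sum1_card [RHS]big_mkcond /=; apply: eq_bigr => x _; rewrite inE; case: (P x).
Qed.

Lemma sum_Posz (I : finType) (P : pred I) (F : I -> nat) :
  (\sum_(i | P i) Posz (F i))%R = Posz (\sum_(i | P i) F i).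
Proof. by rewrite (big_morph Posz PoszD (erefl _)). Qed.

Section Frac.
Variables (T : finType) (k l : nat) (A : {set T}) (G F : rel T) (inn q : T -> nat).
Hypotheses (k1 : 1 < k) (kl : k <= l).
Let m := k + l - 1.
Hypotheses (T1 : 1 < #|T|) (GA : forall a b, G a b -> (a \in A) && (b \notin A)).
Hypotheses (FG : subrel F G) (innA : forall a, a \in A -> inn a = 0) (inn_le : forall b, inn b <= m - 1).
Hypothesis dq : forall b, b \notin A -> \sum_a (G a b : nat) + inn b = m * q b.
Hypothesis conn : forall X, separates [set: T] X -> 6 * m ^ 2 <= cut (fun x y => F x y + F y x) X.

Lemma conn_deg v : 6 * m ^ 2 <= \sum_y (F v y : nat) + \sum_y (F y v : nat).
Proof.
have F0 x : F x x = false.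
  by apply/negP => /FG/GA/andP[xA]; rewrite xA.
rewrite -big_split /= -/(deg (fun x y => F x y + F y x) v) -cut1; last by move=> z; rewrite F0.
apply: conn; rewrite /separates setTI setTD -cards_eq0 cards1 /= -cards_eq0.
by have := cardsC1 v; lia.
Qed.

Lemma sumF0 b : b \in A -> \sum_a (F a b : nat) = 0.
Proof.
by move=> bA; rewrite big1 // => a _; case E : (F a b) => //; have := GA (FG E); rewrite bA andbF.
Qed.

Lemma sumF0l a : a \notin A -> \sum_b (F a b : nat) = 0.
Proof.
by move=> /negPf aA; rewrite big1 // => b _; case E : (F a b) => //; have := GA (FG E); rewrite aA.
Qed.

Lemma conn_in b : b \notin A -> 6 * m ^ 2 <= \sum_a (F a b : nat).
Proof. by move=> bA; have := conn_deg b; rewrite sumF0l. Qed.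

Lemma conn_out a : a \in A -> 6 * m ^ 2 <= \sum_b (F a b : nat).
Proof. by move=> aA; have := conn_deg a; rewrite sumF0 // addn0. Qed.

(* Starting weights: 2k on every edge, plus one on a set of 2k * inn b edges at each b, so that the
   column sums are already those of 2m * H. *)
Lemma exists_base : exists y0 : T -> T -> nat, [/\ forall a b, 2 * k * G a b <= y0 a b <= (2 * k).+1 * G a b,
  forall b, b \notin A -> \sum_a y0 a b = 2 * k * m * q b & forall b, b \in A -> forall a, y0 a b = 0].
Proof.
have /fin_all_exists2[S SG cS] (b : T) : exists2 S : {set T}, S \subset [set a | G a b] & #|S| = 2 * k * inn b.
  have [bA|bA] := boolP (b \in A); first by exists set0; rewrite ?sub0set // cards0 innA ?muln0.
  apply: subset_of_card; rewrite -sum_pred_card.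
  have h1 : \sum_a (F a b : nat) <= \sum_a (G a b : nat).
    by apply: leq_sum => a _; case E: (F a b) => //; rewrite FG.
  have h2 := conn_in bA; have h3 := inn_le b.
  apply: leq_trans (leq_trans h2 h1); apply: (@leq_trans (2 * m * m)); last by rewrite -mulnn; clear; nia.
  by apply: leq_mul; [rewrite leq_mul2l | ]; move: h3 k1 kl; rewrite /m; clear; lia.
exists (fun a b => 2 * k * G a b + (a \in S b)); split=> [a b|b bA|b bA a].
- rewrite leq_addr /= mulSn addnC leq_add2r.
  by case E : (a \in S b) => //; move/subsetP: (SG b) => /(_ a E); rewrite inE => ->.
- have -> : 2 * k * m * q b = 2 * k * (m * q b) by rewrite !mulnA.
  rewrite big_split /= -big_distrr /= -(dq bA) mulnDr; congr (_ + _).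
  rewrite -cS -sum1_card [RHS]big_mkcond /=; apply: eq_bigr => a _; by case: (a \in S b).
have -> : G a b = false by apply/negP => /GA; rewrite bA andbF.
by have := cS b; rewrite innA // muln0 => /eqP; rewrite cards_eq0 => /eqP->; rewrite inE; lia.
Qed.

(* Doubling F and orienting it changes the weight of each edge of F by -1, 0 or 1; this corrects
   the row sums modulo 2mk and preserves the column sums. *)
Lemma exists_H : exists (H : rel T) (p : T -> nat), [/\ subrel H G,
  forall a, \sum_b (H a b : nat) = k * p a,
  forall b, b \notin A -> \sum_a (H a b : nat) = k * q b & forall a, a \in A -> 4 * m <= p a].
Proof.
have [y0 [hy0 sy0 y00]] := exists_base.
pose w x y := 2 * (F x y + F y x).
have m0 : 0 < m by rewrite /m; lia.
have K0 : 0 < 2 * m * k by rewrite !muln_gt0 m0; lia.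
have Fx x : F x x = false by apply/negP => /FG/GA/andP[xA]; rewrite xA.
have sw : wsym w by split=> [x y|x]; rewrite /w ?Fx // addnC.
have degA a : a \in A -> deg w a = 2 * \sum_b (F a b : nat).
  by move=> aA; rewrite /deg -big_distrr /= big_split /= sumF0 // addn0.
have degB b : b \notin A -> deg w b = 2 * \sum_a (F a b : nat).
  by move=> bA; rewrite /deg -big_distrr /= big_split /= sumF0l.
(* In a row, the sum of [o a b - F a b] is half the net degree of a, since the out- and in-arcs add
   up to twice the F-degree. A net degree congruent to [tau a] modulo 4mk thus makes the corrected
   row sum a multiple of 2mk; the doubling of F also settles the parity conditions. *)
pose tau a : int := (- Posz (2 * \sum_b y0 a b))%R.
have [| | | | |o [ow o0 oa]] := @balanced_orient T (2 * m * k) K0 w A tau sw.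
- move=> b x bA; rewrite /w; have [//|xA] := boolP (x \in A).
  case E : (F b x); first by have := GA (FG E); rewrite (negPf bA).
  by case E' : (F x b) => //; have := GA (FG E'); rewrite (negPf xA).
- by move=> b bA; rewrite degB // oddM.
- move=> X /andP[h1 h2].
  have sX : separates [set: T] X.
    rewrite /separates setTI setTD; apply/andP; split; apply: contraNneq h1.
      by move=> ->; rewrite setI0.
    by move=> e; move: h2; rewrite setDE e setI0 eqxx.
  have -> : cut w X = 2 * cut (fun x y => F x y + F y x) X.
    by rewrite /cut big_distrr /=; apply: eq_bigr => x _; rewrite big_distrr /=; apply: eq_bigr => y _; rewrite mulnA.
  apply: leq_trans (_ : 2 * (6 * m ^ 2) <= _); last by rewrite leq_mul2l conn.
  (* What is needed is 18k <= 12m, that is k <= 2l - 2, which follows from k <= l and l >= 2. *)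
  rewrite -mulnn; have -> : 9 * (2 * m * k) = m * (18 * k) by clear; lia.
  have -> : 2 * (6 * (m * m)) = m * (12 * m) by clear; lia.
  by rewrite leq_mul2l; apply/orP; right; move: k1 kl; rewrite /m; clear; lia.
- by move=> a aA; rewrite degA // /tau abszN /= !oddM.
- exists (- Posz (\sum_(b | b \notin A) q b))%R.
  rewrite /tau GRing.sumrN sum_Posz -big_distrr /= exchange_big /=.
  have -> : \sum_b \sum_(a in A) y0 a b = 2 * m * k * \sum_(b | b \notin A) q b.
    rewrite [in RHS]big_mkcond big_distrr /=; apply: eq_bigr => b _.
    case: ifP => [bA|/negbFE bA]; last by rewrite big1 ?muln0 // => a _; rewrite y00.
    rewrite [2 * m * k]mulnAC -sy0 // [RHS](bigID (fun a => a \in A)) /= [X in _ + X]big1 ?addn0 //.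
    move=> a aA; have := hy0 a b; case E : (G a b); last by lia.
    by have := GA E; rewrite (negPf aA).
  by rewrite GRing.mulNr -PoszM [in RHS]mulnC GRing.add0r !mulnA.
have sumo v : \sum_x o v x + \sum_x o x v = deg w v.
  by rewrite -big_split /=; apply: eq_bigr => x _; rewrite ow.
pose y a b := if a \in A then y0 a b + o a b - F a b else 0.
have FA a b : a \in A -> F b a = false.
  by move=> aA; apply/negP => /FG/GA; rewrite aA andbF.
have FB a b : b \notin A -> F b a = false.
  by move=> bA; apply/negP => /FG/GA; rewrite (negPf bA).
have y0F a b : F a b <= y0 a b.
  have := hy0 a b; case E : (F a b) => //=.
  by rewrite (FG E); move: k1; clear; lia.
have yE a b : a \in A -> y a b + F a b = y0 a b + o a b.
  by move=> aA; rewrite /y aA subnK //; apply: leq_trans (y0F a b) (leq_addr _ _).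
have oF a b : a \in A -> o a b <= 2 * F a b.
  by move=> aA; have := ow a b; rewrite /w (FA a b aA) addn0; lia.
(* A weight is at most 2k + 1 + 1, and m >= k + 1 because l >= 2. *)
have yN a b : y a b <= 2 * m.
  rewrite /y; case: ifP => // aA; have := oF a b aA; have := hy0 a b; move: kl k1.
  by rewrite /m; case: (G a b); case: (F a b) => /=; clear; lia.
have yc b : b \notin A -> \sum_a y a b = 2 * m * (k * q b).
  move=> bA; rewrite (bigID (fun a => a \in A)) /= [X in _ + X]big1 ?addn0; last first.
    by rewrite /y => a /negPf->.
  have h1 : \sum_(a in A) y a b + \sum_(a in A) F a b = \sum_(a in A) y0 a b + \sum_(a in A) o a b.
    by rewrite -!big_split; apply: eq_bigr => a aA; apply: yE.
  have cond (f : T -> nat) : (forall a, a \notin A -> f a = 0) -> \sum_(a in A) f a = \sum_a f a.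
    by move=> f0; rewrite [RHS](bigID (fun a => a \in A)) /= [X in _ = _ + X]big1 ?addn0.
  have GF a : a \notin A -> G a b = false /\ F a b = false.
    move=> aA; have G0 : G a b = false by apply/negP => /GA; rewrite (negPf aA).
    by split=> //; apply/negP => /FG; rewrite G0.
  move: h1; rewrite !cond => [h1|a aA|a aA|a aA|a aA].
  2-5: have [Ga Fa] := GF a aA; have := hy0 a b; have := ow a b; rewrite /w /y ?(negPf aA) Ga Fa (FB a b bA) //; lia.
  have := o0 b bA; have := sumo b; rewrite degB // /net; move: h1; rewrite sy0 //.
  have -> : 2 * k * m * q b = 2 * m * (k * q b) by clear; lia.
  move: (2 * m * _) => X; clear; lia.
have yr a : exists p, \sum_b y a b = 2 * m * (k * p).
  have [aA|aA] := boolP (a \in A); last by exists 0; rewrite !muln0 big1 // /y (negPf aA).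
  have h1 : \sum_b y a b + \sum_b F a b = \sum_b y0 a b + \sum_b o a b.
    by rewrite -!big_split; apply: eq_bigr => b _; apply: yE.
  have [t ht] := oa a aA; move: ht h1 (sumo a); rewrite degA // /net /tau.
  move: (\sum_b y a b) (\sum_b y0 a b) (\sum_b (F a b : nat)) (\sum_b o a b) (\sum_b o b a) => Y Y0 FF O I.
  move=> e1 e2 e3; have e4 : Posz Y = (t * Posz (2 * m * k))%R.
    by move: e1 e2 e3; rewrite [(2 * (2 * m * k))%N]mulnC PoszM; move: (2 * m * k) => K; clear; nia.
  have t0 : (0 <= t)%R by move: e4 K0; clear; move: (2 * m * k) => K; nia.
  by exists `|t|%N; apply/eqP; rewrite -eqz_nat e4 -{1}(gez0_abs t0) -PoszM eqz_nat mulnC !mulnA.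
have yc' b : b \in A -> \sum_a y a b = 0.
  move=> bA; rewrite big1 // => a _; rewrite /y; case: ifP => // aA.
  by rewrite y00 //; have := oF a b aA; rewrite (FA b a bA); lia.
have /fin_all_exists[p hp] := yr.
have [||||H [H1 H2 H3]] := @round_exact _ _ (2 * m) y (fun a => k * p a) (fun b => if b \in A then 0 else k * q b).
- by rewrite muln_gt0 m0.
- exact: yN.
- exact: hp.
- by move=> b; case: ifP => [/yc'->|/negbT/yc->]; rewrite ?muln0.
exists H, p; split=> //.
- move=> a b /H1; rewrite /y; case: ifP => // aA; have := hy0 a b; have := oF a b aA.
  case E : (F a b); first by rewrite (FG E).
  by case: (G a b) => //; lia.
- by move=> b /negPf bA; rewrite H3 bA.
(* Every edge of F keeps weight at least 2k - 1, so [2 * m * k * p a] is at least (2k - 1) 6m^2, and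
   k >= 2 gives [p a >= 4 * m]. *)
move=> a aA; have h1 := conn_out aA.
have h2 : (2 * k - 1) * \sum_b (F a b : nat) <= \sum_b y a b.
  rewrite big_distrr /=; apply: leq_sum => b _; have := yE a b aA; have := hy0 a b.
  by case E: (F a b); rewrite ?(FG E) //; move: k1; clear; lia.
have h3 : (2 * k - 1) * (6 * m ^ 2) <= 2 * m * (k * p a).
  by rewrite -hp; apply: leq_trans h2; rewrite leq_mul2l h1 orbT.
rewrite -(@leq_pmul2l (m * k)) ?muln_gt0 ?m0; last by lia.
have h4 : m ^ 2 = m * m by rewrite -mulnn.
rewrite h4 in h3; move: k1 h3; clear; move: m => n; nia.
Qed.

End Frac.

(** * Distribution with capacities and forbidden places *)

Section Fibres.
Variables (T : finType) (L : {set T}) (Fb : T -> {set T}) (cap : T -> nat).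

(** Induction on D with r enlarged: when j is served, [r + cap j] elements are still free and at
    most r of them are forbidden for j. *)
Lemma fibre_partial (D : {set T}) r : #|L| = \sum_(j in D) cap j + r ->
  (forall j, j \in D -> #|Fb j| <= r) ->
  exists f : T -> option T, [/\ forall x j, f x = Some j -> [/\ x \in L, j \in D & x \notin Fb j],
    forall j, j \in D -> #|[set x | f x == Some j]| = cap j & #|[set x in L | f x == None]| = r].
Proof.
elim: {D}#|D| {-2}D (erefl #|D|) r => [|n IH] D cD r cL hF.
  exists (fun=> None); split=> //.
    by move=> j; rewrite (card0_eq cD).
  move: cL; rewrite big1 ?add0n => [<-|j]; last by rewrite (card0_eq cD).
  by apply: eq_card => x; rewrite !inE eqxx andbT.
have /card_gt0P[j jD] : 0 < #|D| by rewrite cD.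
have cD' : #|D :\ j| = n by move: cD; rewrite (cardsD1 j) jD => -[].
move: cL; rewrite (big_setD1 j) //= => cL.
have [||f [f1 f2 f3]] := IH _ cD' (r + cap j).
- by rewrite cL; lia.
- by move=> i /setD1P[_ /hF]; lia.
set M := [set x in L | f x == None] in f3.
have [S /subsetP SM cS] : exists2 S : {set T}, S \subset M :\: Fb j & #|S| = cap j.
  apply: subset_of_card; have := cardsD M (Fb j); have := subset_leq_card (subsetIr M (Fb j)).
  by have := hF j jD; rewrite f3; lia.
have SP x : x \in S -> [/\ x \in L, f x = None & x \notin Fb j].
  by move/SM; rewrite !inE => /and3P[-> -> /eqP].
exists (fun x => if x \in S then Some j else f x); split.
- move=> x i; case: ifP => [/SP[xL _ xF] [<-]|_ /f1[xL /setD1P[_ iD] xF]] //.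
- move=> i iD; have [->|ij] := eqVneq i j.
    rewrite -cS; apply: eq_card => x; rewrite inE; case: ifP => [_|xS]; first by rewrite eqxx.
    by apply/negP => /eqP /f1[_]; rewrite !inE eqxx.
  rewrite -f2 ?inE ?ij //; apply: eq_card => x; rewrite !inE; case: ifP => // /SP[_ -> _].
  by rewrite eq_sym; apply/negbTE/eqP => -[] e; rewrite e eqxx in ij.
have -> : [set x in L | (if x \in S then Some j else f x) == None] = M :\: S.
  by apply/setP => x; rewrite !inE; case: ifP => xS; rewrite ?andbF.
have sSM : S \subset M by apply/subsetP => x /SM; rewrite inE => /andP[].
by have := cardsD M S; rewrite (setIidPr sSM) f3 cS; lia.
Qed.

End Fibres.

(* The indices carrying a restriction are served first: the share of the others leaves enough room. *)
Lemma fibre_assign (T : finType) (L D1 D2 : {set T}) (Fb : T -> {set T}) (cap : T -> nat) :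
  [disjoint D1 & D2] -> #|L| = \sum_(j in D1) cap j + \sum_(j in D2) cap j ->
  (forall j, j \in D1 -> #|Fb j| <= \sum_(j in D2) cap j) ->
  (forall j, j \in D2 -> Fb j = set0) ->
  exists f : T -> T, [/\ forall x, x \in L -> f x \in D1 :|: D2,
    forall x, x \in L -> x \notin Fb (f x) &
    forall j, j \in D1 :|: D2 -> #|[set x in L | f x == j]| = cap j].
Proof.
move=> D12 cL h1 h2.
have [f [f1 f2 f3]] := fibre_partial cL h1.
have [||g [g1 g2 g3]] := @fibre_partial T [set x in L | f x == None] Fb cap D2 0.
- by rewrite f3 addn0.
- by move=> j /h2 ->; rewrite cards0.
have g0 x : x \in L -> f x = None -> exists j, g x = Some j.
  move=> xL fx; case E : (g x) => [j|]; first by exists j.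
  have : x \in set0 by rewrite -(cards0_eq g3) !inE xL fx E.
  by rewrite inE.
pose F x := if f x is Some j then j else odflt x (g x).
have FP x : x \in L -> f x = Some (F x) \/ (f x = None /\ g x = Some (F x)).
  move=> xL; rewrite /F; case E : (f x) => [j|]; first by left.
  by right; have [j ->] := g0 x xL E.
exists F; split=> [x /FP[/f1[]|[_ /g1[]]]|x /FP[/f1[]|[_ /g1[]]]|j].
- by rewrite inE => _ ->.
- by rewrite !inE => _ -> ; rewrite orbT.
- by [].
- by [].
case/setUP => jD.
  rewrite -f2 //; apply: eq_card => x; rewrite !inE; apply/andP/eqP => [[xL /eqP e]|e].
    case: (FP x xL) => [->|[_ /g1[_]]]; rewrite e // => jD2 _.
    by move/pred0P/(_ j): D12; rewrite /= jD jD2.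
  by have [xL _ _] := f1 _ _ e; rewrite /F e xL.
rewrite -g2 //; apply: eq_card => x; rewrite !inE; apply/andP/eqP => [[xL /eqP e]|e].
  case: (FP x xL) => [/f1[_]|[_ ->]]; rewrite e // => jD1 _.
  by move/pred0P/(_ j): D12; rewrite /= jD jD1.
have [] := g1 _ _ e; rewrite inE => /andP[xL /eqP fx] _ _.
by rewrite /F fx e xL.
Qed.

(** The edges are grouped by owner. Since R is asymmetric, an edge comes from a single arc, so it
    has one owner and the groups are disjoint. *)
Lemma decomposable_own (k l : nat) (T I : finType) (R : rel T) (own : T -> T -> I) (D : {set I}) :
  1 < k -> k <= l ->
  (forall u v, R u v -> ~~ R v u) -> (forall u v, R u v -> own u v \in D) ->
  (forall i, i \in D -> bistar_copy k l (edges (fun u v => R u v && (own u v == i)))) ->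
  decomposable k l (edges R).
Proof.
move=> k1 kl asR oD hb.
have -> : edges R = \bigcup_(i in D) edges (fun u v => R u v && (own u v == i)).
  apply/setP => e; apply/edgesP/bigcupP => [[u [v [Ruv ->]]]|[i _ /edgesP[u [v [/andP[Ruv _] ->]]]]].
    by exists (own u v); [exact: oD | apply/edgesP; exists u, v; rewrite Ruv eqxx].
  by exists u, v.
apply: decomposable_family => // i j iD jD ji; apply: disjointI => e.
move=> /edgesP[u [v [/andP[Ruv /eqP oi] ->]]]; apply/negP => /edgesP[u' [v' [/andP[Ruv' /eqP oj]]]].
case/set2_eq => -[? ?]; subst u' v'; first by rewrite -oi -oj eqxx in ji.
by have := asR _ _ Ruv; rewrite Ruv'.
Qed.

(** * Central edges and leaves in the bipartite case *)

Section Assemble.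
Variables (T : finType) (k l : nat) (A : {set T}) (G F : rel T) (In : T -> {set T}) (q : T -> nat).
Hypotheses (k1 : 1 < k) (kl : k <= l).
Let m := k + l - 1.
Hypotheses (T1 : 1 < #|T|) (GA : forall a b, G a b -> (a \in A) && (b \notin A)).
Hypotheses (FG : subrel F G) (InP : forall b y, y \in In b -> [/\ b \notin A, y \notin A, y != b & b \notin In y]).
Hypotheses (In_le : forall b, #|In b| <= m - 1).
Hypothesis dq : forall b, b \notin A -> \sum_a (G a b : nat) + #|In b| = m * q b.
Hypothesis conn : forall X, separates [set: T] X -> 6 * m ^ 2 <= cut (fun x y => F x y + F y x) X.

Lemma In0 a : a \in A -> In a = set0.
Proof. by move=> aA; apply/setP => y; rewrite inE; apply/negP => /InP[]; rewrite aA. Qed.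

(** The row and column sums of H are multiples of k, so weights 1/k round exactly to the central
    edges C. Rounding half of C gives C1, the centres allowed to carry inner edges. Rows of C have
    at least 4m edges and columns at least 6m, so each column of C1 has two edges and each row of C
    has l-1 edges outside C1. *)
Lemma exists_centres : exists (H C C1 : rel T), [/\ subrel H G, subrel C H & subrel C1 C] /\
  [/\ forall a, \sum_b (H a b : nat) = k * \sum_b (C a b : nat),
   forall b, b \notin A -> \sum_a (H a b : nat) = k * \sum_a (C a b : nat),
   forall b, b \notin A -> \sum_a (C a b : nat) = q b,
   forall b, b \notin A -> 2 <= \sum_a (C1 a b : nat) &
   forall a, a \in A -> l - 1 + \sum_b (C1 a b : nat) <= \sum_b (C a b : nat)].
Proof.
have innA a : a \in A -> #|In a| = 0 by move/In0->; rewrite cards0.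
have [H [p [H1 H2 H3 H4]]] := exists_H k1 kl T1 GA FG innA In_le dq conn.
have H0 b : b \in A -> \sum_a (H a b : nat) = 0.
  by move=> bA; rewrite big1 // => a _; case E : (H a b) => //; have := GA (H1 _ _ E); rewrite bA andbF.
have [||||C [C1 C2 C3]] := @round_exact _ _ k (fun a b => H a b : nat) p (fun b => if b \in A then 0 else q b).
- by lia.
- by move=> a b; case: (H a b) => //; lia.
- exact: H2.
- by move=> b; case: ifP => [/H0->|/negbT/H3//]; rewrite muln0.
have [||D [D1 D2 D3 D4 D5]] := @round_near _ _ 2 (fun a b => C a b : nat) => //.
  by move=> a b; case: (C a b).
have C3' b : b \notin A -> \sum_a (C a b : nat) = q b by move=> /negPf bA; rewrite C3 bA.
exists H, C, D; split; first split=> //.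
- by move=> a b /C1; case: (H a b).
- by move=> a b /D1; case: (C a b).
split=> [a|b bA|b bA|b bA|a aA].
- by rewrite H2 C2.
- by rewrite H3 // C3'.
- exact: C3'.
- have h1 := conn_in k1 kl T1 GA FG conn bA; have h2 := D5 b; rewrite C3' // in h2.
  have h3 : \sum_a (F a b : nat) <= \sum_a (G a b : nat).
    by apply: leq_sum => a _; case E: (F a b) => //; rewrite FG.
  have h4 : 6 * m <= q b.
    rewrite -(@leq_pmul2l m); last by rewrite /m; lia.
    by rewrite -dq // mulnCA mulnn (leq_trans h1) // (leq_trans h3) // leq_addr.
  by move: h2 h4 k1 kl; rewrite /m; clear; lia.
have := D2 a; have := H4 a aA; rewrite C2 -/m; move: k1 kl; rewrite /m; clear; lia.
Qed.

(** Centres in C1, whose inner leaves are forbidden, are served first. The at least l-1 unrestricted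
    centres keep (l-1)(k-1) >= l-1 leaves in reserve, as many as can be forbidden. *)
Lemma row_leaves (H C C1 : rel T) (Fb : T -> T -> {set T}) : subrel C H -> subrel C1 C ->
  (forall a, \sum_b (H a b : nat) = k * \sum_b (C a b : nat)) ->
  (forall a, a \in A -> l - 1 + \sum_b (C1 a b : nat) <= \sum_b (C a b : nat)) ->
  (forall a b, C1 a b -> #|Fb a b| <= l - 1) -> (forall a b, ~~ C1 a b -> Fb a b = set0) ->
  exists f : T -> T -> T, forall a, a \in A -> [/\
    forall b, H a b -> ~~ C a b -> C a (f a b) && (b \notin Fb a (f a b)) &
    forall b, C a b -> #|[set x | H a x && ~~ C a x && (f a x == b)]| = k - 1].
Proof.
move=> CH C1C sH sC1 F1 F0.
suff h a : exists f : T -> T, a \in A -> [/\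
    forall b, H a b -> ~~ C a b -> C a (f b) && (b \notin Fb a (f b)) &
    forall b, C a b -> #|[set x | H a x && ~~ C a x && (f x == b)]| = k - 1].
  by have [f hf] := fin_all_exists h; exists f.
have [aA|] := boolP (a \in A); last by exists id.
pose D1 := [set b | C1 a b]; pose D2 := [set b | C a b && ~~ C1 a b].
have cD : #|D1| + #|D2| = \sum_b (C a b : nat).
  rewrite -!sum_pred_card -big_split; apply: eq_bigr => b _ /=.
  by have := @C1C a b; case: (C1 a b) => [->|_] //; rewrite andbT.
have c1 : #|D1| = \sum_b (C1 a b : nat) by rewrite -sum_pred_card.
have [||||f [f1 f2 f3]] := @fibre_assign T [set x | H a x && ~~ C a x] D1 D2 (Fb a) (fun=> k - 1).
- by apply: disjointI => b; rewrite !inE => ->; rewrite andbF.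
- rewrite !sum_nat_const -mulnDl cD -sum_pred_card.
  have : \sum_x (H a x && ~~ C a x : nat) + \sum_b (C a b : nat) = \sum_b (H a b : nat).
    rewrite -big_split; apply: eq_bigr => b _ /=.
    by have := @CH a b; case: (C a b) => [->|_] //; rewrite andbT addn0.
  by rewrite sH; move: k1; case: (k) => // n; rewrite mulSn mulnC subn1 /=; clear; lia.
- move=> b; rewrite inE sum_nat_const => /F1 h; apply: leq_trans h _.
  apply: leq_trans (_ : #|D2| * 1 <= _); last by rewrite leq_mul2l; move: k1; lia.
  by have := sC1 a aA; rewrite -cD c1; lia.
- by move=> b; rewrite inE => /andP[_ /F0].
have DU : D1 :|: D2 = [set b | C a b].
  by apply/setP => b; rewrite !inE; have := @C1C a b; case: (C1 a b) => [->|_] //; rewrite andbT.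
exists f; split=> [b Hb Cb|b Cb].
  have bL : b \in [set x | H a x && ~~ C a x] by rewrite inE Hb.
  by have := f1 b bL; rewrite DU inE => ->; rewrite f2.
rewrite -(f3 b); last by rewrite DU inE.
by apply: eq_card => x; rewrite !inE.
Qed.

(** Two centres suffice for the inner edges of b, since m - 1 = k + l - 2 <= 2 (l - 1). *)
Lemma inner_leaves (C1 : rel T) : (forall b, b \notin A -> 2 <= \sum_a (C1 a b : nat)) ->
  exists f : T -> T -> T, forall b, b \notin A ->
    (forall y, y \in In b -> C1 (f b y) b) /\ (forall a, #|[set y in In b | f b y == a]| <= l - 1).
Proof.
move=> s1; suff h b : exists f : T -> T, b \notin A ->
    (forall y, y \in In b -> C1 (f y) b) /\ (forall a, #|[set y in In b | f y == a]| <= l - 1).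
  by have [f hf] := fin_all_exists h; exists f.
have [|bA] := boolP (b \in A); first by exists id.
pose D := [set a | C1 a b].
have [|h [h1 h2]] := @nat_subsel T D (fun=> l - 1) #|In b|.
  rewrite sum_nat_const -sum_pred_card; have := s1 b bA; have := In_le b.
  move=> h1 h2; apply: leq_trans (_ : 2 * (l - 1) <= _); last by rewrite leq_mul2r h2 orbT.
  by move: h1 k1 kl; rewrite /m; clear; lia.
have [||||f [f1 f2 f3]] := @fibre_assign T (In b) set0 D (fun=> set0) h.
- by apply: disjointI => x; rewrite inE.
- by rewrite big_set0 h2.
- by move=> j; rewrite inE.
- by [].
rewrite set0U in f1 f3; exists f; split=> [y /f1|a]; first by rewrite inE.
have [aD|aD] := boolP (a \in D); first by rewrite f3.
rewrite (_ : [set y in _ | _] = set0) ?cards0 //; apply/setP => y; rewrite !inE.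
by apply/negP => /andP[/f1 yD /eqP e]; rewrite -e yD in aD.
Qed.

(** At b the edges outside H number [m * q b - #|In b| - k * q b], that is
    [(l - 1) * q b - #|In b|]: exactly the places left by the inner leaves. *)
Lemma column_leaves (H C : rel T) (I : T -> T -> {set T}) : subrel H G -> subrel C H ->
  (forall b, b \notin A -> \sum_a (H a b : nat) = k * \sum_a (C a b : nat)) ->
  (forall b, b \notin A -> \sum_a (C a b : nat) = q b) ->
  (forall a b, b \notin A -> #|I a b| <= l - 1) ->
  (forall b, b \notin A -> \sum_(a | C a b) #|I a b| = #|In b|) ->
  exists f : T -> T -> T, forall b, b \notin A -> [/\
    forall a, G a b -> ~~ H a b -> C (f b a) b &
    forall a, C a b -> #|[set x | G x b && ~~ H x b && (f b x == a)]| + #|I a b| = l - 1].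
Proof.
move=> HG CH sH sC I1 I2.
suff h b : exists f : T -> T, b \notin A -> [/\
    forall a, G a b -> ~~ H a b -> C (f a) b &
    forall a, C a b -> #|[set x | G x b && ~~ H x b && (f x == a)]| + #|I a b| = l - 1].
  by have [f hf] := fin_all_exists h; exists f.
have [|bA] := boolP (b \in A); first by exists id.
pose D := [set a | C a b].
have cD : #|D| = q b by rewrite -sum_pred_card sC.
have [||||f [f1 f2 f3]] := @fibre_assign T [set x | G x b && ~~ H x b] set0 D (fun=> set0) (fun a => l - 1 - #|I a b|).
- by apply: disjointI => x; rewrite inE.
- rewrite big_set0 add0n -sum_pred_card.
  have h1 : \sum_x (G x b && ~~ H x b : nat) + \sum_x (H x b : nat) = \sum_x (G x b : nat).
    rewrite -big_split; apply: eq_bigr => x _ /=.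
    by have := @HG x b; case: (H x b) => [->|_] //; rewrite andbT addn0.
  have h2 : \sum_(a in D) (l - 1 - #|I a b|) + \sum_(a in D) #|I a b| = (l - 1) * q b.
    rewrite -big_split -cD mulnC -sum_nat_const; apply: eq_bigr => a _ /=.
    by rewrite subnK ?I1.
  have h3 : \sum_(a in D) #|I a b| = #|In b|.
    by rewrite -I2 //; apply: eq_bigl => a; rewrite inE.
  move: h1 h2 (dq bA); rewrite h3 sH // sC // /m.
  have -> : (k + l - 1) * q b = k * q b + (l - 1) * q b by rewrite -mulnDl addnBA //; lia.
  by clear; lia.
- by move=> j; rewrite inE.
- by [].
rewrite set0U in f1 f3; exists f; split=> [a Ga Ha|a Ca].
  by have := f1 a; rewrite !inE Ga Ha; apply.
have aD : a \in D by rewrite inE.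
rewrite -[RHS](subnK (I1 a b bA)) -f3 //; congr (_ + _); apply: eq_card => x; by rewrite !inE.
Qed.

Theorem bipartite_decomposable : decomposable k l (edges (fun u v => G u v || (v \in In u))).
Proof.
have [H [C [C1 [[HG CH C1C] [sH sH' sC sC1 sC2]]]]] := exists_centres.
have [fI hI] := inner_leaves sC1.
have fIP b y : y \in In b -> C1 (fI b y) b.
  by move=> yb; have [bA _ _ _] := InP yb; apply: (hI b bA).1.
pose I a b := [set y in In b | fI b y == a].
have I_le a b : #|I a b| <= l - 1.
  have [bA|bA] := boolP (b \in A); last exact: (hI b bA).2.
  rewrite (_ : I a b = set0) ?cards0 //; apply/setP => y; rewrite !inE In0 // inE //.
have I0 a b : ~~ C1 a b -> I a b = set0.
  move=> nC; apply/setP => y; rewrite !inE; apply/negP => /andP[/fIP c /eqP e].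
  by rewrite -e c in nC.
have sI b : b \notin A -> \sum_(a | C a b) #|I a b| = #|In b|.
  move=> bA; rewrite -[RHS]sum1_card [RHS](partition_big (fI b) (fun a => C a b)) /=; last first.
    by move=> y /fIP; apply: C1C.
  by apply: eq_bigr => a _; rewrite -sum1_card; apply: eq_bigl => y; rewrite inE.
have [fA hA] := row_leaves (Fb := I) CH C1C sH sC2 (fun a b _ => I_le a b) I0.
have [fB hB] := column_leaves HG CH sH' sC (fun a b _ => I_le a b) sI.
(* The bistar of an arc is named by its central edge: non-central H-edges follow their end in A, the
   other edges of G their end outside A, and an inner edge the end to which it is charged. *)
pose own u v := if G u v then if C u v then (u, v) else if H u v then (u, fA u v) else (fB v u, v)
  else (fI u v, u).
have asR u v : G u v || (v \in In u) -> ~~ (G v u || (u \in In v)).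
  case/orP => [/GA/andP[uA vA]|/InP[uA vA _ nuv]]; rewrite negb_or; apply/andP; split.
  - by apply/negP => /GA/andP[]; rewrite (negPf vA).
  - by apply/negP => /InP[_]; rewrite uA.
  - by apply/negP => /GA/andP[]; rewrite (negPf vA).
  exact: nuv.
have nG u v : v \in In u -> G u v = false.
  by case/InP => uA _ _ _; apply/negP => /GA; rewrite (negPf uA).
apply: (@decomposable_own k l T _ _ own [set p | C p.1 p.2]) => // [u v|[a b]].
  rewrite inE /own; case: ifP => [Guv _|Guv /= vu]; last by apply/C1C/fIP.
  have /andP[uA vA] := GA Guv.
  case: ifP => // nC; case: ifP => /= nH.
    by have [/(_ v nH) h _] := hA u uA; have /andP[] := h (negbT nC).
  by have [h _] := hB v vA; apply: h; rewrite ?nH.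
rewrite inE /= => Cab; have Hab := CH _ _ Cab; have Gab := HG _ _ Hab.
have /andP[aA bA] := GA Gab; have ab : a != b by apply: contraNneq bA => <-.
have [A1 A2] := hA a aA; have [B1 B2] := hB b bA.
pose X := [set x | H a x && ~~ C a x && (fA a x == b)].
pose Z := [set x | G x b && ~~ H x b && (fB b x == a)].
have XP x : x \in X -> [/\ H a x, ~~ C a x, fA a x = b, x \notin A & x \notin I a b].
  rewrite inE => /andP[/andP[Hx Cx] /eqP e]; have /andP[_ xA] := GA (HG _ _ Hx).
  by have /andP[_] := A1 x Hx Cx; rewrite e.
have ZP x : x \in Z -> [/\ G x b, ~~ H x b, fB b x = a & x \in A].
  by rewrite inE => /andP[/andP[Gx Hx] /eqP e]; have /andP[] := GA Gx.
have IP x : x \in I a b -> [/\ x \in In b, fI b x = a, x \notin A & x != b].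
  by rewrite inE => /andP[xb /eqP e]; have [] := InP xb.
suff -> : edges (fun u v => (G u v || (v \in In u)) && (own u v == (a, b))) = star_pair a b X (I a b :|: Z).
  apply: bistar_build => //.
  - exact: A2.
  - rewrite cardsU (_ : I a b :&: Z = set0) ?cards0 ?subn0 1?addnC ?B2 //.
    by apply/setP => x; rewrite inE [RHS]inE; apply/negP => /andP[/IP[_ _ /negPf xA _] /ZP[_ _ _]]; rewrite xA.
  - rewrite !in_setU !negb_or; apply/and3P; split; apply/negP.
    + by move/XP => [_ _ _]; rewrite aA.
    + by move/IP => [_ _]; rewrite aA.
    + by move/ZP => [_]; rewrite Hab.
  - rewrite !in_setU !negb_or; apply/and3P; split; apply/negP.
    + by move/XP => [_]; rewrite Cab.
    + by move/IP => [_ _ _]; rewrite eqxx.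
    + by move/ZP => [_ _ _]; rewrite (negPf bA).
  (* Leaves of a lie outside A, so they could only meet inner leaves of b, which [fA] was told to
     avoid. *)
  apply: disjointI => x /XP[_ _ _ xA xI]; rewrite in_setU negb_or xI /=.
  by apply/negP => /ZP[_ _ _]; rewrite (negPf xA).
apply/setP => e; apply/edgesP/idP => [[u [v [/andP[Ruv /eqP o] ->]]]|].
  rewrite !inE; move: o; rewrite /own; case: ifP => Guv.
    case: ifP => [_ [-> ->]|nC]; first by rewrite eqxx.
    case: ifP => nH [e1 e2]; apply/orP; right; apply/orP; [left|right]; apply/imsetP.
      by exists v; rewrite ?inE -e1 ?nH ?nC -?e2 ?eqxx.
    by exists u; rewrite ?in_setU ?inE -e2 ?Guv ?nH ?e1 ?eqxx ?orbT // setUC.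
  move: Ruv; rewrite Guv /= => vu [e1 e2]; apply/orP; right; apply/orP; right; apply/imsetP.
  by subst u; exists v; rewrite // in_setU inE vu e1 eqxx.
rewrite !inE => /orP[/eqP->|/orP[/imsetP[x /XP[Hx Cx fx _ _] ->]|/imsetP[x]]].
- by exists a, b; rewrite /own Gab Cab eqxx.
- by exists a, x; rewrite /own (HG _ _ Hx) Hx (negPf Cx) fx eqxx.
rewrite in_setU => /orP[/IP[xb fx _ _]|/ZP[Gx Hx fx _]] ->.
  by exists b, x; rewrite /own xb nG // fx eqxx.
exists x, b; rewrite /own Gx (negPf Hx) fx /= setUC; split=> //.
by case: ifP => [/CH|_]; rewrite ?eqxx // (negPf Hx).
Qed.

End Assemble.

(** * Max cut and the reduction to the bipartite case *)

Section Count.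
Variable T : finType.

Lemma card_edges_asym (R : rel T) : (forall u v, R u v -> ~~ R v u) ->
  #|edges R| = \sum_u \sum_v (R u v : nat).
Proof.
move=> asR; rewrite /edges card_in_imset; last first.
  move=> [u v] [u' v']; rewrite !inE /= => Ruv Ruv' /set2_eq[[-> ->]//|[e1 e2]].
  by have := asR _ _ Ruv; rewrite e1 e2 Ruv'.
by rewrite pair_big_dep /= -sum_pred_card.
Qed.

Lemma card_edges_sym (s : rel T) : symmetric s -> irreflexive s ->
  2 * #|edges s| = \sum_u \sum_v (s u v : nat).
Proof.
move=> ss is_; pose R u v := s u v && (enum_rank u < enum_rank v).
have asR u v : R u v -> ~~ R v u by case/andP => _ h; rewrite /R ltnNge (ltnW h) andbF.
have sR u v : s u v = R u v + R v u :> nat.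
  rewrite /R [s v u]ss; case E : (s u v) => //=; case: ltngtP => //.
  by move=> /val_inj/enum_rank_inj e; rewrite e is_ in E.
have -> : edges s = edges R.
  apply/setP => e; apply/edgesP/edgesP => -[u [v [h ->]]]; last by case/andP: h; exists u, v.
  have := sR u v; rewrite h; case E : (R u v); first by exists u, v.
  by case E' : (R v u) => // _; exists v, u; rewrite setUC.
under eq_bigr do under eq_bigr do rewrite sR.
under eq_bigr do rewrite big_split.
by rewrite big_split /= [X in _ + X]exchange_big -!card_edges_asym // mul2n addnn.
Qed.

Lemma bistar_copy_card k l (H : {set {set T}}) : 1 < k -> k <= l -> bistar_copy k l H -> #|H| = k + l - 1.
Proof.
move=> k1 kl [f [fi ->]]; have o0 : 0 < k + l by lia.
have o1 : 1 < k + l by lia.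
(* The bistar is rooted at 0, and each other vertex stands for the edge to its parent; a parent
   precedes its child, so no edge is counted twice. *)
pose par (j : 'I_(k + l)) := if (j == 1 :> nat) || (j <= k) then Ordinal o0 else Ordinal o1.
have par_lt (j : 'I_(k + l)) : 0 < j -> par j < j by rewrite /par; case: ifP => //=; lia.
have arcE (i j : 'I_(k + l)) : bistar_arc k l i j = (0 < j) && (i == par j).
  rewrite /bistar_arc /par; case: ifP => h; rewrite -val_eqE /=; have := ltn_ord j; move: k1 kl h; clear;
  move: (nat_of_ord i) (nat_of_ord j) => x y; lia.
rewrite (_ : imset _ _ = [set [set f (par j); f j] | j in [set~ Ordinal o0]]).
  rewrite card_in_imset ?cardsC1 ?card_ord ?subn1 // => i j; rewrite !inE -!val_eqE -!lt0n /= => i0 j0.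
  case/set2_eq => -[e1 /fi e2] //; have := par_lt i i0; have := par_lt j j0.
  by rewrite -e2 (fi _ _ e1); lia.
apply/setP => e; apply/imsetP/imsetP => [[[i j]]|[j]]; rewrite !inE /=.
  case/orP; rewrite arcE => /andP[h /eqP e1] ->.
    by exists j; rewrite ?inE -?e1 // -val_eqE -lt0n.
  by exists i; rewrite ?inE -?e1 // -?val_eqE -?lt0n // setUC.
by rewrite -val_eqE -lt0n /= => j0 ->; exists (par j, j); rewrite // inE /= /bistar_rel arcE j0 eqxx.
Qed.

Lemma decomposable_card k l (E : {set {set T}}) : 1 < k -> k <= l -> decomposable k l E -> k + l - 1 %| #|E|.
Proof.
move=> k1 kl [P [pP hP]]; rewrite (card_partition pP) dvdn_sum // => H /hP c.
by rewrite (bistar_copy_card k1 kl c).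
Qed.

Lemma cut_edge_connected (g : rel T) n X : edge_connected g n -> symmetric g -> separates [set: T] X ->
  n <= cut (fun x y => g x y) X.
Proof.
move=> [_ cn] sg /andP[]; rewrite setTI => /set0Pn[x xX] /set0Pn[y]; rewrite !inE andbT => yX.
rewrite leqNgt; apply/negP => lt.
pose F := edges (fun u v => [&& g u v, u \in X & v \notin X]).
have FE : F \subset edges g by apply/subsetP => e /edgesP[u [v [/andP[guv _] ->]]]; rewrite mem_edges.
have cF : #|F| < n.
  apply: leq_ltn_trans lt; rewrite card_edges_asym; last first.
    by move=> u v /and3P[_ uX vX]; rewrite uX /= !andbF.
  by apply: leq_sum => u _; apply: leq_sum => v _; case: (g u v); case: (u \in X); case: (v \in X).
have hc a b : [set a; b] \in edges g :\: F -> a \in X -> b \in X.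
  rewrite in_setD [_ \in edges g]mem_edges // => /andP[nF gab] aX; apply: contraNT nF => bX.
  by apply/edgesP; exists a, b; rewrite gab aX.
have cl : closed (fun a b => [set a; b] \in edges g :\: F) (mem X).
  by move=> a b eab; apply/idP/idP; apply: hc; rewrite // setUC.
by have := closed_connect cl (cn F FE cF x y); rewrite /= xX (negPf yX).
Qed.

(** Moving X across the cut, that is passing to the symmetric difference of A and X, gains the
    non-crossing edges of the boundary of X and loses the crossing ones; by maximality the latter
    are at least half. *)
Lemma max_cut (w : T -> T -> nat) : wsym w -> exists A : {set T}, forall X,
  cut w X <= 2 * cut (fun x y => w x y * ((x \in A) (+) (y \in A))) X.
Proof.
move=> [sw _]; pose A := [arg max_(A > set0) cut w A]; exists A => X.
have hA B : cut w B <= cut w A by rewrite /A; case: arg_maxnP => // C _; apply.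
pose B := (A :\: X) :|: (X :\: A).
have h1 : (cut w B).*2 + 2 * (cut (fun x y => w x y * ((x \in A) (+) (y \in A))) X).*2 = (cut w A).*2 + (cut w X).*2.
  rewrite !cut_xor //; last by move=> x y; rewrite sw addbC.
  rewrite big_distrr -!big_split /=; apply: eq_bigr => x _.
  rewrite big_distrr -!big_split /=; apply: eq_bigr => y _.
  by rewrite !inE; do 4!case: (_ \in _); rewrite /= ?muln0 ?muln1; lia.
by have := hA B; lia.
Qed.

End Count.

Lemma cut_sum (T I : finType) (t : I -> T -> T -> nat) X :
  cut (fun x y => \sum_i t i x y) X = \sum_i cut (t i) X.
Proof.
rewrite /cut [RHS]exchange_big; apply: eq_bigr => x _; rewrite [RHS]exchange_big; apply: eq_bigr => y _.
by rewrite big_distrl.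
Qed.

(** Every layer crosses every separating cut, so n layers together have connectivity n. The first
    part also receives all edges in no layer, so that nothing is lost. *)
Lemma pack_three (T : finType) (s : rel T) n1 n2 n3 : 0 < n1 -> symmetric s -> irreflexive s ->
  (forall X, separates [set: T] X -> 2 * (n1 + (n2 + n3)) <= cut (fun x y => s x y) X) ->
  exists F1 F2 F3 : rel T, [/\ symmetric F1, symmetric F2, symmetric F3,
    forall x y, s x y = F1 x y + F2 x y + F3 x y :> nat &
    forall X, separates [set: T] X -> [/\ n1 <= cut (fun x y => F1 x y) X,
      n2 <= cut (fun x y => F2 x y) X & n3 <= cut (fun x y => F3 x y) X]].
Proof.
move=> n10 ss is_ hc; have c0 : 0 < n1 + (n2 + n3) by lia.
have [|||t [t1 t2 t3]] := @pack_layers T _ c0 (fun x y => s x y) [set: T].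
- by split=> [x y|x]; rewrite ?is_ // ss.
- by move=> u v; rewrite inE.
- move=> X /properP[_ [y _ yX]] X0; apply: hc; rewrite /separates setTI X0 /=.
  by apply/set0Pn; exists y; rewrite !inE yX.
pose G1 x y := \sum_(i < n1) t (lshift _ i) x y.
pose G2 x y := \sum_(i < n2) t (rshift _ (lshift _ i)) x y.
pose G3 x y := \sum_(i < n3) t (rshift _ (rshift _ i)) x y.
have Gs x y : G1 x y + (G2 x y + G3 x y) <= s x y.
  by have := t2 x y; rewrite !big_split_ord.
have [sG1 sG2 sG3] : [/\ forall x y, G1 x y = G1 y x, forall x y, G2 x y = G2 y x & forall x y, G3 x y = G3 y x].
  by split=> x y; apply: eq_bigr => i _; apply: (t1 _).1.
have cG n (f : 'I_n -> 'I_(n1 + (n2 + n3))) X : separates [set: T] X ->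
    n <= cut (fun x y => \sum_(i < n) t (f i) x y) X.
  move=> sX; rewrite (cut_sum (fun i => t (f i))) -[leqLHS]card_ord -sum1_card.
  by apply: leq_sum => i _; apply: t3.
exists (fun x y => [&& s x y, G2 x y == 0 & G3 x y == 0]), (fun x y => 0 < G2 x y), (fun x y => 0 < G3 x y).
split=> [x y|x y|x y|x y|X sX].
- by rewrite ss sG2 sG3.
- by rewrite sG2.
- by rewrite sG3.
- by have := Gs x y; case: (s x y) (G2 x y) (G3 x y) => [] [|[|a]] [|[|b]] //=; lia.
split.
- apply: leq_trans (cG _ (@lshift n1 _) X sX) _; apply: cut_le => x y; rewrite -/(G1 x y).
  by have := Gs x y; case: (s x y) (G2 x y) (G3 x y) => [] [|[|a]] [|[|b]] //=; lia.
- apply: leq_trans (cG _ (fun i => rshift n1 (lshift n3 i)) X sX) _; apply: cut_le => x y.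
  by rewrite -/(G2 x y); have := Gs x y; case: (s x y) (G2 x y) => [] [|[|a]] //=; lia.
apply: leq_trans (cG _ (fun i => rshift n1 (@rshift n2 n3 i)) X sX) _; apply: cut_le => x y.
by rewrite -/(G3 x y); have := Gs x y; case: (s x y) (G3 x y) => [] [|[|a]] //=; lia.
Qed.

(** An edge is charged to an end of degree below m; when both ends qualify, the enumeration rank
    decides. *)
Lemma exists_owner (T : finType) (h : rel T) m : 0 < m -> symmetric h -> irreflexive h ->
  (forall u v, h u v -> (#|[set x | h u x]| < m) || (#|[set x | h v x]| < m)) ->
  exists In : T -> {set T}, (forall u, #|In u| <= m - 1) /\
    forall u v, h u v = (v \in In u) + (u \in In v) :> nat.
Proof.
move=> m0 sh ih low; pose small u := #|[set x | h u x]| < m.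
exists (fun u => [set v | [&& h u v, small u & small v ==> (enum_rank u < enum_rank v)]]).
split=> [u|u v].
  have [su|nsu] := boolP (small u); last first.
    by rewrite (_ : [set _ | _] = set0) ?cards0 //; apply/setP => v; rewrite !inE /= andbF.
  have : #|[set x | h u x]| <= m - 1 by move: su m0; rewrite /small; lia.
  apply: leq_trans; apply: subset_leq_card.
  by apply/subsetP => v; rewrite !inE => /and3P[].
rewrite !inE [h v u]sh; case E : (h u v) => //=; have := low u v E; rewrite -/(small u) -/(small v).
case: (small u) (small v) => [] [] //= _; case: ltngtP => //.
by move=> /val_inj/enum_rank_inj e; rewrite e ih in E.
Qed.

(** The bipartite case in the form used twice, once for A and once for its complement: F is charged
    wholly to the side outside A, and of [o] only the arcs leaving A are used. *)
Lemma half_decomposable (T : finType) (k l : nat) (A : {set T}) (F o : rel T) (In : T -> {set T}) :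
  1 < k -> k <= l -> 1 < #|T| -> symmetric F ->
  (forall u v, F u v || o u v -> (u \in A) (+) (v \in A)) ->
  (forall u v, o u v -> ~~ F u v) ->
  (forall u v, v \in In u -> [/\ (v \in A) = (u \in A), v != u & u \notin In v]) ->
  (forall u, #|In u| <= k + l - 1 - 1) ->
  (forall b, b \notin A -> k + l - 1 %| \sum_a (F a b : nat) + \sum_a (o a b : nat) + #|In b|) ->
  (forall X, separates [set: T] X -> 6 * (k + l - 1) ^ 2 <= cut (fun x y => F x y) X) ->
  decomposable k l (edges (fun u v => if u \in A then F u v || o u v else v \in In u)).
Proof.
move=> k1 kl T1 sF bip dis InP In_le dv conn.
pose G u v := (u \in A) && (F u v || o u v).
pose In' u := if u \in A then set0 else In u.
pose q b := (\sum_a (F a b : nat) + \sum_a (o a b : nat) + #|In b|) %/ (k + l - 1).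
have := @bipartite_decomposable T k l A G (fun u v => (u \in A) && F u v) In' q k1 kl T1.
rewrite (_ : edges _ = edges (fun u v => if u \in A then F u v || o u v else v \in In u)); last first.
  apply/setP => e; apply/edgesP/edgesP => -[u [v [h ->]]]; exists u, v; split=> //; move: h; rewrite /G /In';
  by case: (u \in A); rewrite ?inE ?orbF.
apply.
- move=> a b /andP[aA h]; have := bip a b h; by rewrite aA.
- by move=> a b /andP[aA h]; rewrite /G aA h.
- move=> b y; rewrite /In'; case: ifP => [|bA]; first by rewrite inE.
  by move=> /InP[yA yb nb]; rewrite yA bA /=; split.
- by move=> b; rewrite /In'; case: ifP; rewrite ?cards0.
- move=> b bA; rewrite /q mulnC divnK ?dv // /In' (negPf bA); congr (_ + _).
  rewrite -big_split; apply: eq_bigr => a _ /=; rewrite /G.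
  have := bip a b; have := dis a b; rewrite (negPf bA).
  by case: (F a b) (o a b) (a \in A) => [] [] [] //= h1 h2; first [by have := h1 isT | by have := h2 isT].
move=> X sX; apply: leq_trans (conn X sX) _; apply: cut_le => x y; rewrite [F y x]sF.
by have := bip x y; case: (F x y) (x \in A) (y \in A) => [] [] [] //= h; have := h isT.
Qed.

(** The net degree of v is its degree minus twice its in-degree. Prescribing it as the degree plus
    [2 * c v] modulo 2m therefore makes the in-degree congruent to [- c v] modulo m. *)
Lemma orient_residue (T : finType) (m : nat) (w : rel T) (c : T -> nat) : 0 < m ->
  symmetric w -> irreflexive w ->
  (forall X, separates [set: T] X -> 9 * m <= cut (fun x y => w x y) X) ->
  2 * m %| \sum_v \sum_x (w v x : nat) + 2 * \sum_v c v ->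
  exists o : rel T, (forall u v, o u v + o v u = w u v :> nat) /\
    forall v, m %| c v + \sum_a (o a v : nat).
Proof.
move=> m0 sw iw hc dv; pose d v := \sum_x (w v x : nat).
have sw' : wsym (fun x y => w x y) by split=> [x y|x]; rewrite ?iw // sw.
pose tau v := Posz (d v + 2 * c v).
have [|||||o [ow _ ho]] := @balanced_orient T m m0 (fun x y => w x y) [set: T] tau sw'.
- by move=> b x; rewrite inE.
- by move=> b; rewrite inE.
- exact: hc.
- by move=> a _; rewrite /tau /= oddD oddM addbF.
- rewrite (eq_bigl xpredT) => [|x]; last by rewrite inE.
  rewrite sum_Posz big_split -big_distrr /=; case/dvdnP: dv => t ->.
  by exists (Posz t); rewrite PoszM GRing.add0r.
have o1 u v : o u v = (0 < o u v) :> nat by have := ow u v; case: (w u v) (o u v) => [] [|[|a]] //=; lia.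
exists (fun u v => 0 < o u v); split=> [u v|v]; first by rewrite -!o1 ow.
rewrite (eq_bigr (fun a => o a v)) => [|a _]; last by rewrite -o1.
have [t ht] := ho v (in_setT v); move: ht.
have -> : net o v = (Posz (d v) - Posz (2 * \sum_a o a v))%R.
  have -> : d v = \sum_y o v y + \sum_y o y v by rewrite -big_split /=; apply: eq_bigr => y _; rewrite ow.
  by rewrite /net; clear; lia.
rewrite /tau PoszM; move: (d v) (c v) (\sum_a o a v) => D c0 O e.
have e2 : (Posz (c0 + O) = (- t) * Posz m)%R by move: e; clear; nia.
by rewrite -[_ %| _]/(`|Posz m|%N %| `|Posz (c0 + O)|%N) e2 abszM dvdn_mull.
Qed.

Lemma bip_sum (T : finType) (B : {set T}) (F : rel T) : symmetric F ->
  (forall u v, F u v -> (u \in B) (+) (v \in B)) ->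
  2 * \sum_(v in B) \sum_x (F x v : nat) = \sum_v \sum_x (F x v : nat).
Proof.
move=> sF bip; pose S := \sum_v \sum_x (F x v) * (v \in B).
have -> : \sum_(v in B) \sum_x (F x v : nat) = S.
  rewrite big_mkcond; apply: eq_bigr => v _; case: (v \in B); last by rewrite big1 // => x; rewrite muln0.
  by apply: eq_bigr => x _; rewrite muln1.
have -> : 2 * S = S + \sum_v \sum_x (F x v) * (x \in B).
  rewrite mul2n -addnn; congr (_ + _); rewrite exchange_big.
  by apply: eq_bigr => x _; apply: eq_bigr => v _; rewrite sF.
rewrite -big_split; apply: eq_bigr => v _; rewrite -big_split; apply: eq_bigr => x _ /=.
by have := bip x v; case: (F x v) (x \in B) (v \in B) => [] [] [] //= h; have := h isT.
Qed.

Theorem theorem22 (k l : nat) (T : finType) (g : rel T) :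
  1 < k -> k <= l ->
  symmetric g -> irreflexive g ->
  edge_connected g (112 * (k + l - 1) ^ 2) ->
  (k + l - 1) %| #|edges g| ->
  exists P : {set {set {set T}}}, bistar_decomposition k l g P.
Proof.
move=> k1 kl sg ig cg dg; set m := k + l - 1 in cg dg.
have T1 : 1 < #|T| by case: cg.
have m3 : 3 <= m by rewrite /m; move: k1 kl; clear; lia.
have m0 : 0 < m by move: m3; clear; lia.
have [A hA] : exists A : {set T}, _ := max_cut (conj (fun x y => congr1 nat_of_bool (sg x y)) (fun x => congr1 nat_of_bool (ig x))).
pose cross u v := (u \in A) (+) (v \in A).
have crossC u v : cross u v = cross v u by rewrite /cross addbC.
pose w : rel T := fun u v => g u v && cross u v.
pose h : rel T := fun u v => g u v && ~~ cross u v.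
have sw : symmetric w by move=> u v; rewrite /w sg crossC.
have iw : irreflexive w by move=> u; rewrite /w ig.
have sh : symmetric h by move=> u v; rewrite /h sg crossC.
have ih : irreflexive h by move=> u; rewrite /h ig.
have hw X : separates [set: T] X -> 56 * m ^ 2 <= cut (fun x y => w x y) X.
  move=> sX; rewrite -(@leq_pmul2l 2) // mulnA; apply: leq_trans (cut_edge_connected cg sg sX) _.
  apply: leq_trans (hA X) _; rewrite leq_mul2l /=; apply: cut_le => x y.
  by rewrite /w /cross mulnb.
have [h' [sh' sub dec low]] := greedy_bistars k1 kl sh ih.
have ih' : irreflexive h' by move=> u; apply/negP => /sub; rewrite ih.
have [In [In_le InE]] := exists_owner m0 sh' ih' low.
(* Each half needs connectivity 6m^2, and 3m^2 >= 9m suffices for the part to be oriented, as m >=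
   3; the packing asks for 2 (6 + 6 + 3) m^2 = 30m^2. *)
have [||F1 [F2 [F3 [s1 s2 s3 wE hF]]]] := @pack_three T w (6 * m ^ 2) (6 * m ^ 2) (3 * m ^ 2) _ sw iw.
- by rewrite muln_gt0 expn_gt0 m0.
- by move=> X /hw; clear; lia.
have F1w u v : F1 u v -> w u v by have := wE u v; case: (F1 u v) (w u v) => [] [].
have F2w u v : F2 u v -> w u v by have := wE u v; case: (F2 u v) (w u v) (F1 u v) => [] [] [].
have F3w u v : F3 u v -> w u v by have := wE u v; case: (F3 u v) (w u v) (F1 u v) (F2 u v) => [] [] [] [].
have wx u v : w u v -> cross u v by case/andP.
have InP u v : v \in In u -> h' u v by have := InE u v; case: (h' u v) => // + vu; rewrite vu.
have InC u v : v \in In u -> u \notin In v.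
  by have := InE u v; case: (h' u v) (v \in In u) (u \in In v) => [] [] [].
(* The edges charged to v before F3 is oriented: F1 is charged outside A, F2 inside A, and the inner
   edges to their owners. *)
pose c v := (if v \in A then \sum_a (F2 a v : nat) else \sum_a (F1 a v : nat)) + #|In v|.
have i3 : irreflexive F3 by move=> u; apply/negP => /F3w; rewrite iw.
have [||o [o3 oc]] := @orient_residue T m F3 c m0 s3 i3.
- move=> X sX; have [_ _] := hF X sX; apply: leq_trans; rewrite -mulnn mulnA leq_mul2r.
  by apply/orP; right; move: m3; clear; lia.
- have e1 : 2 * #|edges h'| = 2 * \sum_v #|In v|.
    rewrite card_edges_sym //; under eq_bigr do under eq_bigr do rewrite InE.
    under eq_bigr do rewrite big_split; rewrite big_split /= [X in _ + X]exchange_big /= addnn -mul2n.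
    congr (_ * _); apply: eq_bigr => v _; rewrite sum_pred_card; apply: eq_card => u; by rewrite inE.
  have e2 : 2 * #|edges g| = 2 * #|edges h| + \sum_u \sum_v (w u v : nat).
    rewrite !card_edges_sym // -big_split; apply: eq_bigr => u _; rewrite -big_split.
    by apply: eq_bigr => v _ /=; rewrite /h /w; case: (g u v) (cross u v) => [] [].
  have e3 : \sum_u \sum_v (w u v : nat) = \sum_v \sum_u (F1 u v : nat) + \sum_v \sum_u (F2 u v : nat) + \sum_u \sum_v (F3 u v : nat).
    rewrite exchange_big [X in _ + X]exchange_big -!big_split; apply: eq_bigr => v _ /=.
    by rewrite -!big_split; apply: eq_bigr => u _; apply: wE.
  have e4 : \sum_v c v = \sum_(v in ~: A) \sum_a (F1 a v : nat) + \sum_(v in A) \sum_a (F2 a v : nat) + \sum_v #|In v|.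
    rewrite /c big_split; congr (_ + _); rewrite [LHS](bigID (fun v => v \in A)) /= addnC.
    by congr (_ + _); [apply: eq_big => [v|v /negPf ->] | apply: eq_bigr => v ->]; rewrite ?inE.
  have e5 := bip_sum (B := A) s2 (fun u v Fuv => wx u v (F2w u v Fuv)).
  have e6 : 2 * \sum_(v in ~: A) \sum_x (F1 x v : nat) = \sum_v \sum_x (F1 x v : nat).
    apply: bip_sum => // u v /F1w/wx; rewrite /cross !inE; by case: (u \in A) (v \in A) => [] [].
  have e7 : #|edges h| = #|edges h :\: edges h'| + #|edges h'|.
    have := cardsID (edges h') (edges h); rewrite (setIidPr _) 1?addnC //.
    by apply/subsetP => e /edgesP[u [v [/sub huv ->]]]; rewrite mem_edges.
  (* Apart from F3, each edge not removed by the greedy step is charged once. So the sum counts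
     twice the edges that remain, whose number is a multiple of m because whole bistars of m edges
     were removed. *)
  have -> : \sum_v \sum_x (F3 v x : nat) + 2 * \sum_v c v = 2 * (#|edges g| - #|edges h :\: edges h'|).
    move: e1 e2 e3 e4 e5 e6 e7; clear.
    move: (\sum_v c v) (\sum_v \sum_x (F3 v x : nat)) (#|edges g|) (#|edges h|) (#|edges h'|) => x1 x2 x3 x4 x5.
    move: (#|edges h :\: edges h'|) (\sum_v #|In v|) (\sum_u \sum_v (w u v : nat)) => x6 x7 x8.
    move: (\sum_v \sum_u (F1 u v : nat)) (\sum_v \sum_u (F2 u v : nat)) => x9 x10.
    move: (\sum_(v in ~: A) _) (\sum_(v in A) _) => x11 x12; lia.
  rewrite dvdn_pmul2l // dvdn_sub //; exact: decomposable_card dec.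
have o3w u v : o u v -> F3 u v by have := o3 u v; case: (o u v) (F3 u v) => [] [].
have d1 : decomposable k l (edges (fun u v => if u \in A then F1 u v || o u v else v \in In u)).
  apply: half_decomposable => //.
  - by move=> u v /orP[/F1w|/o3w/F3w]; apply: wx.
  - by move=> u v /o3w; have := wE u v; case: (w u v) (F1 u v) (F2 u v) (F3 u v) => [] [] [] [].
  - move=> u v vu; have /andP[guv nc] := sub _ _ (InP _ _ vu); split; last exact: InC.
      by move: nc; rewrite /cross negb_add => /eqP.
    by apply: contraTneq guv => ->; rewrite ig.
  - by move=> b bA; have := oc b; rewrite /c (negPf bA) addnAC.
  by move=> X /hF[].
have d2 : decomposable k l (edges (fun u v => if u \in ~: A then F2 u v || o u v else v \in In u)).
  apply: half_decomposable => //.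
  - move=> u v; rewrite !inE => Fuv; suff : cross u v by rewrite /cross; case: (u \in A) (v \in A) => [] [].
    by case/orP: Fuv => [/F2w|/o3w/F3w]; apply: wx.
  - by move=> u v /o3w; have := wE u v; case: (w u v) (F1 u v) (F2 u v) (F3 u v) => [] [] [] [].
  - move=> u v vu; have /andP[guv nc] := sub _ _ (InP _ _ vu); split; last exact: InC.
      by move: nc; rewrite !inE /cross negb_add => /eqP ->.
    by apply: contraTneq guv => ->; rewrite ig.
  - by move=> b; rewrite inE negbK => bA; have := oc b; rewrite /c bA addnAC.
  by move=> X /hF[].
set R1 : rel T := fun u v => if u \in A then _ else _ in d1.
set R2 : rel T := fun u v => if u \in ~: A then _ else _ in d2.
have o_w u v : o u v -> w u v by move/o3w/F3w.
have In_cross u v : v \in In u -> cross u v = false by move/InP/sub => /andP[_ /negbTE].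
have R1g u v : R1 u v -> w u v || h' u v.
  by rewrite /R1; case: ifP => [_ /orP[/F1w->|/o_w->]|_ /InP->]; rewrite ?orbT.
have R2g u v : R2 u v -> w u v || h' u v.
  by rewrite /R2; case: ifP => [_ /orP[/F2w->|/o_w->]|_ /InP->]; rewrite ?orbT.
(* An arc of [o] goes to the first half if it leaves A and to the second half if it enters A; an
   inner edge goes to the half of the side containing it. *)
have R12 u v : R1 u v -> ~~ R2 u v && ~~ R2 v u.
  rewrite /R1 /R2 !inE; case: ifP => [uA Fuv|uA vu] /=.
    have wuv : w u v by case/orP: Fuv => [/F1w|/o_w].
    have cuv := wx _ _ wuv; have vA : v \in A = false by move: cuv; rewrite /cross uA; case: (v \in A).
    rewrite vA /=; apply/andP; split; first by apply/negP => /In_cross; rewrite cuv.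
    rewrite [F2 v u]s2; move: Fuv (wE u v) (o3 u v); rewrite wuv.
    by case: (F1 u v) (F2 u v) (F3 u v) (o u v) (o v u) => [] [] [] [] [].
  have cuv := In_cross _ _ vu; have vA : v \in A = false by move: cuv; rewrite /cross uA; case: (v \in A).
  rewrite vA /= !negb_or -!andbA; have nw : w u v = false by rewrite /w cuv andbF.
  have nw' : w v u = false by rewrite sw.
  by apply/and4P; split; apply/negP; [move/F2w | move/o_w | move/F2w | move/o_w]; rewrite ?nw ?nw'.
have R12g u v : w u v || h' u v -> [|| R1 u v, R1 v u, R2 u v | R2 v u].
  rewrite /R1 /R2 !inE; case/orP => [wuv|huv].
    have := wx _ _ wuv; rewrite /cross [F1 v u]s1 [F2 v u]s2; move: (wE u v) (o3 u v); rewrite wuv.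
    by case: (u \in A) (v \in A) (F1 u v) (F2 u v) (F3 u v) (o u v) (o v u) => [] [] [] [] [] [] []; rewrite ?orbT.
  have := InE u v; rewrite huv.
  by case: (v \in In u) (u \in In v) (u \in A) (v \in A) => [] [] [] []; rewrite ?orbT.
have RE : edges R1 :|: edges R2 = edges (fun u v => w u v || h' u v).
  apply/setP => e; rewrite inE; apply/orP/edgesP => [[] /edgesP[u [v [Ruv ->]]]|[u [v [/R12g r ->]]]].
  - by exists u, v; rewrite R1g.
  - by exists u, v; rewrite R2g.
  by case/or4P: r => r; [left|left|right|right]; apply/edgesP; [exists u, v|exists v, u|exists u, v|exists v, u];
    rewrite // setUC.
change (decomposable k l (edges g)); have -> : edges g = (edges h :\: edges h') :|: (edges R1 :|: edges R2).
  apply/setP => e; rewrite RE in_setU in_setD; apply/edgesP/idP => [[u [v [guv ->]]]|].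
    rewrite !mem_edges //; last by move=> x y; rewrite sw sh'.
    by rewrite /w /h guv /=; case: (cross u v); case: (h' u v).
  case/orP => [/andP[_ /edgesP[u [v [/andP[guv _] ->]]]]|/edgesP[u [v [/orP[/andP[guv _]|/sub/andP[guv _]] ->]]]];
  by exists u, v.
apply: decomposableU => //; last first.
  apply: decomposableU => //.
  apply: disjointI => e /edgesP[u [v [/R12/andP[n1 n2] ->]]]; apply/negP => /edgesP[x [y [r]]].
  by case/set2_eq => -[e1 e2]; move: n1 n2; rewrite e1 e2 r.
apply: disjointI => e; rewrite in_setD => /andP[ne /edgesP[u [v [huv ee]]]]; rewrite RE.
rewrite ee in ne *; rewrite mem_edges; last by move=> x y; rewrite sw sh'.
rewrite mem_edges // in ne; rewrite (negPf ne) orbF; move: huv; rewrite /h /w => /andP[-> /negPf ->] //.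
Qed.
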